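(* Let $(R,\mathfrak m)$ be a Cohen–Macaulay local ring of dimension one with a canonical ideal, and assume $R$ is not a discrete valuation ring. Let $Q$ be the total ring of fractions of $R$, let $A=\mathfrak m:_Q\mathfrak m=\mathrm{Hom}_R(\mathfrak m,\mathfrak m)$, and suppose that $A$ is a local ring with maximal ideal $M$. Let $e=[A/M:R/\mathfrak m]$ and let $r=r(R)$ be the Cohen–Macaulay type of $R$. Then $$\mathrm{cdeg}(A)=e^{-1}\bigl[\mathrm{cdeg}(R)+\mathrm e_0(\mathfrak m)-2r\bigr].$$
   Context: $\mathfrak m:_Q\mathfrak m=\{q\in Q: q\mathfrak m\subseteq\mathfrak m\}$. A canonical ideal is an ideal isomorphic to a canonical module. For a one-dimensional Cohen–Macaulay local ring $B$ with canonical ideal $D$, the canonical degree is $\mathrm{cdeg}(B)=\mathrm e_0(D)-\lambda_B(B/D)$, where $\mathrm e_0(D)$ is the Hilbert–Samuel multiplicity of $B$ with respect to $D$ (equal to $0$ if $D=B$) and $\lambda$ is length; this is independent of the choice of $D$. $\mathrm e_0(\mathfrak m)$ is the multiplicity of $R$. *)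

(* Defs.v *)
From HB Require Import structures.
From mathcomp Require Import all_boot all_order all_algebra.
From mathcomp Require Import boolp classical_sets functions.

Set Implicit Arguments.
Unset Strict Implicit.
Unset Printing Implicit Defensive.
Import GRing.Theory.
Local Open Scope classical_set_scope.
Local Open Scope ring_scope.

(* Submodules and ideals are sets ([V -> Prop]); numerical invariants are total
   functions, given by [xget] from the relation that defines them, with the
   default value 0 when no number satisfies that relation. *)

Identity Coercion set_fun : set >-> Funclass.

Section Modules.
Variables (R : comNzRingType) (V : lmodType R).
Implicit Types (N P : set V).

Definition is_submodule N : Prop :=
  N 0 /\ forall (a : R) u v, N u -> N v -> N (a *: u + v).

Definition span (S : set V) : set V :=
  [set v | forall N, is_submodule N -> S `<=` N -> N v].

Definition fin_gen N : Prop :=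
  exists (n : nat) (g : 'I_n -> V), N = span (range g).

(* Strict chains of length [n] of submodules of V / N. *)
Definition has_chain N (n : nat) : Prop :=
  exists c : nat -> set V,
    [/\ forall i, (i <= n)%N -> is_submodule (c i) /\ N `<=` c i &
        forall i, (i < n)%N -> c i `<` c i.+1].

(* The length of V / N. *)
Definition is_colength N (n : nat) : Prop :=
  has_chain N n /\ forall k, has_chain N k -> (k <= n)%N.

Definition colength N : nat := xget 0%N (is_colength N).

(* [s] is a regular sequence on V / N, including V / (N + (s) V) <> 0. *)
Fixpoint regular_seq N (s : seq R) : Prop :=
  if s is x :: s' then
    (forall v, N (x *: v) -> N v) /\
    regular_seq [set u | exists n v, N n /\ u = n + x *: v] s'
  else N <> setT.

End Modules.

Section Ideals.
Variable R : comNzRingType.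

Record ideal := Ideal {
  ideal_set :> set R;
  ideal_submodule : @is_submodule R R^o ideal_set }.

Implicit Types I J m : ideal.

Definition maximal_ideal m : Prop :=
  ~ m 1 /\ forall I, (m : set R) `<` I -> I 1.

Definition is_prime I : Prop :=
  ~ I 1 /\ forall x y, I (x * y) -> I x \/ I y.

Definition local_ring m : Prop :=
  maximal_ideal m /\
  forall I, maximal_ideal I -> (I : set R) = m.

Definition noetherian : Prop := forall I, @fin_gen R R^o I.

Definition has_prime_chain (n : nat) : Prop :=
  exists p : nat -> ideal,
    (forall i, (i <= n)%N -> is_prime (p i)) /\
    (forall i, (i < n)%N -> (p i : set R) `<` p i.+1).

Definition krull_dim (n : nat) : Prop :=
  has_prime_chain n /\ forall k, has_prime_chain k -> (k <= n)%N.

Definition regular_in (m : ideal) (V : lmodType R) (s : seq R) : Prop :=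
  (forall x, x \in s -> m x) /\ regular_seq [set (0 : V)] s.

Definition depth (m : ideal) (V : lmodType R) (n : nat) : Prop :=
  (exists s, size s = n /\ regular_in m V s) /\
  forall s, regular_in m V s -> (size s <= n)%N.

Definition cm_local_dim1 m : Prop :=
  [/\ local_ring m, noetherian, krull_dim 1 & depth m R^o 1].

(* A local ring is a discrete valuation ring when it is a principal ideal
   domain that is not a field. *)
Definition is_dvr m : Prop :=
  [/\ forall x y : R, x * y = 0 -> x = 0 \/ y = 0,
      forall I, exists a : R, (I : set R) = [set x * a | x in setT] &
      (m : set R) <> [set 0]].

Fixpoint ideal_pow I (n : nat) : set R :=
  if n is n'.+1 then
    @span R R^o [set z | exists x y, [/\ I x, ideal_pow I n' y & z = x * y]]
  else setT.

(* In dimension one, e_0(I) is the leading coefficient of the polynomial that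
   gives the length of R / I^n for n >> 0; for I = R it is 0. *)
Definition is_multiplicity I (e : nat) : Prop :=
  exists (c : int) (n0 : nat), forall n : nat, (n0 <= n)%N ->
    (@colength R R^o (ideal_pow I n))%:Z = e%:Z * n%:Z - c.

Definition multiplicity I : nat := xget 0%N (is_multiplicity I).

End Ideals.

Section TypeOfModule.
Variables (R : comNzRingType) (m : ideal R).

(* Dimension over R/m of a subquotient P/N with N `<=` P and m P `<=` N: the
   size of a family in P whose classes form a basis. *)
Definition is_residue_dim (V : lmodType R) (P N : set V) (n : nat) : Prop :=
  exists v : 'I_n -> V,
    [/\ forall i, P (v i),
        forall u, P u -> exists c : 'I_n -> R, N (u - \sum_i c i *: v i) &
        forall c : 'I_n -> R, N (\sum_i c i *: v i) -> forall i, m (c i)].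

Definition residue_dim (V : lmodType R) (P N : set V) : nat :=
  xget 0%N (is_residue_dim P N).

(* Ext^1_R(R/m, V) computed from 0 -> m -> R -> R/m -> 0, that is, the cokernel
   of the restriction Hom_R(R, V) -> Hom_R(m, V). An element of Hom_R(m, V) is
   carried by a function R -> V that is linear on m; its values outside m are
   killed by the quotient, as [ext1_den] contains all functions vanishing
   on m. *)
Definition ext1_num (V : lmodType R) : set (R -> V) :=
  [set f | forall a x y, m x -> m y -> f (a * x + y) = a *: f x + f y].

Definition ext1_den (V : lmodType R) : set (R -> V) :=
  [set f | exists v : V, forall x, m x -> f x = x *: v].

(* The Cohen-Macaulay type dim_{R/m} Ext^t(R/m, V), t = depth V, of a module of
   depth t = 1. *)
Definition cm_type (V : lmodType R) : nat :=
  residue_dim (@ext1_num V) (@ext1_den V).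

End TypeOfModule.

Section Canonical.
Variable R : comNzRingType.

Definition injective_module (E : lmodType R) : Prop :=
  forall (U W : lmodType R) (f : {linear U -> W}) (g : {linear U -> E}),
    injective f -> exists h : {linear W -> E}, forall u, h (f u) = g u.

(* There is an exact sequence 0 -> C -> E_0 -> ... -> E_n -> 0 with every E_i
   injective. *)
Fixpoint injdim_le (n : nat) (C : lmodType R) : Prop :=
  if n is n'.+1 then
    exists (E B : lmodType R) (f : {linear C -> E}) (g : {linear E -> B}),
      [/\ injective_module E, injective f,
          forall x, g x = 0 <-> range f x,
          range g = setT & injdim_le n' B]
  else injective_module C.

(* A canonical module of a one-dimensional Cohen-Macaulay local ring is a
   maximal Cohen-Macaulay module of type one and finite injective dimension. *)
Definition canonical_module (m : ideal R) (C : lmodType R) : Prop :=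
  [/\ fin_gen [set: C], depth m C 1, cm_type m C = 1%N &
      exists n, injdim_le n C].

Definition canonical_ideal (m D : ideal R) : Prop :=
  exists (C : lmodType R) (f : {linear C -> R^o}),
    [/\ canonical_module m C, injective f & range f = (D : set R)].

Definition is_cdeg (m : ideal R) (c : int) : Prop :=
  exists D, canonical_ideal m D /\
    c = (multiplicity D)%:Z - (@colength R R^o D)%:Z.

Definition cdeg (m : ideal R) : int := xget 0 (is_cdeg m).

End Canonical.

Section TotalFractions.
Variables (R : comNzRingType) (Q : comAlgType R).

Definition nonzerodivisor (s : R) : Prop := forall x, s * x = 0 -> x = 0.

Definition total_fractions : Prop :=
  [/\ forall a : R, a%:A = 0 :> Q -> a = 0,
      forall s, nonzerodivisor s -> exists q : Q, s%:A * q = 1 &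
      forall q : Q, exists a s, nonzerodivisor s /\ s%:A * q = a%:A].

End TotalFractions.

(* The ring I :_Q I, as an R-subalgebra of Q. *)
Section Colon.
Variables (R : comNzRingType) (Q : comAlgType R) (I : ideal R).

Definition colon : {pred Q} :=
  fun q => `[< forall x, I x -> exists2 y, I y & q * x%:A = y%:A >].

Lemma colon_subalg_closed : subalg_closed colon.
Proof.
split.
- by apply/asboolP => x Ix; exists x; rewrite ?mul1r.
- move=> a u v /asboolP uI /asboolP vI; apply/asboolP => x Ix.
  have [y Iy ey] := uI x Ix; have [z Iz ez] := vI x Ix.
  exists (a * y + z); first exact: (ideal_submodule I).2.
  by rewrite mulrDl ez scalerDl -scalerA -ey scalerAl.
- move=> u v /asboolP uI /asboolP vI; apply/asboolP => x Ix.
  have [y Iy ey] := vI x Ix; have [z Iz ez] := uI y Iy.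
  by exists z => //; rewrite -mulrA ey.
Qed.

HB.instance Definition _ :=
  GRing.isSubalgClosed.Build R Q colon colon_subalg_closed.

Record colon_ring := ColonRing {
  colon_val :> Q;
  colon_valP : colon_val \in colon }.

HB.instance Definition _ := [isSub for colon_val].
HB.instance Definition _ := [Choice of colon_ring by <:].
HB.instance Definition _ := [SubChoice_isSubComNzRing of colon_ring by <:].
HB.instance Definition _ := [SubZmodule_isSubLmodule of colon_ring by <:].
HB.instance Definition _ := [SubNzRing_SubLmodule_isSubLalgebra of colon_ring by <:].
HB.instance Definition _ := [SubLalgebra_isSubAlgebra of colon_ring by <:].

End Colon.

(* [A/M : R/m], for an R-algebra A. *)
Definition residue_degree (R : comNzRingType) (m : ideal R)
    (A : comAlgType R) (M : ideal A) : nat :=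
  residue_dim m [set: A] M.

(* Main.v *)
Require Import Defs.
From HB Require Import structures.
From mathcomp Require Import all_boot all_order all_algebra.
From mathcomp Require Import generic_quotient ring_quotient.
From mathcomp Require Import boolp classical_sets functions.
From mathcomp Require Import ring zify.

(** The canonical degrees of [R] and of [A = m : m] are compared through one
    ideal, [K = m D] for a canonical ideal [D] of [R], which is an ideal of both
    rings and turns out to be canonical for [A].

    Duality. Say that a fractional ideal [D] has type one when [(D : m) / D] has
    length one. A simple extension [J] of [I] then changes [D : I] by length at
    most one; between [z J] and [J] nothing can be lost, because scaling by the
    regular element [z] gives both sides the same length, so equality holds
    throughout. Hence [J |-> D : J] preserves lengths and is an involution
    ([dual_lgt], [dualK]). It follows that two such ideals differ by a unit of
    [Q] ([type_one_unique]), and that [(R : m) / R] has the same length as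
    [D / m D] ([type_generators]).

    Canonical ideals are the integral ideals of type one. If [D] is canonical,
    finite injective dimension kills [Ext^2] on modules of finite length; this
    makes [D] faithful ([injdim_faithful]), so that [D] contains a regular
    element and its type can be read off in [Q] ([canonical_type_one]).
    Conversely, if [D] has type one then [Q] and [Q / D] are injective by Baer's
    criterion, duality supplying the extensions one simple step at a time
    ([quotient_injective], [fractions_injective]), and [0 -> D -> Q -> Q / D -> 0]
    is an injective resolution ([type_one_canonical]).

    Multiplicities. The residue field may be finite, so a reduction of an ideal
    [L] is looked for in some power of [L]. In the fibre ring, the direct sum of
    the [L ^ n / m L ^ n], take a largest family of orthogonal non-nilpotent
    elements of one positive degree [a]; its sum [y] satisfies
    [L ^ (n + a) = y L ^ n] for large [n] ([orthogonal_reduction]). The same is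
    true in degree [a + 1], which makes the successive differences of the lengths
    of [R / L ^ n] constant ([exists_hilbert_slope]), and [a] times the
    multiplicity of [L] is the length of [R / y R] ([reduction_slope]). Since
    reductions of equal degree multiply, multiplicities add up in products of
    ideals ([hilbert_slope_prodq]).

    The computation. Because [R] is not a discrete valuation ring, [A] equals
    [R : m], which is [D : m D]; dually [D : A = m D] ([product_dual]). Dualizing
    the inclusion of the maximal ideal [M] in [A] shows that [m D] has type one
    over [A] ([product_type_one]), so [cdeg A = e_0(m D) - length_A (A / m D)].
    Let [e] be the degree of [A / M] over [R / m]. Lengths over [R] are [e] times
    lengths over [A] ([lgt_restrict]). Filtering [A / m D] by [A], [R], [D], [m D]
    gives [e] times its length over [A] as [2 r + length_R (R / D)]
    ([colength_over]), and [e] times the multiplicity of [m D] over [A] is its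
    multiplicity over [R], that is [e_0(m) + e_0(D)] ([multiplicity_over]).
    Subtracting gives the formula. *)

Set Implicit Arguments.
Unset Strict Implicit.
Unset Printing Implicit Defensive.
Import Defs GRing.Theory.
Local Open Scope classical_set_scope.
Local Open Scope ring_scope.

(** * Submodules and composition series *)

Section Submodules.
Variables (R : comNzRingType) (V : lmodType R).
Implicit Types (N P L X Y S : set V).

Lemma submod0 N : is_submodule N -> N 0. Proof. by case. Qed.

Lemma submodZ N a u : is_submodule N -> N u -> N (a *: u).
Proof. by move=> [N0 NL] Nu; rewrite -[_ *: _]addr0; apply: NL. Qed.

Lemma submodD N u v : is_submodule N -> N u -> N v -> N (u + v).
Proof. by move=> [N0 NL] Nu Nv; rewrite -[u]scale1r; apply: NL. Qed.

Lemma submodN N u : is_submodule N -> N u -> N (- u).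
Proof. by move=> sN Nu; rewrite -scaleN1r; apply: submodZ. Qed.

Lemma submodB N u v : is_submodule N -> N u -> N v -> N (u - v).
Proof. by move=> sN Nu Nv; apply: submodD => //; apply: submodN. Qed.

Lemma submod_sum N (I : finType) (F : I -> V) :
  is_submodule N -> (forall i, N (F i)) -> N (\sum_i F i).
Proof.
move=> sN NF; elim/big_rec: _ => [|i x _ Nx]; first exact: submod0.
exact: submodD.
Qed.

Lemma submod_addK N u v : is_submodule N -> N v -> N (u + v) -> N u.
Proof. by move=> sN Nv Nuv; rewrite -(addrK v u); apply: submodB. Qed.

Lemma span_submod S : is_submodule (span S).
Proof.
split=> [N [N0 _] _ //|a u v su sv N sN SN].
by apply: sN.2; [apply: su | apply: sv].
Qed.

Lemma span_ext S : S `<=` span S.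
Proof. by move=> v Sv N _; apply. Qed.

Lemma span_min S N : is_submodule N -> S `<=` N -> span S `<=` N.
Proof. by move=> sN SN v; apply. Qed.

Definition addS N P : set V := [set u | exists2 v, P v & N (u - v)].

Lemma addS_submod N P : is_submodule N -> is_submodule P ->
  is_submodule (addS N P).
Proof.
move=> sN sP; split; first by exists 0; [case: sP | rewrite subr0; case: sN].
move=> a u v [u' Pu Nu] [v' Pv Nv]; exists (a *: u' + v').
  by apply: sP.2.
by rewrite opprD addrACA -scalerBr; apply: sN.2.
Qed.

Lemma addSl N P : is_submodule P -> N `<=` addS N P.
Proof. by move=> sP u Nu; exists 0; [case: sP | rewrite subr0]. Qed.

Lemma addSr N P : is_submodule N -> P `<=` addS N P.
Proof. by move=> sN u Pu; exists u; rewrite ?subrr //; case: sN. Qed.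

Lemma addS_min N P L : is_submodule L -> N `<=` L -> P `<=` L -> addS N P `<=` L.
Proof.
move=> sL NL PL u [v Pv Nuv]; rewrite -(subrK v u).
by apply: submodD => //; [apply: NL | apply: PL].
Qed.

Definition adjoin P v : set V := [set u | exists a, P (u - a *: v)].

Lemma adjoin_submod P v : is_submodule P -> is_submodule (adjoin P v).
Proof.
move=> sP; split; first by exists 0; rewrite scale0r subr0; case: sP.
move=> a u w [b Pu] [c Pw]; exists (a * b + c).
rewrite scalerDl -scalerA opprD addrACA -scalerBr.
exact: sP.2.
Qed.

Lemma adjoin_ext P v : P `<=` adjoin P v.
Proof. by move=> u Pu; exists 0; rewrite scale0r subr0. Qed.

Lemma adjoin_in P v : is_submodule P -> adjoin P v v.
Proof. by move=> [P0 _]; exists 1; rewrite scale1r subrr. Qed.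

Lemma adjoin_min P v L : is_submodule L -> P `<=` L -> L v ->
  adjoin P v `<=` L.
Proof.
move=> sL PL Lv u [a Pu]; rewrite -(subrK (a *: v) u).
by apply: submodD => //; [apply: PL | apply: submodZ].
Qed.

Lemma setI_submod N P : is_submodule N -> is_submodule P ->
  is_submodule (N `&` P).
Proof.
move=> sN sP; split; first by split; apply: submod0.
by move=> a u v [? ?] [? ?]; split; [apply: sN.2 | apply: sP.2].
Qed.

Lemma setT_submod : is_submodule [set: V]. Proof. by []. Qed.

End Submodules.

Section Ideals.
Variable R : comNzRingType.

Lemma regZ (a : R) (x : R^o) : a *: x = a * x. Proof. by []. Qed.

Lemma submodMl (N : set R^o) (a b : R) : is_submodule N -> N b -> N (a * b).
Proof. by move=> sN Nb; exact: (submodZ a sN Nb). Qed.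

Lemma principal_submod (z : R) :
  is_submodule ([set z * x | x in [set: R]] : set R^o).
Proof.
split; first by exists 0; rewrite ?mulr0.
move=> a _ _ [b _ <-] [c _ <-]; exists (a * b + c) => //.
by rewrite mulrDr mulrCA.
Qed.

End Ideals.

(** Linearity of an unbundled function: most maps below are multiplications by an
    element of [Q]. *)
Definition lin (R : comNzRingType) (V W : lmodType R) (f : V -> W) : Prop :=
  forall a u v, f (a *: u + v) = a *: f u + f v.

Section Lin.
Variables (R : comNzRingType) (V W : lmodType R) (f : V -> W).
Hypothesis finite_length : lin f.

Lemma linB u v : f (u - v) = f u - f v.
Proof. by rewrite addrC -scaleN1r finite_length scaleN1r addrC. Qed.
Lemma lin0 : f 0 = 0.
Proof. by rewrite -[X in f X](subrr 0) linB subrr. Qed.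
Lemma linZ a u : f (a *: u) = a *: f u.
Proof. by rewrite -[X in f X]addr0 finite_length lin0 addr0. Qed.
Lemma linD u v : f (u + v) = f u + f v.
Proof. by rewrite -[X in f (X + _)]scale1r finite_length scale1r. Qed.

Lemma preimage_submod (N : set W) : is_submodule N -> is_submodule (f @^-1` N).
Proof.
move=> sN; split; first by rewrite /preimage /= lin0; case: sN.
by move=> a u v /= Nu Nv; rewrite /preimage /= finite_length; apply: sN.2.
Qed.

Lemma image_submod (N : set V) : is_submodule N -> is_submodule (f @` N).
Proof.
move=> sN; split; first by exists 0; rewrite ?lin0 //; case: sN.
move=> a _ _ [u Nu <-] [v Nv <-]; exists (a *: u + v); rewrite ?finite_length //.
exact: sN.2.
Qed.

Lemma image_span (S : set V) : f @` span S = span (f @` S).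
Proof.
apply/seteqP; split=> [_ [u su <-]|].
  apply: (su (f @^-1` span (f @` S))); first exact/preimage_submod/span_submod.
  by move=> v Sv; apply: span_ext; exists v.
apply: span_min; first exact/image_submod/span_submod.
by move=> _ [u Su <-]; exists u => //; apply: span_ext.
Qed.
End Lin.

(** What is used of a local ring; the form does not mention other ideals. *)
Definition local_units (R : comNzRingType) (m : ideal R) : Prop :=
  ~ m 1 /\ forall x, ~ m x -> exists y, y * x = 1.

Section Composition.
Variables (R : comNzRingType) (m : ideal R).

(** Composition series, built upwards from [N]. Over a local ring a factor is
    simple exactly when one element killed by [m] generates it. *)
Inductive cser (V : lmodType R) (N : set V) : set V -> nat -> Prop :=
| cser0 : cser N N 0
| cserS P n v : cser N P n -> ~ P v -> (forall a, m a -> P (a *: v)) ->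
    cser N (adjoin P v) n.+1.

Section OneModule.
Variable V : lmodType R.
Implicit Types (N P L X Y : set V).

Lemma cser_sub N P n : is_submodule N -> cser N P n ->
  is_submodule P /\ N `<=` P.
Proof.
move=> sN; elim=> [|P' n' v _ [sP NP] _ _]; first by split.
split; first exact: adjoin_submod.
by move=> u /NP; apply: adjoin_ext.
Qed.

Lemma cser_trans N L P a b : cser N L a -> cser L P b -> cser N P (a + b).
Proof.
move=> cNL; elim=> [|P' n' v _ IH Pv mv]; first by rewrite addn0.
by rewrite addnS; apply: cserS.
Qed.

End OneModule.

(** Covers both the second isomorphism theorem ([f] the identity) and the
    transport of lengths along multiplications. *)
Lemma cser_push (V W : lmodType R) (f : V -> W) (X Y : set V) (L : set W) n :
  lin f -> is_submodule X -> is_submodule L -> f @` X `<=` L ->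
  (forall u, Y u -> L (f u) -> X u) -> cser X Y n -> cser L (addS L (f @` Y)) n.
Proof.
move=> fL sX sL XL + c; elim: c => [|P k v c IH Pv mv] LYX.
  suff -> : addS L (f @` X) = L by apply: cser0.
  apply/seteqP; split; first exact: addS_min.
  by apply: addSl; exact: image_submod.
have [sP XP] := cser_sub sX c; have sfP := image_submod fL sP.
have sPv := adjoin_submod v sP; have sfPv := image_submod fL sPv.
have {}IH : cser L (addS L (f @` P)) k.
  by apply: IH => u Pu; apply: LYX; apply: adjoin_ext.
have sLP := addS_submod sL sfP.
have -> : addS L (f @` adjoin P v) = adjoin (addS L (f @` P)) (f v).
  apply/seteqP; split.
    apply: addS_min; first exact: adjoin_submod.
      by move=> u Lu; apply: adjoin_ext; apply: addSl.
    move=> _ [u [a Pu] <-]; exists a; rewrite -(linZ fL) -(linB fL).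
    by apply: addSr => //; exists (u - a *: v).
  apply: adjoin_min; first exact: addS_submod.
    apply: addS_min; [exact: addS_submod|exact: addSl|].
    by move=> _ [u Pu <-]; apply: addSr => //; exists u => //; apply: adjoin_ext.
  by apply: addSr => //; exists v => //; apply: adjoin_in.
apply: cserS => // [[_ [p Pp <-] Lvp]|a ma]; last first.
  by apply: addSr => //; exists (a *: v); [apply: mv | rewrite (linZ fL)].
apply: Pv; rewrite -(subrK p v); apply: submodD => //; apply: XP; apply: LYX.
  by apply: (submodB sPv); [exact: adjoin_in | exact: adjoin_ext].
by rewrite (linB fL).
Qed.

Section Lengths.
Variable V : lmodType R.
Implicit Types (N P L X Y : set V).
Hypothesis locm : local_units m.

(** The Jordan-Hoelder theorem in the form needed: intersecting a series with [L]
    and adding [L] to it, each factor goes to exactly one of the two parts. *)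
Lemma cser_split N P L n : is_submodule N -> is_submodule L ->
  N `<=` L -> L `<=` P -> cser N P n ->
  exists a b, [/\ (a + b)%N = n, cser N L a & cser L P b].
Proof.
move=> sN sL NL + c; elim: c L sL NL => [|P' k v c IH Pv mv] L sL NL LP.
  exists 0%N, 0%N; have -> : L = N by apply/seteqP; split.
  by split=> //; apply: cser0.
have [sP NP] := cser_sub sN c.
have sI := setI_submod sL sP.
have [|a [b [eab cI cb]]] := IH (L `&` P') sI _ (@subIsetr _ _ _).
  by move=> u Nu; split; [apply: NL | apply: NP].
have [LP'|/existsNP[w /not_implyP[Lw Pw]]] := pselect (L `<=` P').
  have eL : L `&` P' = L by apply/seteqP; split=> [u []//|u Lu]; split=> //; apply: LP'.
  rewrite eL in cI cb.
  by exists a, b.+1; split; rewrite ?addnS ?eab //; apply: cserS.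
have [al Pwal] := LP w Lw.
have mal : ~ m al.
  by move=> /mv Pal; apply: Pw; rewrite -(subrK (al *: v) w); apply: submodD.
have [be ebe] := locm.2 al mal.
exists a.+1, b; split; first by rewrite addSn eab.
  have -> : L = adjoin (L `&` P') w.
    apply/seteqP; split; last by apply: adjoin_min => //; apply: subIsetl.
    move=> u Lu; have [c' Pu] := LP u Lu; exists (c' * be); split.
      by apply: submodB => //; apply: submodZ.
    have -> : u - (c' * be) *: w = (u - c' *: v) - (c' * be) *: (w - al *: v).
      rewrite scalerBr scalerA -mulrA ebe mulr1.
      by rewrite opprB addrA subrK.
    by apply: submodB => //; apply: submodZ.
  apply: cserS => // [[_ //]|x mx]; split; first exact: submodZ.
  rewrite -(subrK (al *: v) w) scalerDr; apply: submodD => //.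
    exact: submodZ.
  by rewrite scalerA mulrC -scalerA; apply: submodZ => //; apply: mv.
have <- : addS L P' = adjoin P' v.
  apply/seteqP; split.
    by apply: addS_min => //; [apply: adjoin_submod | apply: adjoin_ext].
  apply: adjoin_min; [exact: addS_submod|exact: addSr|].
  have -> : v = be *: w - be *: (w - al *: v).
    by rewrite scalerBr opprB addrC scalerA ebe scale1r subrK.
  apply: submodB; first exact: addS_submod.
    by apply: addSl => //; apply: submodZ.
  by apply: addSr => //; apply: submodZ.
rewrite -[X in addS L X]image_id.
by apply: (cser_push (f := id) _ sI sL) cb => //; rewrite image_id; apply: subIsetl.
Qed.

Lemma cser_eq0 N P : is_submodule N -> cser N P 0 -> N = P.
Proof. by move=> sN c; inversion c. Qed.

Lemma chain_mono (c : nat -> set V) i k :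
  (forall j, (j < k)%N -> c j `<` c j.+1) -> (i <= k)%N -> c i `<=` c k.
Proof.
move=> cl; elim: k cl => [|k IH] cl; first by rewrite leqn0 => /eqP->.
rewrite leq_eqVlt => /orP[/eqP->//|ik].
apply: (subset_trans (IH _ ik)) => [j jk|]; first by apply: cl; apply: leqW.
by case: (cl k (ltnSn k)).
Qed.

(** Cut the series at the last but one term of the chain; the strict step above it
    uses up at least one factor. *)
Lemma cser_chain (c : nat -> set V) N P n k : is_submodule N -> cser N P n ->
  (forall i, (i <= k)%N -> [/\ is_submodule (c i), N `<=` c i & c i `<=` P]) ->
  (forall i, (i < k)%N -> c i `<` c i.+1) -> (k <= n)%N.
Proof.
move=> sN; elim: k P n => // k IH P n cNP cs cl.
have [s1 N1 P1] := cs k (leqnSn k); have [s2 N2 P2] := cs k.+1 (leqnn _).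
have [a [b [<- ca cb]]] := cser_split sN s1 N1 P1 cNP.
have ka : (k <= a)%N.
  apply: (IH (c k)) => // [i ik|i ik]; last by apply: cl; rewrite ltnW.
  have [si Ni _] := cs i (leqW ik); split=> //.
  by apply: chain_mono ik => j jk; apply: cl; apply: leqW.
case: b cb => [|b] cb; last by rewrite addnS ltnS (leq_trans ka) ?leq_addr.
have e := cser_eq0 s1 cb; have [_ ne] := cl k (ltnSn k).
by case: ne; rewrite e.
Qed.

Lemma cser_has_chain N P n : is_submodule N -> cser N P n ->
  exists c : nat -> set V, [/\ forall i, is_submodule (c i) /\ N `<=` c i,
    forall i, (i < n)%N -> c i `<` c i.+1 & forall i, (n <= i)%N -> c i = P].
Proof.
move=> sN; elim=> [|P' k v c [ch [cs cl ce]] Pv mv].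
  by exists (fun=> N); split=> // i; split=> // u.
have [sP NP] := cser_sub sN c.
exists (fun i => if (i <= k)%N then ch i else adjoin P' v); split=> [i|i|i].
- case: ifP => _ //; split; first exact: adjoin_submod.
  by move=> u /NP; apply: adjoin_ext.
- rewrite ltnS => lt; case: (ltngtP i k) lt => // [ik _|-> _]; first exact: cl.
  rewrite ce //; split; first exact: adjoin_ext.
  by move=> /(_ v (adjoin_in v sP)).
- by case: leqP.
Qed.

Lemma cser_le N P n k : is_submodule N -> cser N P n -> cser N P k -> (k <= n)%N.
Proof.
move=> sN cn ck; have [c [cs cl ce]] := cser_has_chain sN ck.
apply: (cser_chain (c := c) sN cn) => // i ik; have [si Ni] := cs i; split=> //.
rewrite -(ce k (leqnn k)).
exact: chain_mono ik.
Qed.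

Lemma cser_uniq N P n k : is_submodule N -> cser N P n -> cser N P k -> n = k.
Proof.
move=> sN cn ck; apply/eqP; rewrite eqn_leq.
by rewrite (cser_le sN cn ck) (cser_le sN ck cn).
Qed.

Lemma cser_colength N n : is_submodule N -> cser N setT n -> colength N = n.
Proof.
move=> sN c; have H : is_colength N n.
  split.
    have [ch [cs cl ce]] := cser_has_chain sN c.
    by exists ch; split=> // i _; apply: cs.
  move=> k [ch [cs cl]]; apply: (cser_chain (c := ch) sN c) => // i ik.
  by have [] := cs i ik.
rewrite /colength; apply: xget_unique => // k [hk bk].
by apply/eqP; rewrite eqn_leq H.2 // bk //; case: H.
Qed.

Definition lgt N P : nat := xget 0%N (cser N P).
Definition finite_length N P : Prop := exists n, cser N P n.

Lemma lgtE N P n : is_submodule N -> cser N P n -> lgt N P = n.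
Proof.
by move=> sN c; apply: xget_unique => // k ck; apply: cser_uniq sN ck c.
Qed.

Lemma flP N P : finite_length N P -> cser N P (lgt N P).
Proof. by move=> h; rewrite /lgt; apply: xgetPex. Qed.

Lemma lgt_add N L P : is_submodule N -> finite_length N L -> finite_length L P ->
  lgt N P = (lgt N L + lgt L P)%N.
Proof.
move=> sN /flP c1 /flP c2; apply: lgtE => //; exact: cser_trans c1 c2.
Qed.

Lemma fl_split N L P : is_submodule N -> is_submodule L -> N `<=` L ->
  L `<=` P -> finite_length N P -> finite_length N L /\ finite_length L P.
Proof.
move=> sN sL NL LP [n c]; have [a [b [_ ca cb]]] := cser_split sN sL NL LP c.
by split; [exists a | exists b].
Qed.

Lemma lgt_eq0 N P : is_submodule N -> finite_length N P -> lgt N P = 0%N -> N = P.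
Proof. by move=> sN /flP + e; rewrite e; apply: cser_eq0. Qed.

Lemma lgt_refl N : is_submodule N -> lgt N N = 0%N.
Proof. by move=> sN; apply: lgtE => //; apply: cser0. Qed.

End Lengths.

Lemma cser_image (V W : lmodType R) (f : V -> W) (N P : set V) n :
  lin f -> injective f -> is_submodule N -> cser N P n ->
  cser (f @` N) (f @` P) n.
Proof.
move=> fL fI sN; elim=> [|P' k v c IH Pv mv]; first exact: cser0.
have [sP _] := cser_sub sN c.
have -> : f @` adjoin P' v = adjoin (f @` P') (f v).
  apply/seteqP; split=> [_ [u [a Pu] <-]|w [a [u Pu e]]].
    by exists a; exists (u - a *: v); rewrite ?(linB fL) ?(linZ fL).
  exists (u + a *: v); last by rewrite (linD fL) ?(linZ fL) // e subrK.
  by exists a; rewrite addrK.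
apply: cserS => // [[u Pu /fI e]|a ma]; first by apply: Pv; rewrite -e.
by exists (a *: v); [apply: mv | rewrite (linZ fL)].
Qed.

Lemma cser_preimage (V W : lmodType R) (f : V -> W) (N P : set W) n :
  lin f -> is_submodule N -> P `<=` range f -> cser N P n ->
  cser (f @^-1` N) (f @^-1` P) n.
Proof.
move=> fL sN + c; elim: c => [|P' k v c IH Pv mv] Pf; first exact: cser0.
have [sP _] := cser_sub sN c.
have [v' _ ev] := Pf v (adjoin_in v sP).
have -> : f @^-1` adjoin P' v = adjoin (f @^-1` P') v'.
  apply/seteqP; split=> u [a].
    by move=> Pu; exists a; rewrite /preimage /= (linB fL) ?(linZ fL) ?ev.
  by rewrite /preimage /= (linB fL) // (linZ fL) // ev => Pu; exists a.
apply: cserS; rewrite /preimage /= ?ev //.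
  by apply: IH => w Pw; apply: Pf; apply: adjoin_ext.
by move=> a ma; rewrite (linZ fL) // ev; apply: mv.
Qed.

End Composition.

(** * Residue dimensions and Noetherian modules *)

Lemma widen_lift n (j : 'I_n) : widen_ord (leqnSn n) j = lift ord_max j.
Proof. by apply: val_inj; rewrite /= /bump leqNgt ltn_ord. Qed.

Section ResidueDimension.
Variables (R : comNzRingType) (m : ideal R) (locm : local_units m).

Section Families.
Variable V : lmodType R.
Implicit Types (N P : set V).

Definition span_mod N n (v : 'I_n -> V) : set V :=
  [set u | exists c : 'I_n -> R, N (u - \sum_i c i *: v i)].

Definition indep_mod N n (v : 'I_n -> V) : Prop :=
  forall c : 'I_n -> R, N (\sum_i c i *: v i) -> forall i, m (c i).

Lemma span_mod0 N (v : 'I_0 -> V) : span_mod N v = N.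
Proof.
apply/seteqP; split=> u; first by case=> c; rewrite big_ord0 subr0.
by exists (fun=> 0); rewrite big_ord0 subr0.
Qed.

Lemma span_modS N n (v : 'I_n.+1 -> V) :
  span_mod N v = adjoin (span_mod N (fun i => v (widen_ord (leqnSn n) i)))
    (v ord_max).
Proof.
apply/seteqP; split=> u.
  case=> c; rewrite big_ord_recr /= opprD addrA addrAC => Nu.
  by exists (c ord_max), (fun i => c (widen_ord (leqnSn n) i)).
case=> a [c Nu].
exists (fun i => if unlift ord_max i is Some j then c j else a).
rewrite big_ord_recr /= unlift_none opprD addrA addrAC.
congr (N _): Nu; congr (_ - _); apply: eq_bigr => i _.
by rewrite widen_lift liftK.
Qed.

Lemma span_mod_submod N n (v : 'I_n -> V) :
  is_submodule N -> is_submodule (span_mod N v).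
Proof.
move=> sN; elim: n v => [|n IH] v; first by rewrite span_mod0.
by rewrite span_modS; apply: adjoin_submod.
Qed.

Lemma indep_modS N n (v : 'I_n.+1 -> V) : indep_mod N v ->
  indep_mod N (fun i => v (widen_ord (leqnSn n) i)) /\
  ~ span_mod N (fun i => v (widen_ord (leqnSn n) i)) (v ord_max).
Proof.
move=> iv; split.
  move=> c Nc i.
  have := iv (fun i => if unlift ord_max i is Some j then c j else 0).
  rewrite big_ord_recr /= unlift_none scale0r addr0.
  move=> /(_ _ (lift ord_max i)); rewrite liftK; apply.
  by congr (N _): Nc; apply: eq_bigr => j _; rewrite widen_lift liftK.
case=> c Nc.
have := iv (fun i => if unlift ord_max i is Some j then - c j else 1).
rewrite big_ord_recr /= unlift_none scale1r.
move=> /(_ _ ord_max); rewrite unlift_none => H; apply: locm.1; apply: H.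
congr (N _): Nc; rewrite addrC -sumrN; congr (_ + _); apply: eq_bigr => j _.
by rewrite widen_lift liftK scaleNr.
Qed.

(** Adjoining the members of the family one by one gives a strict chain. *)
Lemma indep_mod_le N P n k (v : 'I_n -> V) : is_submodule N -> cser m N P k ->
  (forall i, P (v i)) -> indep_mod N v -> (n <= k)%N.
Proof.
move=> sN; elim: n v P k => // n IH v P k c Pv /indep_modS[iv nv].
have [sP NP] := cser_sub sN c.
pose L := span_mod N (fun i => v (widen_ord (leqnSn n) i)).
have sL : is_submodule L by apply: span_mod_submod.
have NL : N `<=` L.
  move=> u Nu; exists (fun=> 0); rewrite big1 ?subr0 // => i _.
  by rewrite scale0r.
have LP : L `<=` P.
  move=> u [d /NP Pu]; rewrite -(subrK (\sum_i d i *: v (widen_ord (leqnSn n) i)) u).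
  by apply: submodD => //; apply: submod_sum => // i; apply: submodZ.
have [a [b [<- ca cb]]] := cser_split locm sN sL NL LP c.
have na : (n <= a)%N.
  apply: IH ca _ iv => i; exists (fun j => (j == i)%:R).
  rewrite (bigD1 i) //= eqxx scale1r big1 => [|j /negbTE->]; last by rewrite scale0r.
  by rewrite addr0 subrr; case: sN.
case: b cb => [|b] cb; last by rewrite addnS ltnS (leq_trans na) ?leq_addr.
by case: nv; rewrite -/L (cser_eq0 sL cb).
Qed.

Lemma indep_cser N n (v : 'I_n -> V) : is_submodule N ->
  (forall a i, m a -> N (a *: v i)) -> indep_mod N v ->
  cser m N (span_mod N v) n.
Proof.
move=> sN; elim: n v => [|n IH] v mv iv; first by rewrite span_mod0; apply: cser0.
have [iv' nv] := indep_modS iv; rewrite span_modS.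
apply: cserS => // [|a ma]; first by apply: IH => // a i ma; apply: mv.
exists (fun=> 0); rewrite big1 ?subr0 => [|i _]; first exact: mv.
by rewrite scale0r.
Qed.

Lemma residue_dim_cser P N n : is_submodule N -> is_submodule P -> N `<=` P ->
  (forall a u, m a -> P u -> N (a *: u)) ->
  is_residue_dim m P N n <-> cser m N P n.
Proof.
move=> sN sP NP mP; split.
  case=> v [Pv gv iv].
  have -> : P = span_mod N v.
    apply/seteqP; split=> [u Pu|u [c /NP Nu]]; first exact: gv.
    rewrite -(subrK (\sum_i c i *: v i) u); apply: submodD => //.
    by apply: submod_sum => // i; apply: submodZ.
  by apply: indep_cser => // a i ma; apply: mP.
move=> c; elim: c sP NP mP => [|P' k v c IH Pv mv] sP NP mP.
  exists (fun=> 0); split=> [[]//|u Pu|c _ []//].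
  by exists (fun=> 0); rewrite big_ord0 subr0.
have [sP' NP'] := cser_sub sN c.
have [//|//|a u ma Pu|w [Pw gw iw]] := IH.
  by apply: mP => //; apply: adjoin_ext.
pose w' (i : 'I_k.+1) := if unlift ord_max i is Some j then w j else v.
have sw' (d : 'I_k.+1 -> R) : \sum_i d i *: w' i =
    \sum_i d (lift ord_max i) *: w i + d ord_max *: v.
  rewrite big_ord_recr /= /w' unlift_none; congr (_ + _).
  by apply: eq_bigr => i _; rewrite widen_lift liftK.
exists w'; split.
- move=> i; rewrite /w'; case: unliftP => [j _|_]; first exact: adjoin_ext.
  exact: adjoin_in.
- move=> u [a /gw[d Nu]].
  exists (fun i => if unlift ord_max i is Some j then d j else a).
  rewrite sw' unlift_none opprD addrA addrAC.
  by congr (N _): Nu; congr (_ - _); apply: eq_bigr => j _; rewrite liftK.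
- move=> d; rewrite sw' => Nd.
  have md : m (d ord_max).
    apply: contrapT => /locm.2[y ey]; apply: Pv.
    rewrite -[v]scale1r -ey -scalerA; apply: submodZ => //.
    have Ps : P' (\sum_i d (lift ord_max i) *: w i).
      by apply: submod_sum => // i; apply: submodZ.
    by apply: (submod_addK sP' Ps); rewrite addrC; apply: NP'.
  have Nv : N (d ord_max *: v) by apply: mP => //; apply: adjoin_in.
  have /iw H := submod_addK sN Nv Nd.
  by move=> i; case: (unliftP ord_max i) => [j ->|->].
Qed.

Lemma residue_dimE P N n : is_submodule N -> is_submodule P -> N `<=` P ->
  (forall a u, m a -> P u -> N (a *: u)) ->
  is_residue_dim m P N n -> residue_dim m P N = n.
Proof.
move=> sN sP NP mP h; apply: xget_unique => // k hk.
have [H1 _] := residue_dim_cser k sN sP NP mP.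
have [H2 _] := residue_dim_cser n sN sP NP mP.
exact: (cser_uniq locm sN (H1 hk) (H2 h)).
Qed.

End Families.

(** The correspondence [T] need not be a map in either direction: it is used for
    homomorphisms from [m] and the elements of [Q] inducing them, where a
    homomorphism is only determined on [m]. *)
Lemma residue_dim_transfer (V W : lmodType R) (T : V -> W -> Prop)
    (P N : set V) (P' N' : set W) n :
  T 0 0 -> (forall a u v u' v', T u u' -> T v v' -> T (a *: u + v) (a *: u' + v')) ->
  (forall u, P u -> exists2 w, P' w & T u w) ->
  (forall w, P' w -> exists2 u, P u & T u w) ->
  (forall u w, T u w -> N u <-> N' w) ->
  is_residue_dim m P N n -> is_residue_dim m P' N' n.
Proof.
move=> T0 TL TP TP' TN [v [Pv gv iv]].
have /choice[w Hw] : forall i, exists w, P' w /\ T (v i) w.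
  by move=> i; have [w] := TP _ (Pv i); exists w.
have Ts (c : 'I_n -> R) : T (\sum_i c i *: v i) (\sum_i c i *: w i).
  elim/big_rec2: _ => // i u u' _ Tu; apply: TL => //; exact: (Hw i).2.
exists w; split=> [i|u' Pu'|c Nc].
- exact: (Hw i).1.
- have [u Pu Tu] := TP' u' Pu'; have [c Nc] := gv u Pu.
  exists c; apply: (TN _ _ _).1 Nc; rewrite ![_ - \sum_i _]addrC -!scaleN1r.
  exact: TL.
- by apply: iv; apply: (TN _ _ (Ts c)).2.
Qed.

End ResidueDimension.

(** Zorn's lemma for nonempty sets ordered by inclusion; only nonempty chains are
    to be bounded, so that the bound can be their union. *)
Lemma zorn_nonempty (T : Type) (F : set (set T)) (X0 : set T) : F X0 ->
  (forall X, F X -> X !=set0) ->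
  (forall C, C `<=` F -> C !=set0 -> total_on C subset ->
     F (\bigcup_(X in C) X)) ->
  exists2 A, F A & forall B, F B -> A `<=` B -> B = A.
Proof.
move=> F0 Fne Fch; pose P := [set X : set T | F X \/ X = set0].
have [C CP Ct|A [PA maxA]] := @Zorn_bigcup T P.
  have [[X [CX FX]]|nF] := pselect (exists X, C X /\ F X); last first.
    right; apply/seteqP; split=> // u [X CX Xu]; case: nF.
    by exists X; split=> //; case: (CP X CX) => // e; rewrite e in Xu.
  left; have -> : \bigcup_(Y in C) Y = \bigcup_(Y in C `&` F) Y.
    apply/seteqP; split=> [u [Y CY Yu]|u [Y [CY _] Yu]]; last by exists Y.
    by exists Y => //; split=> //; case: (CP Y CY) => // e; rewrite e in Yu.
  apply: Fch; first by move=> Y [].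
    by exists X.
  by move=> Y Z [CY _] [CZ _]; apply: Ct.
case: PA => [FA|A0]; last first.
  case: (maxA X0); last by left.
  rewrite A0; split=> // H; have [u Xu] := Fne X0 F0; exact: H Xu.
exists A => // B FB AB; apply/seteqP; split=> //.
by apply: contrapT => nA; apply: (maxA B) => //; left.
Qed.

Section Noetherian.
Variable R : comNzRingType.

(** Noetherianity, as the maximum condition, which is how it is applied. *)
Definition acc (V : lmodType R) (L : set V) : Prop :=
  forall F : set (set V), F !=set0 ->
    (forall N, F N -> is_submodule N /\ N `<=` L) ->
    exists2 N, F N & forall N', F N' -> N `<=` N' -> N' = N.

Lemma acc_sub (V : lmodType R) (L L' : set V) : L' `<=` L -> acc L -> acc L'.
Proof.
move=> LL aL F F0 FL; apply: aL => // N /FL[sN NL]; split=> //.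
exact: subset_trans LL.
Qed.

Lemma acc_inj (V W : lmodType R) (f : V -> W) (L : set V) (L' : set W) :
  lin f -> injective f -> f @` L `<=` L' -> acc L' -> acc L.
Proof.
move=> fL fI fLL aL F [N0 FN0] FL.
have [||_ [N FN <-] maxN] := aL [set f @` N | N in F].
- by exists (f @` N0); exists N0.
- move=> _ [N FN <-]; have [sN NL] := FL N FN; split; first exact: image_submod.
  by move=> _ [u Nu <-]; apply: fLL; exists u => //; apply: NL.
exists N => // N' FN' NN'; apply/seteqP; split=> // u N'u.
have /seteqP[/(_ (f u)) H _] : f @` N' = f @` N.
  by apply: maxN; [exists N' | move=> _ [w Nw <-]; exists w => //; apply: NN'].
by have [|w Nw /fI <-] := H; first by exists u.
Qed.

Lemma span_ordP (V : lmodType R) n (g : 'I_n -> V) u :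
  span (range g) u <-> exists c : 'I_n -> R, u = \sum_i c i *: g i.
Proof.
split; last first.
  move=> [c ->]; apply: submod_sum => [|i]; first exact: span_submod.
  by apply: (submodZ _ (span_submod _)); apply: span_ext; exists i.
move: u; apply: span_min.
  split; first by exists (fun=> 0); rewrite big1 // => i _; rewrite scale0r.
  move=> a _ _ [c ->] [d ->]; exists (fun i => a * c i + d i).
  rewrite scaler_sumr -big_split; apply: eq_bigr => i _.
  by rewrite scalerDl scalerA.
move=> _ [i _ <-]; exists (fun j => (j == i)%:R).
rewrite (bigD1 i) //= eqxx scale1r big1 ?addr0 // => j /negbTE->.
by rewrite scale0r.
Qed.

Lemma acc_fin_gen (V : lmodType R) (L : set V) :
  acc L -> is_submodule L -> fin_gen L.
Proof.
move=> aL sL.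
have [||N [sN NL [n [g eN]]] maxN] :=
    aL [set N | [/\ is_submodule N, N `<=` L & fin_gen N]].
- exists [set 0]; split=> [|_ ->|]; last 2 first.
  + exact: submod0.
  + exists 0%N, (fun=> 0); apply/seteqP; split=> [_ ->|]; first exact: (submod0 (span_submod _)).
    by move=> u /span_ordP[c ->]; rewrite big_ord0.
  by split=> // a u v -> ->; rewrite scaler0 addr0.
- by move=> N [].
suff -> : L = N by exists n, g.
apply/seteqP; split=> // v Lv.
suff <- : adjoin N v = N by apply: adjoin_in.
apply: maxN; last exact: adjoin_ext.
split; [exact: adjoin_submod | exact: adjoin_min|].
exists n.+1, (fun i => if unlift ord_max i is Some j then g j else v).
apply/seteqP; split.
  apply: adjoin_min; first exact: span_submod.
    rewrite {1}eN; apply: span_min; first exact: span_submod.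
    by move=> _ [i _ <-]; apply: span_ext; exists (lift ord_max i); rewrite ?liftK.
  by apply: span_ext; exists ord_max; rewrite ?unlift_none.
apply: span_min; first exact: adjoin_submod.
move=> _ [i _ <-]; case: unliftP => [j _|_]; last exact: adjoin_in.
by apply: adjoin_ext; rewrite eN; apply: span_ext; exists j.
Qed.

Lemma noetherian_acc : noetherian R -> acc [set: R^o].
Proof.
move=> nR F [I0 F0] FL.
apply: (zorn_nonempty F0) => [X /FL[sX _]|C CF [X CX] Ct].
  by exists 0; exact: submod0.
pose U := \bigcup_(X in C) X.
have sC Y : C Y -> is_submodule Y by move=> /CF/FL[].
have sU : is_submodule U.
  split; first by exists X => //; exact: (submod0 (sC X CX)).
  move=> a u v [Y CY Yu] [Z CZ Zv].
  have [YZ|ZY] := Ct Y Z CY CZ.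
    by exists Z => //; apply: (sC Z CZ).2 => //; apply: YZ.
  by exists Y => //; apply: (sC Y CY).2 => //; apply: ZY.
have [n [g eU]] := nR (Ideal sU); rewrite /= in eU.
have [Y CY Yg] : exists2 Y, C Y & forall i, Y (g i).
  have Ug i : U (g i) by rewrite eU; apply: span_ext; exists i.
  clear eU; elim: n g Ug => [|n IH] g Ug; first by exists X => // -[].
  have [Y CY Yg] := IH (fun i => g (lift ord_max i)) (fun i => Ug _).
  have [Z CZ Zg] := Ug ord_max.
  have [YZ|ZY] := Ct Y Z CY CZ.
    exists Z => // i; case: (unliftP ord_max i) => [j ->|-> //].
    exact: YZ.
  by exists Y => // i; case: (unliftP ord_max i) => [j ->|->]; [exact: Yg|exact: ZY].
suff E : U = Y by have := CF Y CY; rewrite -E.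
apply/seteqP; split; last by move=> u Yu; exists Y.
rewrite eU; apply: span_min; first exact: sC.
by move=> _ [i _ <-].
Qed.

Definition smul (V : lmodType R) (I : set R) (L : set V) : set V :=
  span [set w | exists a v, [/\ I a, L v & w = a *: v]].

Section Nakayama.
Variables (m : ideal R) (locm : local_units m) (V : lmodType R).
Implicit Types N L : set V.

Lemma unit1B a : m a -> exists y, y * (1 - a) = 1.
Proof.
move=> ma; apply: locm.2 => m1; apply: locm.1; rewrite -(subrK a 1).
exact: (submodD (ideal_submodule m)).
Qed.

Lemma nakayama1 N a v : is_submodule N -> m a -> N (v - a *: v) -> N v.
Proof.
move=> sN ma; rewrite -[X in X - _]scale1r -scalerBl => Nv.
by have [y ey] := unit1B ma; rewrite -[v]scale1r -ey -scalerA; apply: submodZ.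
Qed.

(** Reduces to the cyclic case: a proper submodule of [L] that is maximal among
    those containing [N] leaves one generator. *)
Lemma nakayama N L : acc L -> is_submodule N -> is_submodule L -> N `<=` L ->
  L `<=` addS N (smul m L) -> L = N.
Proof.
move=> aL sN sL NL H.
have [e|neq] := pselect (L = N); first by [].
have [||N' [sN' NN' N'L N'ne] maxN] :=
    aL [set N' | [/\ is_submodule N', N `<=` N', N' `<=` L & N' <> L]].
- by exists N; split=> // e; apply: neq.
- by move=> N' [].
have [v [Lv N'v]] : exists v, L v /\ ~ N' v.
  apply: contrapT => nv; apply: N'ne; apply/seteqP; split=> // v Lv.
  by apply: contrapT => N'v; apply: nv; exists v.
have eL : L = adjoin N' v.
  apply: contrapT => ne; apply: N'v.
  rewrite -(maxN (adjoin N' v)); [exact: adjoin_in|split|exact: adjoin_ext].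
  - exact: adjoin_submod.
  - by move=> u /NN'; apply: adjoin_ext.
  - exact: adjoin_min.
  - by move=> e; apply: ne.
have sM : is_submodule [set u | exists2 a, m a & N' (u - a *: v)].
  split; first by exists 0; [exact: submod0 (ideal_submodule m)|
    rewrite scale0r subr0; case: sN'].
  move=> b u w [a ma Nu] [a' ma' Nw]; exists (b * a + a').
    exact: (ideal_submodule m).2.
  rewrite scalerDl -scalerA opprD addrACA -scalerBr.
  exact: sN'.2.
have MM : smul m L `<=` [set u | exists2 a, m a & N' (u - a *: v)].
  apply: span_min => // _ [a [w [ma + ->]]]; rewrite eL => -[b Nw].
  exists (a * b); first by rewrite mulrC; exact: submodZ (ideal_submodule m) _.
  by rewrite -scalerA -scalerBr; apply: submodZ.
have [w /MM[a ma Nw] Nvw] := H v Lv.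
case: N'v; apply: (nakayama1 sN' ma).
have -> : v - a *: v = (v - w) + (w - a *: v) by rewrite addrA subrK.
by apply: submodD => //; apply: NN'.
Qed.

(** The first step of a composition series. *)
Lemma fl_socle N P : is_submodule N -> finite_length m N P -> N <> P ->
  exists w, [/\ P w, ~ N w & forall a, m a -> N (a *: w)].
Proof.
move=> sN [n c]; elim: c => // P' k v c IH Pv mv ne.
have [e|/IH[w [Pw Nw mw]]] := pselect (N = P'); last first.
  by exists w; split=> //; apply: adjoin_ext.
by exists v; rewrite e; split=> //; apply: adjoin_in; case: (cser_sub sN c).
Qed.

End Nakayama.
End Noetherian.

(** * Fractional ideals *)

(** Cohen-Macaulay local rings of dimension one, without prime ideals or regular
    sequences, so that the property can be passed on to the ring [m : m]. *)
Record cm1 (R : comNzRingType) (m : ideal R) : Prop := Cm1 {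
  cm1_loc : local_units m;
  cm1_acc : acc [set: R^o];
  cm1_reg : exists2 x, m x & nonzerodivisor x;
  cm1_fl : forall z, nonzerodivisor z ->
    @finite_length R m R^o [set z * x | x in setT] setT }.

Section Fractional.
Variables (R : comNzRingType) (m : ideal R) (Q : comAlgType R).
Hypotheses (cm : cm1 m) (tf : total_fractions Q).
Implicit Types (L N P D I J : set Q) (p q : Q) (a s t z : R).

Let locm : local_units m := cm1_loc cm.

Definition emb (a : R) : Q := a%:A.
Local Notation alg := emb.

Lemma alg_lin : lin (alg : R^o -> Q).
Proof. by move=> a u v; rewrite /emb scalerDl -scalerA. Qed.
Lemma algD a b : alg (a + b) = alg a + alg b. Proof. exact: scalerDl. Qed.
Lemma algB a b : alg (a - b) = alg a - alg b. Proof. exact: scalerBl. Qed.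
Lemma algM a b : alg (a * b) = alg a * alg b.
Proof. by rewrite /emb -scalerAl mul1r scalerA. Qed.
Lemma alg1 : alg 1 = 1. Proof. exact: scale1r. Qed.
Lemma algZ a q : a *: q = alg a * q. Proof. by rewrite /emb mulr_algl. Qed.
Lemma alg_inj : injective alg.
Proof.
case: tf => h _ _ a b e; apply/eqP; rewrite -subr_eq0; apply/eqP; apply: h.
by rewrite -/(emb _) algB e subrr.
Qed.

Lemma mul_lin q : lin (fun u : Q => q * u).
Proof. by move=> a u v; rewrite mulrDr scalerAr. Qed.

Definition invertible q : Prop := exists p, q * p = 1.

Lemma invertible_inj q : invertible q -> injective (fun u => q * u).
Proof.
move=> [p e] u v /(congr1 (fun w => p * w)).
by rewrite !mulrA [p * q]mulrC e !mul1r.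
Qed.

Lemma invertibleM p q : invertible p -> invertible q -> invertible (p * q).
Proof. by move=> [p' ep] [q' eq]; exists (p' * q'); rewrite mulrACA ep eq mulr1. Qed.

Lemma invertible_inv p q : p * q = 1 -> invertible q.
Proof. by move=> e; exists p; rewrite mulrC. Qed.

Lemma nzd_invertible s : nonzerodivisor s <-> invertible (alg s).
Proof.
split=> [h|[p e] x sx]; first by case: tf => _ H _; apply: H.
apply: alg_inj; rewrite /emb scale0r -/(alg x) -[alg x]mul1r -e mulrAC -algM sx.
by rewrite /emb scale0r mul0r.
Qed.

Lemma nzdM s t : nonzerodivisor s -> nonzerodivisor t -> nonzerodivisor (s * t).
Proof. by move=> hs ht x; rewrite -mulrA => /hs/ht. Qed.

Lemma nzd1 : nonzerodivisor (1 : R). Proof. by move=> x; rewrite mul1r. Qed.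

Lemma nzdX s n : nonzerodivisor s -> nonzerodivisor (s ^+ n).
Proof.
move=> h; elim: n => [|n IH]; first by rewrite expr0; exact: nzd1.
by rewrite exprS; apply: nzdM.
Qed.

Lemma fracP q : exists a s, nonzerodivisor s /\ alg s * q = alg a.
Proof. by case: tf => _ _ /(_ q). Qed.

Lemma invertible_fracP q : invertible q ->
  exists a s, [/\ nonzerodivisor s, nonzerodivisor a & alg s * q = alg a].
Proof.
move=> uq; have [a [s [hs e]]] := fracP q; exists a, s; split=> //.
by apply/nzd_invertible; rewrite -e; apply: invertibleM => //; apply/nzd_invertible.
Qed.

Definition ring_image : set Q := range alg.
Local Notation base := ring_image.

Lemma base_submod : is_submodule base.
Proof. exact: (image_submod alg_lin). Qed.

Lemma baseM u v : base u -> base v -> base (u * v).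
Proof. by move=> [a _ <-] [b _ <-]; exists (a * b); rewrite ?algM. Qed.

Definition scl q L : set Q := [set q * u | u in L].

Lemma scl_submod q L : is_submodule L -> is_submodule (scl q L).
Proof. exact: (image_submod (mul_lin q)). Qed.

Lemma sclM p q L : scl p (scl q L) = scl (p * q) L.
Proof.
apply/seteqP; split=> [_ [_ [u Lu <-] <-]|_ [u Lu <-]].
  by exists u; rewrite ?mulrA.
by exists (q * u); rewrite ?mulrA //; exists u.
Qed.

Lemma scl1 L : scl 1 L = L.
Proof.
apply/seteqP; split=> [_ [u Lu <-]|u Lu]; first by rewrite mul1r.
by exists u; rewrite ?mul1r.
Qed.

Lemma sclS q L N : L `<=` N -> scl q L `<=` scl q N.
Proof. by move=> LN _ [u Lu <-]; exists u => //; apply: LN. Qed.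

Lemma scl_sub a L : is_submodule L -> scl (alg a) L `<=` L.
Proof. by move=> sL _ [u Lu <-]; rewrite -algZ; apply: submodZ. Qed.

Definition prodq L N : set Q :=
  span [set w | exists u v, [/\ L u, N v & w = u * v]].

Lemma prodq_submod L N : is_submodule (prodq L N).
Proof. exact: span_submod. Qed.

Lemma prodq_in L N u v : L u -> N v -> prodq L N (u * v).
Proof. by move=> Lu Nv; apply: span_ext; exists u, v. Qed.

Lemma prodq_min L N P : is_submodule P -> (forall u v, L u -> N v -> P (u * v)) ->
  prodq L N `<=` P.
Proof. by move=> sP H; apply: span_min => // _ [u [v [Lu Nv ->]]]; apply: H. Qed.

Definition colq D J : set Q := [set q | forall u, J u -> D (q * u)].

Lemma colq_submod D J : is_submodule D -> is_submodule (colq D J).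
Proof.
move=> sD; split; first by move=> u _; rewrite mul0r; case: sD.
by move=> a u v hu hv w Jw; rewrite mulrDl -scalerAl; apply: sD.2; [apply: hu|apply: hv].
Qed.

Lemma colqS D J J' : J `<=` J' -> colq D J' `<=` colq D J.
Proof. by move=> JJ q h u /JJ; apply: h. Qed.

Record fractional L : Prop := Frac {
  frac_submod : is_submodule L;
  frac_den : exists2 s, nonzerodivisor s & scl (alg s) L `<=` base;
  frac_reg : exists2 t, nonzerodivisor t & L (alg t) }.

Lemma base_frac : fractional base.
Proof.
split; first exact: base_submod.
  by exists 1; [exact: nzd1 | rewrite alg1 scl1].
by exists 1; [exact: nzd1 | exists 1].
Qed.

Lemma scl_frac q L : invertible q -> fractional L -> fractional (scl q L).
Proof.
move=> uq [sL [s hs sLb] [t ht Lt]]; split; first exact: scl_submod.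
  have [a [c [hc e]]] := fracP q.
  exists (s * c); first exact: nzdM.
  move=> _ [_ [u Lu <-] <-]; rewrite algM mulrA -[_ * q]mulrA e mulrAC mulrC.
  by apply: baseM; [exists a | apply: sLb; exists u].
have [a [c [hc ha e]]] := invertible_fracP uq.
exists (a * t); first exact: nzdM.
exists (c *: alg t); first exact: submodZ.
by rewrite algZ mulrA [q * _]mulrC e algM.
Qed.

Lemma prodq_frac L N : fractional L -> fractional N -> fractional (prodq L N).
Proof.
move=> [sL [s hs sLb] [t ht Lt]] [sN [s' hs' sNb] [t' ht' Nt]]; split.
- exact: prodq_submod.
- exists (s * s'); first exact: nzdM.
  move=> _ [w Pw <-]; suff /(_ w Pw) : prodq L N `<=` (fun w => alg (s * s') * w) @^-1` base by [].
  apply: prodq_min; first exact: (preimage_submod (mul_lin _) base_submod).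
  move=> u v Lu Nv; rewrite /preimage /= algM mulrACA.
  by apply: baseM; [apply: sLb; exists u | apply: sNb; exists v].
- by exists (t * t'); [exact: nzdM | rewrite algM; apply: prodq_in].
Qed.

Lemma setI_frac L N : fractional L -> fractional N -> fractional (L `&` N).
Proof.
move=> [sL [s hs sLb] [t ht Lt]] [sN _ [t' ht' Nt]]; split.
- exact: setI_submod.
- by exists s => // _ [u [Lu _] <-]; apply: sLb; exists u.
- exists (t * t'); first exact: nzdM.
  rewrite algM; split; last by rewrite -algZ; apply: submodZ.
  by rewrite mulrC -algZ; apply: submodZ.
Qed.

Lemma colq_frac L N : fractional L -> fractional N -> fractional (colq L N).
Proof.
move=> [sL [s hs sLb] [t ht Lt]] [sN [s' hs' sNb] [t' ht' Nt]]; split.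
- exact: colq_submod.
- exists (s * t'); first exact: nzdM.
  move=> _ [q h <-]; rewrite algM -mulrA [_ * q]mulrC; apply: sLb.
  by exists (q * alg t') => //; apply: h.
- exists (t * s'); first exact: nzdM.
  move=> u Nu; have [|a _ e] := sNb (alg s' * u); first by exists u.
  by rewrite algM -mulrA -e mulrC -algZ; apply: submodZ.
Qed.

Lemma base_acc : acc base.
Proof.
move=> F [N0 F0] FL.
have E N : F N -> alg @` (alg @^-1` N) = N.
  move=> FN; apply/seteqP; split=> [_ [u Nu <-] //|w Nw].
  by have [a _ e] := (FL N FN).2 w Nw; exists a; rewrite // /preimage /= e.
have [||_ [N FN <-] maxN] :=
    cm1_acc cm (F := [set (alg : R^o -> Q) @^-1` N | N in F]).
- by exists (alg @^-1` N0); exists N0.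
- move=> _ [N FN <-]; split=> //.
  by apply: (preimage_submod alg_lin); case: (FL N FN).
exists N => // N' FN' NN'; rewrite -(E N' FN') -(E N FN); congr (_ @` _).
by apply: maxN; [exists N' | move=> a /NN'].
Qed.

Lemma frac_acc L : fractional L -> acc L.
Proof.
move=> [sL [s hs sLb] _]; apply: acc_inj sLb base_acc; first exact: mul_lin.
by apply: invertible_inj; apply/nzd_invertible.
Qed.

Lemma cser_scl q N P n : invertible q -> is_submodule N -> cser m N P n ->
  cser m (scl q N) (scl q P) n.
Proof. by move=> uq; apply: cser_image; [exact: mul_lin | exact: invertible_inj]. Qed.

Lemma lgt_scl q N P : invertible q -> is_submodule N -> finite_length m N P ->
  lgt m (scl q N) (scl q P) = lgt m N P.
Proof.
move=> uq sN /flP c; apply: lgtE => //; first exact: scl_submod.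
exact: cser_scl.
Qed.

Lemma base_fl z : nonzerodivisor z -> finite_length m (scl (alg z) base) base.
Proof.
move=> hz; have [n c] := cm1_fl cm hz; exists n.
have -> : scl (alg z) base = alg @` [set z * x | x in setT].
  apply/seteqP; split=> [_ [_ [x _ <-] <-]|_ [_ [x _ <-] <-]].
    by exists (z * x); [exists x | rewrite algM].
  by exists (alg x); [exists x | rewrite algM].
apply: (cser_image alg_lin alg_inj) c.
exact: principal_submod.
Qed.

(** [P / N] is a subquotient of a copy of [R / z R] for some regular [z]. *)
Lemma frac_fl N P : fractional N -> fractional P -> N `<=` P -> finite_length m N P.
Proof.
move=> [sN _ [t ht Nt]] [sP [s hs sPb] _] NP.
have [p ep] := (nzd_invertible s).1 hs.
have up : invertible p by apply: invertible_inv ep.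
have [n c] := base_fl (nzdM hs ht).
have {}c := cser_scl up (scl_submod _ base_submod) c.
have e : scl p (scl (alg (s * t)) base) = scl (alg t) base.
  by rewrite sclM algM mulrA [p * _]mulrC ep mul1r.
rewrite e in c.
have Nb : scl (alg t) base `<=` N.
  by move=> _ [_ [x _ <-] <-]; rewrite mulrC -algZ; apply: submodZ.
have Pb : P `<=` scl p base.
  move=> u Pu; exists (alg s * u); first by apply: sPb; exists u.
  by rewrite mulrA [p * _]mulrC ep mul1r.
have st : is_submodule (scl (alg t) base) by apply/scl_submod/base_submod.
have [_ [b [_ _ c']]] := cser_split locm st sN Nb (subset_trans NP Pb) c.
have [a [b' [_ c'' _]]] := cser_split locm sN sP NP Pb c'.
by exists a.
Qed.

Lemma frac_lgt_add N L P : fractional N -> fractional L -> fractional P ->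
  N `<=` L -> L `<=` P ->
  lgt m N P = (lgt m N L + lgt m L P)%N.
Proof.
move=> fN fL fP NL LP; apply: lgt_add => //; first exact: frac_submod.
  exact: frac_fl.
exact: frac_fl.
Qed.

Lemma frac_lgt_eq0 N P : fractional N -> fractional P -> N `<=` P ->
  lgt m N P = 0%N -> N = P.
Proof. by move=> fN fP NP; apply: lgt_eq0; [exact: frac_submod | exact: frac_fl]. Qed.

(** Both sides are compared with the same length for a common submodule. *)
Lemma lgt_scl_self L z : nonzerodivisor z -> fractional L ->
  lgt m (scl (alg z) L) L = lgt m (scl (alg z) base) base.
Proof.
move=> hz; have uz := (nzd_invertible z).1 hz.
suff H N P : fractional N -> fractional P -> N `<=` P ->
    lgt m (scl (alg z) N) N = lgt m (scl (alg z) P) P.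
  move=> fL; have fI := setI_frac fL base_frac.
  by rewrite -(H _ _ fI fL (@subIsetl _ _ _)) (H _ _ fI base_frac (@subIsetr _ _ _)).
move=> fN fP NP; have fzN := scl_frac uz fN; have fzP := scl_frac uz fP.
have sN := frac_submod fN; have sP := frac_submod fP.
have := frac_lgt_add fzN fN fP (scl_sub sN) NP.
rewrite (frac_lgt_add fzN fzP fP (sclS NP) (scl_sub sP)).
rewrite lgt_scl //; [lia | exact: frac_fl].
Qed.

Lemma lgt_le_scl_self N L z : nonzerodivisor z -> fractional N -> fractional L ->
  scl (alg z) L `<=` N -> N `<=` L ->
  (lgt m N L <= lgt m (scl (alg z) base) base)%N.
Proof.
move=> hz fN fL zN NL; have fz := scl_frac ((nzd_invertible z).1 hz) fL.
rewrite -(lgt_scl_self hz fL) (frac_lgt_add fz fN fL zN NL).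
exact: leq_addl.
Qed.

End Fractional.

(** * Duality for fractional ideals of type one *)

Section Duality.
Variables (R : comNzRingType) (m : ideal R) (Q : comAlgType R).
Hypotheses (cm : cm1 m) (tf : total_fractions Q).
Implicit Types (L N P D I J : set Q) (p q : Q) (a s t z : R).

Let locm : local_units m := cm1_loc cm.
Local Notation base := (@ring_image R Q).
Local Notation alg := (@emb R Q).
Local Notation mQ := ([set alg a | a in (m : set R)]).

Lemma frac_between I J P : fractional I -> fractional J -> is_submodule P ->
  I `<=` P -> P `<=` J -> fractional P.
Proof.
move=> [sI _ [t ht It]] [sJ [s hs Js] _] sP IP PJ; split=> //.
  by exists s => //; apply: subset_trans Js; apply: sclS.
by exists t => //; apply: IP.
Qed.

Lemma frac_absorb I J : fractional I -> fractional J ->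
  exists2 z, nonzerodivisor z & scl (alg z) J `<=` I.
Proof.
move=> [sI _ [t ht It]] [sJ [s hs Js] _]; exists (t * s); first exact: nzdM.
move=> _ [u Ju <-]; have [|a _ e] := Js (alg s * u); first by exists u.
by rewrite algM -mulrA -e mulrC -algZ; apply: submodZ.
Qed.

Lemma adjoin_frac J q : fractional J -> fractional (adjoin J q).
Proof.
move=> [sJ [s hs Js] [t ht Jt]]; split; first exact: adjoin_submod.
  have [c [d [hd ed]]] := fracP tf q; exists (s * d); first exact: nzdM.
  move=> _ [u [a Ju] <-].
  have -> : alg (s * d) * u =
      alg d * (alg s * (u - a *: q)) + alg (s * a) * (alg d * q).
    by rewrite !algM [a *: q]algZ; ring.
  apply: (submodD (base_submod Q)).
    by apply: baseM; [exists d | apply: Js; exists (u - a *: q)].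
  by rewrite ed; apply: baseM; [exists (s * a) | exists c].
by exists t => //; apply: adjoin_ext.
Qed.

Lemma ideal_frac (I : ideal R) t : nonzerodivisor t -> I t ->
  fractional [set alg a | a in (I : set R)].
Proof.
move=> ht It; split.
- exact: (image_submod (@alg_lin R Q) (ideal_submodule I)).
- exists 1; first exact: nzd1.
  by rewrite alg1 scl1 => _ [a _ <-]; exists a.
- by exists t => //; exists t.
Qed.

Lemma max_frac : fractional mQ.
Proof. by have [x mx hx] := cm1_reg cm; exact: ideal_frac hx mx. Qed.

Lemma colq_prodq D I J : is_submodule D ->
  colq D (prodq I J) = colq (colq D I) J.
Proof.
move=> sD; apply/seteqP; split=> q h.
  by move=> v Jv u Iu; rewrite -mulrA [v * u]mulrC; apply: h; apply: prodq_in.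
move=> w Pw; suff : prodq I J `<=` (fun u => q * u) @^-1` D by apply.
apply: prodq_min; first exact: (preimage_submod (mul_lin q) sD).
by move=> u v Iu Jv; rewrite /preimage /= [u * v]mulrC mulrA; apply: h.
Qed.

Lemma prodqC I J : prodq I J = prodq J I.
Proof.
by apply/seteqP; split; apply: prodq_min => [|u v ? ?]; rewrite ?[u * v]mulrC;
   [exact: prodq_submod | exact: prodq_in | exact: prodq_submod | exact: prodq_in].
Qed.

Lemma colq_base D : is_submodule D -> colq D base = D.
Proof.
move=> sD; apply/seteqP; split=> q.
  by move=> /(_ 1); rewrite mulr1; apply; exists 1; rewrite ?alg1.
by move=> Dq _ [a _ <-]; rewrite mulrC -algZ; apply: submodZ.
Qed.

Lemma colq_scl D J p q : p * q = 1 -> colq D (scl q J) = scl p (colq D J).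
Proof.
move=> e; apply/seteqP; split=> [u h|_ [u h <-] _ [v Jv <-]].
  exists (q * u); last by rewrite mulrA e mul1r.
  by move=> v Jv; rewrite mulrAC mulrC; apply: h; exists v.
by rewrite mulrACA e mul1r; apply: h.
Qed.

Lemma cser1_gen (V : lmodType R) (N P : set V) w : is_submodule N ->
  cser m N P 1 -> P w -> ~ N w -> P = adjoin N w.
Proof.
move=> sN c Pw Nw; have [sP NP] := cser_sub sN c.
have [a [b [e ca cb]]] := cser_split locm sN (adjoin_submod w sN)
  (@adjoin_ext _ _ N w) (adjoin_min sP NP Pw) c.
case: a e ca => [|a] e ca.
  by case: Nw; rewrite (cser_eq0 sN ca); apply: adjoin_in.
case: b e cb => [|b] e cb; last by move: e; rewrite addnS.
by rewrite (cser_eq0 (adjoin_submod w sN) cb).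
Qed.

(** [(D : m) / D] is [Ext^1 (R / m, D)], so these are the ideals of
    Cohen-Macaulay type one; they will turn out to be the canonical ones. *)
Definition type_one D : Prop := fractional D /\ cser m D (colq D mQ) 1.

Section TypeOne.
Variable D : set Q.
Hypothesis (tD : type_one D).
Let fD : fractional D := tD.1.
Let sD : is_submodule D := frac_submod fD.

(** For a simple extension [J] of [I] generated by [v], evaluation at [v] embeds
    [(D : I) / (D : J)] in the one-dimensional [(D : m) / D]. *)
Lemma dual_step I v : is_submodule I -> (forall a, m a -> I (a *: v)) ->
  (exists n, (n <= 1)%N /\ cser m (colq D (adjoin I v)) (colq D I) n).
Proof.
move=> sI mv; set J := adjoin I v.
have sJ : is_submodule J by apply: adjoin_submod.
have IJ : I `<=` J by apply: adjoin_ext.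
have DJI := colqS (D := D) IJ.
have [DIJ|/existsNP[q /not_implyP[hq nq]]] := pselect (colq D I `<=` colq D J).
  by exists 0%N; split=> //; rewrite (_ : colq D J = colq D I);
     [exact: cser0 | apply/seteqP].
have dv p : colq D I p -> colq D J p <-> D (p * v).
  move=> hp; split=> [h|Dpv u [a Iu]]; first by apply: h; apply: adjoin_in.
  rewrite -(subrK (a *: v) u) mulrDr; apply: submodD => //; first exact: hp.
  by rewrite -scalerAr; apply: submodZ.
have Dm p : colq D I p -> colq D mQ (p * v).
  move=> hp _ [a ma <-]; rewrite -mulrA [v * _]mulrC -algZ.
  by apply: hp; apply: mv.
exists 1%N; split=> //.
have -> : colq D I = adjoin (colq D J) q.
  apply/seteqP; split; last first.
    by apply: adjoin_min => //; apply: colq_submod.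
  move=> p hp; have := Dm p hp; rewrite (cser1_gen sD tD.2 (Dm q hq)); last first.
    by move=> Dqv; apply: nq; apply/dv.
  case=> a Dpq; exists a; apply/dv; last by rewrite mulrBl -scalerAl.
  have sDI := colq_submod I sD.
  by apply: (submodB sDI hp); apply: (submodZ a sDI hq).
apply: cserS => //; first exact: cser0.
move=> a ma; apply/dv; first exact: (submodZ a (colq_submod I sD) hq).
by rewrite -scalerAl scalerAr; apply: hq; apply: mv.
Qed.

Lemma dual_le I J : fractional I -> fractional J -> I `<=` J ->
  (lgt m (colq D J) (colq D I) <= lgt m I J)%N.
Proof.
move=> fI fJ IJ; have [n c] := frac_fl cm tf fI fJ IJ.
rewrite (lgtE locm (frac_submod fI) c).
elim: c fJ => [|P k v c IH Pv mv] fJ {IJ}.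
  by rewrite lgt_refl //; apply: colq_submod.
have [sP IP] := cser_sub (frac_submod fI) c.
have PJ : P `<=` adjoin P v by apply: adjoin_ext.
have fP := frac_between fI fJ sP IP PJ.
have [k' [le c']] := dual_step sP mv.
rewrite (frac_lgt_add cm tf (L := colq D P)); last 2 first.
- exact: colqS.
- exact: colqS.
- rewrite (lgtE locm _ c'); last exact: colq_submod.
  by have := IH fP; lia.
all: exact: colq_frac.
Qed.

(** The inequality holds for both steps of [z J <= I <= J], and the sum is an
    equality because scaling does not change lengths. *)
Lemma dual_lgt I J : fractional I -> fractional J -> I `<=` J ->
  lgt m (colq D J) (colq D I) = lgt m I J.
Proof.
move=> fI fJ IJ; have [z hz zJI] := frac_absorb fI fJ.
have uz := (nzd_invertible tf z).1 hz.
have fzJ := scl_frac tf uz fJ.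
have H1 := dual_le fI fJ IJ; have H2 := dual_le fzJ fI zJI.
have H3 := frac_lgt_add cm tf fzJ fI fJ zJI IJ.
have fDJ := colq_frac fD fJ; have fDI := colq_frac fD fI.
have fDz := colq_frac fD fzJ.
have := frac_lgt_add cm tf fDJ fDI fDz (colqS IJ) (colqS zJI).
have [p ep] := uz; have ep' : p * alg z = 1 by rewrite mulrC.
have eJ : colq D J = scl (alg z) (colq D (scl (alg z) J)).
  by rewrite (colq_scl _ _ ep') sclM ep scl1.
rewrite {1}eJ lgt_scl_self // -(lgt_scl_self cm tf hz fJ); lia.
Qed.

Lemma dual_sub J : J `<=` colq D (colq D J).
Proof. by move=> u Ju q hq; rewrite mulrC; apply: hq. Qed.

(** By [dual_lgt] the length of [(D : (D : J)) / J] is the same for all [J]; for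
    [J = D] it is zero, as [1] lies in [D : D]. *)
Lemma dualK J : fractional J -> colq D (colq D J) = J.
Proof.
have DD : D `<=` colq D (colq D D) by apply: dual_sub.
have eD : colq D (colq D D) = D.
  apply/seteqP; split=> // q /(_ 1); rewrite mulr1; apply.
  by move=> u Du; rewrite mul1r.
have dd I : fractional I -> fractional (colq D (colq D I)).
  by move=> fI; apply: colq_frac => //; apply: colq_frac.
have lgt_dd I I' : fractional I -> fractional I' -> I `<=` I' ->
    lgt m (colq D (colq D I)) (colq D (colq D I')) = lgt m I I'.
  by move=> fI fI' II'; rewrite !dual_lgt //; [exact: colq_frac|exact: colq_frac|exact: colqS].
move=> fJ; pose I := J `&` D; have fI : fractional I by exact: setI_frac.
have ID : I `<=` D by exact: subIsetr.
have IJ : I `<=` J by exact: subIsetl.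
have ddS I1 I2 : I1 `<=` I2 -> colq D (colq D I1) `<=` colq D (colq D I2).
  by move=> h; do 2!apply: colqS.
have eI : I = colq D (colq D I).
  apply: (frac_lgt_eq0 cm tf) => //; [exact: dd|exact: dual_sub|].
  have DI := ddS _ _ ID; have := lgt_dd _ _ fI fD ID; rewrite eD in DI *.
  by have := frac_lgt_add cm tf fI (dd _ fI) fD (@dual_sub I) DI; lia.
apply/esym/(frac_lgt_eq0 cm tf) => //; [exact: dd|exact: dual_sub|].
have := frac_lgt_add cm tf fI fJ (dd _ fJ) IJ (@dual_sub J).
by have := lgt_dd _ _ fI fJ IJ; rewrite -eI; lia.
Qed.

Lemma dual_self : colq D D = base.
Proof. by rewrite -{2}(colq_base sD) dualK //; apply: base_frac. Qed.

End TypeOne.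

Lemma frac_nakayama L P : fractional L -> is_submodule P -> P `<=` L ->
  L `<=` addS P (prodq mQ L) -> L = P.
Proof.
move=> fL sP PL H; apply: (nakayama locm (frac_acc cm tf fL)) => //.
  exact: frac_submod.
move=> u /H[v pv Pv]; exists v => //; move: v pv {Pv}.
apply: prodq_min; first exact: span_submod.
move=> _ v [a ma <-] Lv; apply: span_ext; exists a, v; split=> //.
by rewrite algZ.
Qed.

Lemma cyclic_invertible q : fractional (scl q base) -> invertible q.
Proof.
case=> _ _ [t ht [_ [a _ <-] e]]; have [p ep] := (nzd_invertible tf t).1 ht.
by exists (alg a * p); rewrite mulrA e.
Qed.

Lemma frac_principal L P : fractional L -> is_submodule P -> P `<=` prodq mQ L ->
  cser m P L 1 -> exists2 q, invertible q & L = scl q base.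
Proof.
move=> fL sP PM c; have [_ PL] := cser_sub sP c.
have [v [Lv Pv _]] : exists w, [/\ L w, ~ P w & forall a, m a -> P (a *: w)].
  apply: fl_socle => //; first by exists 1%N.
  by move=> e; have := cser_uniq locm sP c; rewrite -e => /(_ 0%N (@cser0 _ _ _ P)).
have e : L = scl v base.
  apply: frac_nakayama => //; first exact/scl_submod/base_submod.
    by move=> _ [_ [a _ <-] <-]; rewrite mulrC -algZ; apply: submodZ => //; exact: frac_submod.
  rewrite {1}(cser1_gen sP c Lv Pv) => u [a Pu].
  exists (u - a *: v); first exact: PM.
  rewrite opprB addrC subrK.
  by exists (alg a); [exists a | rewrite algZ mulrC].
by exists v => //; apply: cyclic_invertible; rewrite -e.
Qed.

(** The multipliers [H = D' : D] have dual [D' : H = D], and [D' : m H = D : m];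
    so [H / m H] has length one and [H] is principal. *)
Lemma type_one_unique D D' : type_one D -> type_one D' ->
  exists2 p, invertible p & D = scl p D'.
Proof.
move=> tD tD'; have [fD cD] := tD; have [fD' cD'] := tD'.
have sD := frac_submod fD; have sD' := frac_submod fD'.
pose H := colq D' D; have fH : fractional H by exact: colq_frac.
have eD : colq D' H = D by rewrite dualK.
have fM : fractional (prodq H mQ) by apply: prodq_frac => //; exact: max_frac.
have MH : prodq H mQ `<=` H.
  apply: prodq_min; first exact: frac_submod.
  by move=> u _ Hu [a ma <-]; rewrite mulrC -algZ; exact: (submodZ a (frac_submod fH) Hu).
have l1 : lgt m (prodq H mQ) H = 1%N.
  rewrite -(dual_lgt tD' fM fH MH) colq_prodq // eD.
  exact: (lgtE locm sD cD).
have [q uq eH] : exists2 q, invertible q & H = scl q base.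
  apply: (frac_principal fH (prodq_submod H mQ)).
    by rewrite prodqC.
  by rewrite -l1; apply: flP; exact: frac_fl.
have [p ep] := uq; exists p; first exact: invertible_inv ep.
by rewrite -eD eH (colq_scl _ _ (p := p)) ?colq_base // mulrC.
Qed.

(** Write [R = D : D] and [R : m = D : m D], and dualize. *)
Lemma type_generators D : type_one D ->
  lgt m base (colq base mQ) = lgt m (prodq D mQ) D.
Proof.
move=> tD; have [fD cD] := tD; have sD := frac_submod fD.
rewrite -(dual_self tD) -colq_prodq // dual_lgt //.
  by apply: prodq_frac => //; exact: max_frac.
apply: prodq_min => // u _ Du [a ma <-].
by rewrite mulrC -algZ; apply: submodZ.
Qed.

End Duality.

(** * One-dimensional Cohen-Macaulay local rings *)

Section DimensionOne.
Variables (R : comNzRingType).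
Implicit Types (m : ideal R).

Lemma acc_local_units m : acc [set: R^o] -> local_ring m -> local_units m.
Proof.
move=> aR [[m1 mmax] muniq]; split=> // x mx; apply: contrapT => nx.
pose xR := [set a * x | a in [set: R]].
have sxR : @is_submodule R R^o xR.
  split; first by exists 0; rewrite ?mul0r.
  move=> a _ _ [b _ <-] [c _ <-]; exists (a * b + c) => //.
  by rewrite mulrDl -mulrA.
have [||I [sI xI I1] maxI] :=
    aR [set I | [/\ @is_submodule R R^o I, xR `<=` I & ~ I 1]].
- by exists xR; split=> // -[y _ e]; apply: nx; exists y.
- by move=> N [].
apply: mx; rewrite -(muniq (Ideal sI)) /=; last first.
  split=> //= J [/= IJ nJI]; apply: contrapT => J1; apply: nJI.
  rewrite (maxI J) //; split=> //; first exact: (ideal_submodule J).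
  exact: subset_trans IJ.
by apply: xI; exists 1; rewrite ?mul1r.
Qed.

Definition ideal_colon (N : set R^o) (w : R) : set R^o := [set a | N (a * w)].

Lemma ideal_colon_submod N w : @is_submodule R R^o N ->
  @is_submodule R R^o (ideal_colon N w).
Proof.
move=> sN; split; first by rewrite /ideal_colon /= mul0r; exact: submod0 sN.
move=> a u v Nu Nv; rewrite /ideal_colon /= mulrDl.
by apply: (submodD sN) => //; rewrite /GRing.scale /= -mulrA; apply: submodMl.
Qed.

(** The usual proof that maximal annihilators are prime, for [R / N]. *)
Lemma max_colon_prime (N : set R^o) : acc [set: R^o] ->
  @is_submodule R R^o N -> N <> setT ->
  exists w, ~ N w /\ forall sp : @is_submodule R R^o (ideal_colon N w),
    is_prime (Ideal sp).
Proof.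
move=> aR sN NT.
have N1 : ~ N 1.
  by move=> N1; apply: NT; apply/seteqP; split=> // a _; rewrite -[a]mulr1; apply: submodMl.
have [||_ [w Nw <-] maxp] := aR [set ideal_colon N w | w in ~` N].
- by exists (ideal_colon N 1); exists 1.
- by move=> _ [w _ <-]; split=> //; apply: ideal_colon_submod.
exists w; split=> // sp; split=> [|x y]; first by rewrite /ideal_colon /= mul1r.
rewrite /= => Nxy; have [Nx|Nx] := pselect (ideal_colon N w x); [by left|right].
have <- : ideal_colon N (x * w) = ideal_colon N w.
  apply: maxp; first by exists (x * w).
  by move=> a Na; rewrite /ideal_colon /= mulrCA; apply: submodMl.
by rewrite /ideal_colon /= mulrCA mulrA.
Qed.

(** A prime avoiding [z] inside [p] is found among the ideals that avoid all
    [s * z ^+ n] with [s] outside [p]; regularity of [z] keeps [0] off this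
    multiplicative set. *)
Lemma prime_below (p : ideal R) z : acc [set: R^o] -> is_prime p ->
  nonzerodivisor z -> p z -> exists2 q : ideal R, is_prime q & (q : set R) `<` p.
Proof.
move=> aR [p1 pp] hz pz.
have [||q [sq qS] maxq] := aR [set I | @is_submodule R R^o I /\
    forall s n, ~ p s -> ~ I (s * z ^+ n)].
- exists [set 0]; split; first by split=> // a u v -> ->; rewrite scaler0 addr0.
  move=> s n ps; rewrite /= mulrC => /(nzdX hz) s0; apply: ps; rewrite s0.
  exact: submod0 (ideal_submodule p).
- by move=> I [].
have meet a : ~ q a -> exists s n, ~ p s /\ adjoin q a (s * z ^+ n).
  move=> qa; apply: contrapT => nm; apply: qa.
  rewrite -(maxq (adjoin q a)); [exact: adjoin_in|split|exact: adjoin_ext].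
    exact: adjoin_submod.
  by move=> s n ps h; apply: nm; exists s, n.
exists (Ideal sq).
  split=> [q1|x y /= qxy]; first by apply: (qS 1 0%N p1); rewrite mulr1.
  apply: contrapT => /not_orP[/meet[s [n [ps [a qa]]]] /meet[t [k [pt [b qb]]]]].
  apply: (qS (s * t) (n + k)%N); first by move=> /pp[].
  have -> : s * t * z ^+ (n + k) = (t * z ^+ k) * (s * z ^+ n - a *: (x : R^o))
      + (a * x) * (t * z ^+ k - b *: (y : R^o)) + (a * b) * (x * y).
    rewrite exprD /GRing.scale /=; ring.
  apply: (submodD sq); last exact: submodMl.
  by apply: (submodD sq); apply: submodMl.
split=> /= [u qu|pq].
  by apply: contrapT => pu; apply: (qS u 0%N pu); rewrite mulr1.
by apply: (qS 1 1%N p1); rewrite mul1r; apply: pq.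
Qed.

Lemma local_prime m : local_units m -> is_prime m.
Proof.
case=> m1 mu; split=> // x y mxy; have [mx|/mu[z ez]] := pselect (m x); [by left|].
right; rewrite -[y]mul1r -ez -mulrA; apply: submodMl => //.
exact: ideal_submodule.
Qed.

(** Let [z] be regular. Above a proper ideal [N] containing [z R] there is a simple
    extension: an associated prime of [R / N] contains [z], so it is not minimal,
    and in dimension one it is [m]. *)
Lemma cm_local_dim1_cm1 m : cm_local_dim1 m -> cm1 m.
Proof.
case=> locm /noetherian_acc aR [_ dim] [[s [ss [sm rs]]] _].
have lu := acc_local_units aR locm; have [m1 mu] := lu.
split=> //.
  case: s ss sm rs => // x [] // _ sm [hx _]; exists x; first by apply: sm; rewrite inE.
  by move=> y xy; apply: hx.
move=> z hz; set zR := [set z * x | x in setT].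
have szR : @is_submodule R R^o zR by exact: principal_submod.
have [||N [sN zN fN] maxN] :=
    aR [set N | [/\ @is_submodule R R^o N, zR `<=` N & @finite_length R m R^o zR N]].
- by exists zR; split=> //; exists 0%N; apply: cser0.
- by move=> N [].
have [<- //|NT] := pselect (N = setT).
have [w [Nw pw]] := max_colon_prime aR sN NT.
have sp := ideal_colon_submod w sN; have {}pw := pw sp.
set p := Ideal sp in pw.
have pz : p z by apply: zN; exists w.
have pm : (p : set R) `<=` m.
  move=> x px; apply: contrapT => /mu[y ey]; apply: pw.1; rewrite -ey.
  exact: submodMl.
have mp : (m : set R) `<=` p.
  apply: contrapT => mp; have [q pq qp] := prime_below aR pw hz pz.
  suff : has_prime_chain R 2 by move=> /dim.
  exists (fun i => if i is i'.+1 then if i' is _.+1 then m else p else q).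
  split=> [[|[|i]] _ //|[|[|i]] //]; exact: local_prime.
have mw a : m a -> N (a * w) by move=> /mp.
have [n c] := fN.
suff e : adjoin N w = N by case: Nw; rewrite -e; apply: adjoin_in.
apply: maxN; last exact: adjoin_ext.
split; first exact: adjoin_submod.
  by move=> u /zN; apply: adjoin_ext.
by exists n.+1; apply: cserS.
Qed.

End DimensionOne.

(** * Extending linear maps; associated primes *)

Section IdealModule.
Variables (R : comNzRingType) (I : ideal R).

Definition in_ideal : {pred R^o} := fun x => `[< I x >].

Lemma in_ideal_submod_closed : submod_closed in_ideal.
Proof.
split; first by apply/asboolP; exact: submod0 (ideal_submodule I).
by move=> a u v /asboolP Iu /asboolP Iv; apply/asboolP; exact: (ideal_submodule I).2.
Qed.

HB.instance Definition _ :=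
  GRing.isSubmodClosed.Build R R^o in_ideal in_ideal_submod_closed.

Record ideal_module := IdealModule {
  ideal_val :> R^o;
  ideal_valP : ideal_val \in in_ideal }.

HB.instance Definition _ := [isSub for ideal_val].
HB.instance Definition _ := [Choice of ideal_module by <:].
HB.instance Definition _ := [SubChoice_isSubLmodule of ideal_module by <:].

Definition ideal_incl : {linear ideal_module -> R^o} := \val.

Lemma ideal_incl_inj : injective ideal_incl. Proof. exact: val_inj. Qed.
Lemma ideal_incl_range : range ideal_incl = I.
Proof.
apply/seteqP; split=> [_ [u _ <-]|x Ix]; first exact/asboolP/(ideal_valP u).
have xI : x \in in_ideal by apply/asboolP.
by exists (IdealModule xI).
Qed.
End IdealModule.

Section LinearOn.
Variables (R : comNzRingType) (V B : lmodType R).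

Definition linear_on (J : set V) (h : V -> B) : Prop :=
  forall a u v, J u -> J v -> h (a *: u + v) = a *: h u + h v.

Lemma linear_on0 J h : is_submodule J -> linear_on J h -> h 0 = 0.
Proof.
move=> sJ hl; have J0 := submod0 sJ.
have := hl 1 0 0 J0 J0; rewrite !scale1r addr0 => /eqP.
by rewrite -subr_eq subrr eq_sym => /eqP.
Qed.

Lemma linear_onZ J h a u : is_submodule J -> linear_on J h -> J u ->
  h (a *: u) = a *: h u.
Proof.
move=> sJ hl Ju; rewrite -[a *: u]addr0 hl //; last exact: submod0.
by rewrite (linear_on0 sJ hl) addr0.
Qed.

Lemma linear_onB J h u v : is_submodule J -> linear_on J h -> J u -> J v ->
  h (u - v) = h u - h v.
Proof.
by move=> sJ hl Ju Jv; rewrite addrC -scaleN1r hl // scaleN1r addrC.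
Qed.

Lemma linear_on_adjoin (J : set V) (h : V -> B) (w : V) (b : B) :
  is_submodule J -> linear_on J h ->
  (forall a, J (a *: w) -> h (a *: w) = a *: b) ->
  exists h', [/\ linear_on (adjoin J w) h', forall u, J u -> h' u = h u & h' w = b].
Proof.
move=> sJ hl hb; pose coef u : R := xget 0 [set s | J (u - s *: w)].
pose h' u := h (u - coef u *: w) + coef u *: b.
have h'E u s : J (u - s *: w) -> h' u = h (u - s *: w) + s *: b.
  move=> Js; have Jc : J (u - coef u *: w).
    by rewrite /coef; apply: (@xgetPex _ 0 [set s | J (u - s *: w)]); exists s.
  have E : (coef u - s) *: w = (u - s *: w) - (u - coef u *: w).
    by rewrite scalerBl opprB [RHS]addrC addrA subrK.
  have := hb (coef u - s); rewrite E => /(_ (submodB sJ Js Jc)).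
  rewrite (linear_onB sJ hl) // scalerBl => e.
  rewrite /h' -[h (u - s *: w)](subrK (h (u - coef u *: w))) e.
  by rewrite [RHS]addrAC subrK addrC.
exists h'; split.
- move=> a u v [s Js] [t Jt].
  rewrite (h'E u s) // (h'E v t) // (h'E _ (a * s + t)).
    have -> : a *: u + v - (a * s + t) *: w = a *: (u - s *: w) + (v - t *: w).
      by rewrite scalerDl -scalerA opprD addrACA -scalerBr.
    by rewrite hl // scalerDl scalerDr scalerA addrACA.
  have -> : a *: u + v - (a * s + t) *: w = a *: (u - s *: w) + (v - t *: w).
    by rewrite scalerDl -scalerA opprD addrACA -scalerBr.
  exact: sJ.2.
- by move=> u Ju; rewrite (h'E u 0) ?scale0r ?subr0 ?addr0.
- have J0 := submod0 sJ.
  by rewrite (h'E w 1) !scale1r subrr ?(linear_on0 sJ hl) ?add0r.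
Qed.
End LinearOn.

Section AssociatedPrimes.
Variable R : comNzRingType.
Hypothesis aR : acc [set: R^o].

Definition max_ann (s : R) : Prop :=
  s <> 0 /\ forall s', s' <> 0 -> (forall a, a * s = 0 -> a * s' = 0) ->
    forall a, a * s' = 0 -> a * s = 0.

Lemma max_ann_prime s a b : max_ann s -> a * b * s = 0 -> a * s = 0 \/ b * s = 0.
Proof.
case=> s0 ms abs; have [as0|as0] := pselect (a * s = 0); [by left|right].
apply: (ms (a * s)) => //; last by rewrite mulrA [b * a]mulrC.
by move=> c cs; rewrite mulrCA cs mulr0.
Qed.

Lemma max_ann_above s : s <> 0 ->
  exists2 t, max_ann t & forall a, a * s = 0 -> a * t = 0.
Proof.
move=> s0.
have [||_ [t [t0 st <-]] maxt] := aR (F := [set A | exists t,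
   [/\ t <> 0, forall a, a * s = 0 -> a * t = 0 & [set a : R^o | a * t = 0] = A]]).
- by exists [set a : R^o | a * s = 0]; exists s.
- move=> _ [t [_ _ <-]]; split=> //; split; first exact: mul0r.
  by move=> a u v /= ut vt; rewrite mulrDl -scalerAl ut scaler0 add0r.
exists t => //; split=> // t' t'0 tt' a at'.
suff /seteqP[H _] : [set a : R^o | a * t' = 0] = [set a : R^o | a * t = 0] by apply: H.
by apply: maxt => //; exists t'; split=> // b /st/tt'.
Qed.

(** Elements with a maximal annihilator span a finitely generated module, and a
    combination of finitely many of them is killed by whatever kills these. Since
    the annihilators are primes, no further one is possible. *)
Lemma max_ann_finite : exists l : seq R, (forall s, s \in l -> max_ann s) /\
  forall x, ~ nonzerodivisor x -> exists2 s, s \in l & x * s = 0.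
Proof.
pose sp (l : seq R) := span [set s : R^o | s \in l].
have [||_ [l lm <-] maxl] := aR (F := [set sp l | l in
    [set l : seq R | forall s, s \in l -> max_ann s]]).
- by exists (sp [::]); exists [::].
- by move=> _ [l _ <-]; split=> //; apply: span_submod.
exists l; split=> // x /existsNP[y /not_implyP[xy y0]].
have [t mt yt] := max_ann_above y0.
have {yt y0}xt := yt _ xy.
have : sp l t.
  rewrite -(maxl (sp (t :: l))); first by apply: span_ext; rewrite /= inE eqxx.
    by exists (t :: l) => // s; rewrite inE => /orP[/eqP->|/lm].
  apply: span_min; first exact: span_submod.
  by move=> s /= sl; apply: span_ext; rewrite /= inE sl orbT.
have [//|nl] := pselect (exists2 s, s \in l & x * s = 0).
(* By primality, a product of elements killing one member of [l] each, but not
   [t], does not kill [t]. *)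
suff [c ct cl] : exists2 c, c * t <> 0 & forall s, s \in l -> c * s = 0.
  move=> lt; case: ct; suff : sp l `<=` [set t : R^o | c * t = 0] by apply.
  apply: span_min; last by move=> s /cl.
  split; first exact: mulr0.
  by move=> a u v /= cu cv; rewrite /GRing.scale /= mulrDr mulrCA cu cv mulr0 addr0.
move=> {maxl}.
elim: l lm nl => [|s l IH] lm nl.
  by exists 1; rewrite // mul1r; case: mt.
have [|[s' s'l xs']|c ct cl] := IH.
- by move=> u ul; apply: lm; rewrite inE ul orbT.
- by apply: nl; exists s'; rewrite // inE s'l orbT.
have [a as0 at0] : exists2 a, a * s = 0 & a * t <> 0.
  apply: contrapT => na; apply: nl; exists s; first by rewrite inE eqxx.
  have [s0 ms] := lm s (mem_head _ _).
  apply: (ms t) => //; first by case: mt.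
  by move=> a as0; apply: contrapT => at0; apply: na; exists a.
exists (a * c); first by move=> /(max_ann_prime mt)[].
move=> u; rewrite inE => /orP[/eqP->|/cl cu]; first by rewrite mulrAC as0 mul0r.
by rewrite -mulrA cu mulr0.
Qed.

(** Prime avoidance for the maximal annihilators, which cover the zero divisors;
    a faithful ideal is contained in none of them. *)
Lemma faithful_regular (I : set R^o) : is_submodule I ->
  (forall s, (forall d, I d -> d * s = 0) -> s = 0) ->
  exists2 t, nonzerodivisor t & I t.
Proof.
move=> sI fI; have [l [lm lz]] := max_ann_finite.
suff [t It tl] : exists2 t, I t & forall s, s \in l -> t * s <> 0.
  by exists t => //; apply: contrapT => /lz[s /tl].
elim: l lm {lz} => [|s l IH] lm; first by exists 0 => //; exact: submod0.
have [|t It tl] := IH; first by move=> u ul; apply: lm; rewrite inE ul orbT.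
have ms := lm s (mem_head _ _).
have [ts|ts] := pselect (t * s = 0); last first.
  by exists t => // u; rewrite inE => /orP[/eqP->//|/tl].
have [c cs cl] : exists2 c, c * s <> 0 & forall u, u \in l -> c * u = 0.
  elim: l lm tl {IH} => [|u l IH] lm tl; first by exists 1; rewrite // mul1r; case: ms.
  have [v|v vl|c cs cl] := IH.
  - by rewrite inE => /orP[/eqP->|vl] //; apply: lm; rewrite !inE vl !orbT.
  - by apply: tl; rewrite inE vl orbT.
  have mu : max_ann u by apply: lm; rewrite !inE eqxx orbT.
  have [a au as0] : exists2 a, a * u = 0 & a * s <> 0.
    apply: contrapT => na; apply: (tl u); first by rewrite inE eqxx.
    apply: (mu.2 s) => //; first by case: ms.
    by move=> a au; apply: contrapT => as0; apply: na; exists a.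
  exists (a * c); first by move=> /(max_ann_prime ms)[].
  move=> v; rewrite inE => /orP[/eqP->|/cl cu]; first by rewrite mulrAC au mul0r.
  by rewrite -mulrA cu mulr0.
have [d Id ds] : exists2 d, I d & d * s <> 0.
  apply: contrapT => nd; case: ms => + _; apply; apply: fI => d Id.
  by apply: contrapT => ds; apply: nd; exists d.
exists (t + c * d); first by apply: (submodD sI) => //; apply: submodMl.
move=> u; rewrite inE mulrDl => /orP[/eqP->|ul].
  by rewrite ts add0r => /(max_ann_prime ms)[].
by rewrite mulrAC cl // mul0r addr0; apply: tl.
Qed.

End AssociatedPrimes.

(** * Canonical ideals are fractional ideals of type one *)

Section FiniteInjectiveDimension.
Variables (R : comNzRingType) (m : ideal R) (cm : cm1 m).
Let locm : local_units m := cm1_loc cm.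

(** The vanishing of [Ext^1 (R / J, B)] for all regular ideals [J]. *)
Definition extends_regular (B : lmodType R) : Prop :=
  forall (J : set R^o) (h : R^o -> B), is_submodule J ->
    (exists2 z, nonzerodivisor z & J z) -> linear_on J h ->
    exists b, forall x : R^o, J x -> h x = (x : R) *: b.

Definition divisible (B : lmodType R) : Prop :=
  forall x b, nonzerodivisor x -> exists b' : B, b = x *: b'.

Lemma injective_extends (E : lmodType R) (I : ideal R) (h : R^o -> E) :
  injective_module E -> linear_on (I : set R^o) h ->
  exists b, forall x : R^o, I x -> h x = (x : R) *: b.
Proof.
move=> iE hl; pose g (u : ideal_module I) : E := h (ideal_val u).
have glin : linear g.
  by move=> a u v; apply: hl; apply/asboolP/ideal_valP.
pose gL : {linear ideal_module I -> E} :=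
  HB.pack g (GRing.isLinear.Build _ _ _ _ g glin).
have [k ek] := iE _ _ (ideal_incl I) gL (@ideal_incl_inj _ I).
exists (k (1 : R^o)) => x; rewrite -ideal_incl_range => -[u _ <-].
have -> : h (ideal_incl I u) = gL u by [].
rewrite -ek -linearZ; congr (k _); by rewrite /GRing.scale /= mulr1.
Qed.

(** Extend along multiplication by [x] on the ring. *)
Lemma injective_divisible (E : lmodType R) : injective_module E -> divisible E.
Proof.
move=> iE x b hx; pose f (u : R^o) : R^o := x * (u : R).
have flin : linear f by move=> a u v; rewrite /f mulrDr /GRing.scale /= mulrCA.
pose fL : {linear R^o -> R^o} := HB.pack f (GRing.isLinear.Build _ _ _ _ f flin).
pose g (u : R^o) : E := (u : R) *: b.
have glin : linear g by move=> a u v; rewrite /g scalerDl -scalerA.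
pose gL : {linear R^o -> E} := HB.pack g (GRing.isLinear.Build _ _ _ _ g glin).
have fi : injective fL.
  move=> u v /eqP; rewrite -subr_eq0 /= /f -mulrBr => /eqP/hx/eqP.
  by rewrite subr_eq0 => /eqP.
have [k ek] := iE _ _ fL gL fi; exists (k 1).
have := ek 1; rewrite /= /g scale1r => <-; rewrite -linearZ; congr (k _).
Qed.

(** A regular ideal reaches the whole ring by simple extensions, and each of them
    is governed by a homomorphism from [m]. *)
Lemma extends_from_max (B : lmodType R) :
  (forall h : R^o -> B, linear_on (m : set R^o) h ->
     exists b, forall x : R^o, m x -> h x = (x : R) *: b) ->
  extends_regular B.
Proof.
move=> hm J h sJ [z hz Jz] hl.
have [||J' [sJ' JJ' [h' hl' hh']] maxJ] := cm1_acc cm (F := [set J' |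
   [/\ is_submodule J', J `<=` J' &
     exists2 h' : R^o -> B, linear_on J' h' & forall x, J x -> h' x = h x]]).
- by exists J; split=> //; exists h.
- by move=> N [].
have zJ' : [set z * x | x in setT] `<=` J'.
  by move=> _ [x _ <-]; rewrite mulrC; apply: submodMl => //; apply: JJ'.
have [eJ|nJ] := pselect (J' = setT).
  exists (h' 1) => x Jx; rewrite -(hh' x Jx) -(linear_onZ _ sJ' hl') ?eJ //.
  by rewrite /GRing.scale /= mulr1.
have sz := principal_submod z.
have [_ fJ] := fl_split locm sz sJ' zJ' (@subsetT _ _) (cm1_fl cm hz).
have [w [_ Jw mw]] := fl_socle sJ' fJ nJ.
have [|b hb] := hm (fun a => h' ((a : R) *: w)).
  move=> a u v mu mv.
  by rewrite scalerDl -scalerA hl' //; apply: mw.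
have [|h3 [hl3 e3 _]] := linear_on_adjoin (w := w) (b := b) sJ' hl'.
  move=> a Ja; apply: hb; apply: contrapT => /locm.2[y ey].
  by apply: Jw; rewrite -[w]scale1r -ey -scalerA; apply: submodZ.
case: Jw; rewrite -(maxJ (adjoin J' w)); first exact: adjoin_in.
  split; first exact: adjoin_submod.
    by move=> u /JJ'; apply: adjoin_ext.
  by exists h3 => // x Jx; rewrite e3 ?hh' //; apply: JJ'.
exact: adjoin_ext.
Qed.

(** The connecting homomorphism of [0 -> B -> E -> B' -> 0], made explicit. Write
    [h a = a e] in [E]; the class of [e] in [B'] is killed by [m], so it defines a
    homomorphism from [x R + c R] that vanishes at [x], where [c] is a socle
    element modulo [x]. Extending it splits [e] into [c e1], with [x e1] in [B],
    and an element of [B]. *)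
Lemma socle_extension (B E B' : lmodType R) (i : {linear B -> E})
    (g : {linear E -> B'}) x c (h : R^o -> B) :
  injective_module E -> injective i -> (forall e, g e = 0 <-> range i e) ->
  range g = setT -> extends_regular B' -> nonzerodivisor x ->
  (forall y, c <> x * y) -> linear_on (m : set R^o) h ->
  exists d b, forall a r : R, m a -> a * c = x * r -> h a = r *: d + a *: b.
Proof.
move=> iE ii ex gs eB' hx cx hl.
have [e he] : exists e, forall a : R^o, m a -> i (h a) = (a : R) *: e.
  apply: (injective_extends (I := m) (h := i \o h)) => // a u v mu mv.
  by rewrite /= hl // linearP.
pose xR : set R^o := [set x * y | y in [set: R]].
have sx : is_submodule xR by exact: principal_submod.
have me a : m a -> a *: g e = 0.
  by move=> ma; rewrite -linearZ -he //; apply/ex; exists (h a).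
have [|//|k [kl k0 kc]] := @linear_on_adjoin _ R^o B' xR (fun=> 0) c (g e) sx.
  by move=> a u v _ _; rewrite scaler0 addr0.
  move=> a [y _ ey]; rewrite me //; apply: contrapT => /locm.2[t et].
  apply: (cx (t * y)); rewrite mulrCA ey /GRing.scale /= mulrA et mul1r.
  by [].
have [|b' hb'] := eB' (adjoin xR c) k (adjoin_submod (c : R^o) sx) _ kl.
  by exists x => //; apply: adjoin_ext; exists 1; rewrite ?mulr1.
have : range g b' by rewrite gs.
case=> e1 _ e1b.
have xe1 : g (x *: e1) = 0.
  have xx : xR x by exists 1; rewrite ?mulr1.
  by rewrite linearZ /= e1b -(hb' x) ?k0 //; apply: adjoin_ext.
have ce1 : g (e - c *: e1) = 0.
  rewrite linearB linearZ /= e1b -(hb' c) ?kc ?subrr //.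
  exact: (adjoin_in (c : R^o) sx).
have [d _ ed] := (ex _).1 xe1; have [b _ eb] := (ex _).1 ce1.
exists d, b => a r ma ac; apply: ii.
rewrite linearD !linearZ /= ed eb he // scalerBr !scalerA ac [x * r]mulrC.
by rewrite addrC subrK.
Qed.

(** [R / x] is a nonzero module of finite length for a regular [x] in [m]. *)
Lemma exists_socle : exists x c, [/\ m x, nonzerodivisor x,
  forall y, c <> x * y & forall a, m a -> exists r, a * c = x * r].
Proof.
have [x mx hx] := cm1_reg cm; exists x.
pose xR : set R^o := [set x * y | y in [set: R]].
have sx : is_submodule xR by exact: principal_submod.
have [|c [_ nc mc]] := fl_socle sx (cm1_fl cm hx).
  move=> e; have [y _ exy] : xR 1 by rewrite e.
  by apply: locm.1; rewrite -exy mulrC; apply: submodMl => //; exact: ideal_submodule.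
exists c; split=> // [y ey|a /mc[y _ e]]; last by exists y; rewrite e.
by apply: nc; exists y.
Qed.

(** All cosyzygies after the first are quotients of injective modules, hence
    divisible, and for a divisible [B] the first term in [socle_extension] is a
    multiplication as well. So vanishing of [Ext^1] descends from the end of the
    resolution. *)
Lemma injdim_extends n (B : lmodType R) : divisible B -> injdim_le n B ->
  extends_regular B.
Proof.
elim: n B => [|n IH] B dB.
  move=> iB J h sJ _ hl.
  exact: (injective_extends (I := Ideal sJ)).
case=> E [B' [i [g [iE ii ex gs /IH eB']]]].
have {}eB' : extends_regular B'.
  apply: eB' => x b hx; have : range g b by rewrite gs.
  case=> e _ <-; have [e' ->] := injective_divisible iE e hx.
  by exists (g e'); rewrite linearZ.
have [x [c [mx hx cx mc]]] := exists_socle.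
apply: extends_from_max => h hl.
have [d [b hdb]] := socle_extension iE ii ex gs eB' hx cx hl.
have [d' ed] := dB x d hx; exists (c *: d' + b) => a ma.
have [r er] := mc a ma.
by rewrite (hdb a r ma er) ed scalerDr !scalerA er [r * x]mulrC.
Qed.

(** Let [c] be a socle element modulo [x]. If [c] killed [C], then the first term
    in [socle_extension] would vanish by torsion-freeness and [h] would be a
    multiplication. So the annihilator of [C] lies in [x R], hence is [x] times
    itself, and Nakayama's lemma applies. *)
Lemma injdim_faithful n (C : lmodType R) (h : R^o -> C) :
  (forall x (v : C), nonzerodivisor x -> x *: v = 0 -> v = 0) ->
  injdim_le n C -> linear_on (m : set R^o) h ->
  (forall v, exists2 a, m a & h a <> a *: v) ->
  forall s, (forall v : C, s *: v = 0) -> s = 0.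
Proof.
move=> tfC idC hl nh.
case: n idC => [iC|n [E [B [i [g [iE ii ex gs idB]]]]]].
  have [v hv] := injective_extends iC hl.
  by have [a ma []] := nh v; apply: hv.
have eB : extends_regular B.
  apply: injdim_extends idB => x b hx; have : range g b by rewrite gs.
  case=> e _ <-; have [e' ->] := injective_divisible iE e hx.
  by exists (g e'); rewrite linearZ.
have [x mx hx] := cm1_reg cm.
(* A socle element modulo [x] that kills [C] is a multiple of [x]. *)
have key c : (forall a, m a -> exists r, a * c = x * r) ->
    (forall v : C, c *: v = 0) -> exists y, c = x * y.
  move=> mc c0; apply: contrapT => cx.
  have {}cx y : c <> x * y by move=> e; apply: cx; exists y.
  have [d [b hdb]] := socle_extension iE ii ex gs eB hx cx hl.
  have [a ma []] := nh b; have [r er] := mc a ma.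
  rewrite (hdb a r ma er) (_ : r *: d = 0) ?add0r //.
  by apply: (tfC x _ hx); rewrite scalerA -er -scalerA c0 scaler0.
pose ann : set R^o := [set s | forall v : C, s *: v = 0].
have sann : is_submodule ann.
  split; first by move=> v; rewrite scale0r.
  by move=> a u w hu hw v; rewrite scalerDl -scalerA hu hw scaler0 addr0.
pose xR : set R^o := [set x * y | y in [set: R]].
have sx : is_submodule xR by exact: principal_submod.
have annx : ann `<=` xR.
  move=> s hs; apply: contrapT => sxR.
  have [f _] := fl_split locm sx (adjoin_submod (s : R^o) sx) (@adjoin_ext _ _ xR s)
    (@subsetT _ _) (cm1_fl cm hx).
  have [|w [[b [y _ ey]] nw mw]] := fl_socle sx f.
    by move=> e; apply: sxR; rewrite e; apply: adjoin_in.
  have {ey}ew : (w : R) = x * y + b * s by rewrite ey subrK.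
  have [|v|z ez] := key (b * s).
  - move=> a /mw[t _ et]; exists (t - a * y).
    have {}et : x * t = a * w by exact: et.
    by rewrite mulrBr et ew; ring.
  - by rewrite -scalerA hs scaler0.
  by apply: nw; exists (y + z) => //; rewrite ew mulrDr -ez.
have s0 : @is_submodule R R^o [set 0].
  by split=> // a u v -> ->; rewrite scaler0 addr0.
have : ann = [set 0].
  apply: (nakayama locm (acc_sub (@subsetT _ _) (cm1_acc cm)) s0 sann).
    by move=> _ ->; exact: submod0.
  move=> s hs; have [y _ ey] := annx s hs.
  exists s; last by rewrite subrr.
  apply: span_ext; exists x, y; split=> // v.
  by apply: (tfC x _ hx); rewrite scalerA ey.
by move=> e s hs; have : ann s by []; rewrite e.
Qed.

End FiniteInjectiveDimension.

Section TypeTransfer.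
Variables (R : comNzRingType) (m : ideal R) (cm : cm1 m).
Variables (C : lmodType R) (f : {linear C -> R^o}).
Hypothesis fI : injective f.
Let locm : local_units m := cm1_loc cm.

Lemma torsion_free x (v : C) : nonzerodivisor x -> x *: v = 0 -> v = 0.
Proof.
move=> hx /(congr1 f); rewrite linearZ linear0 => /hx f0.
by apply: fI; rewrite linear0.
Qed.

Lemma ext1_num_submod : is_submodule (@ext1_num R m C).
Proof.
split; first by move=> a x y _ _; rewrite /= scaler0 addr0.
move=> a u v hu hv b x y mx my; rewrite /= !fctE hu // hv //.
by rewrite !scalerDr !scalerA [a * b]mulrC addrACA.
Qed.

Lemma ext1_den_submod : is_submodule (@ext1_den R m C).
Proof.
split; first by exists 0 => x _; rewrite scaler0.
move=> a u v [c hu] [d hv]; exists (a *: c + d) => x mx.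
by rewrite /= !fctE hu // hv // scalerDr !scalerA mulrC.
Qed.

Lemma ext1_den_sub : @ext1_den R m C `<=` @ext1_num R m C.
Proof.
move=> u [c hu] a x y mx my; rewrite !hu // ?scalerDl ?scalerA //.
exact: (ideal_submodule m).2.
Qed.

Lemma ext1_num_linear u : @ext1_num R m C u -> linear_on (m : set R^o) u.
Proof. by []. Qed.

Lemma ext1_max_den a u : m a -> @ext1_num R m C u -> @ext1_den R m C (a *: u).
Proof.
move=> ma /ext1_num_linear hu; exists (u a) => x mx; rewrite /= !fctE.
by rewrite -!(linear_onZ _ (ideal_submodule m) hu) // !regZ mulrC.
Qed.

Lemma cm_typeE n : is_residue_dim m (@ext1_num R m C) (@ext1_den R m C) n ->
  cm_type m C = n.
Proof.
apply: (residue_dimE locm) => //.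
- exact: ext1_den_submod.
- exact: ext1_num_submod.
- exact: ext1_den_sub.
- exact: ext1_max_den.
Qed.

Variable Q : comAlgType R.
Hypothesis tf : total_fractions Q.
Local Notation alg := (@emb R Q).
Local Notation mQ := ([set alg a | a in (m : set R)]).
Local Notation DQ := ([set alg a | a in range f]).

Let T (u : R -> C) (q : Q) : Prop := forall a, m a -> alg (f (u a)) = q * alg a.

Let TL a u v q p : T u q -> T v p -> T (a *: u + v) (a *: q + p).
Proof.
move=> hu hv b mb; rewrite !fctE linearP /= regZ algD algM hu // hv //.
by rewrite mulrDl [a *: q]algZ mulrA.
Qed.

Let TP u : @ext1_num R m C u -> exists2 q, colq DQ mQ q & T u q.
Proof.
move=> hu; have [x mx hx] := cm1_reg cm.
have [p ep] := (nzd_invertible tf x).1 hx.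
have H b y (my : m y) : u (b * y) = b *: u y :=
  linear_onZ b (ideal_submodule m) (ext1_num_linear hu) my.
have Tu : T u (alg (f (u x)) * p).
  move=> a ma; rewrite mulrAC -algM.
  have -> : f (u x) * a = f (u a) * x.
    have := H x a ma; rewrite mulrC H // => /(congr1 f).
    by rewrite !linearZ /= regZ mulrC => ->; rewrite mulrC.
  by rewrite algM -mulrA ep mulr1.
exists (alg (f (u x)) * p) => // _ [a ma <-]; rewrite -Tu //.
by exists (f (u a)) => //; exists (u a).
Qed.

Let TP' q : colq DQ mQ q -> exists2 u, @ext1_num R m C u & T u q.
Proof.
move=> hq; have /choice[u Hu] : forall a, exists c, m a -> alg (f c) = q * alg a.
  move=> a; have [ma|nma] := pselect (m a); last by exists 0.
  by have [|_ [c _ <-] e] := hq (alg a); [exists a | exists c].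
exists u => // a x y mx my; apply: fI; apply: (alg_inj tf).
rewrite Hu; last exact: (ideal_submodule m).2.
rewrite linearP /= regZ !algD !algM !Hu // mulrDr; congr (_ + _).
by rewrite mulrCA.
Qed.

Let TN u q : T u q -> @ext1_den R m C u <-> DQ q.
Proof.
move=> hT; split=> [[v hv]|[_ [v _ <-] eq]].
  have [x mx hx] := cm1_reg cm; exists (f v); first by exists v.
  have ux := (nzd_invertible tf x).1 hx; apply: (invertible_inj ux).
  have := hT x mx; rewrite hv // linearZ /= regZ algM => ->.
  by rewrite mulrC.
exists v => a ma; apply: fI; apply: (alg_inj tf).
by rewrite hT // linearZ -eq /= regZ algM mulrC.
Qed.

Let T0 : T 0 0.
Proof. by move=> a _; rewrite mul0r /= linear0 /emb scale0r. Qed.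

Lemma type_transfer n :
  is_residue_dim m (@ext1_num R m C) (@ext1_den R m C) n <->
  is_residue_dim m (colq DQ mQ) DQ n.
Proof.
split; first exact: (residue_dim_transfer (T := T)).
apply: (residue_dim_transfer (T := fun q u => T u q)) => //.
- by move=> a q p u v hu hv; apply: TL.
- by move=> q u /TN H; split=> /H.
Qed.

Lemma range_submod : is_submodule (range f : set R^o).
Proof. by apply: image_submod => // a u v; rewrite linearP. Qed.

Lemma image_ideal_submod : is_submodule DQ.
Proof. exact: (image_submod (@alg_lin R Q) range_submod). Qed.

Lemma colq_max_sub : DQ `<=` colq DQ mQ.
Proof.
move=> q Dq _ [a _ <-]; rewrite mulrC -algZ.
exact: (submodZ a image_ideal_submod Dq).
Qed.

Lemma cser_type n : cser m DQ (colq DQ mQ) n <->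
  is_residue_dim m (@ext1_num R m C) (@ext1_den R m C) n.
Proof.
rewrite type_transfer.
have sD := image_ideal_submod; have sC := colq_submod mQ sD.
have mC a u : m a -> colq DQ mQ u -> DQ (a *: u).
  by move=> ma; rewrite algZ mulrC; apply; exists a.
by rewrite (residue_dim_cser locm n sD sC colq_max_sub mC).
Qed.

End TypeTransfer.

(** Type one provides a homomorphism from [m] that is not a multiplication, so
    [D] is faithful, hence regular; then homomorphisms from [m] to [D] are the
    multiplications by elements of [D : m]. *)
Lemma canonical_type_one (R : comNzRingType) (m : ideal R) (Q : comAlgType R)
    (D : ideal R) : cm1 m -> total_fractions Q -> canonical_ideal m D ->
  type_one m [set @emb R Q a | a in (D : set R)].
Proof.
move=> cm tf [C [f [[_ _ tC [n idC]] fI <-]]].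
have rd : is_residue_dim m (@ext1_num R m C) (@ext1_den R m C) 1%N.
  move: tC; rewrite /cm_type /residue_dim; case: xgetP => // k -> h e.
  by rewrite -e.
split; last exact/(cser_type cm fI tf).
have [v [Pv _ iv]] := rd.
have [|t ht [c _ ec]] := faithful_regular (cm1_acc cm) (range_submod f).
  move=> s hs; apply: (injdim_faithful cm (h := v ord0) (torsion_free fI) idC).
  - exact: Pv.
  - move=> c; apply: contrapT => nc; apply: (cm1_loc cm).1.
    apply: (iv (fun=> 1) _ ord0); exists c => a ma.
    rewrite big_ord1 scale1r; apply: contrapT => ne; apply: nc.
    by exists a.
  - by move=> c; apply: fI; rewrite linearZ linear0 -(hs (f c)) 1?mulrC //; exists c.
have sf := range_submod f.
apply: (@ideal_frac _ _ (Ideal sf) t ht); by exists c.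
Qed.

(** * Quotient modules, Baer's criterion, a form of Nakayama's lemma *)

Section QuotientModule.
Local Open Scope quotient_scope.
Variables (R : comNzRingType) (V : lmodType R) (N : set V) (sN : is_submodule N).

Definition in_submod of is_submodule N : {pred V} := fun v => `[< N v >].

Lemma in_submod_zmod_closed : zmod_closed (in_submod sN).
Proof.
split; first by apply/asboolP; exact: submod0 sN.
by move=> u v /asboolP Nu /asboolP Nv; apply/asboolP; exact: submodB.
Qed.

HB.instance Definition _ :=
  GRing.isZmodClosed.Build V (in_submod sN) in_submod_zmod_closed.

Definition quot_module : Type := Quotient.quot (in_submod sN).
HB.instance Definition _ := GRing.Zmodule.on quot_module.

Definition quot_pi : V -> quot_module := \pi_(Quotient.quot (in_submod sN)).

Lemma quot_piP u v : quot_pi u = quot_pi v <-> N (u - v).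
Proof.
split=> [/eqP|Nuv]; last apply/eqP.
  by rewrite /quot_pi -Quotient.idealrBE => /asboolP.
by rewrite /quot_pi -Quotient.idealrBE; apply/asboolP.
Qed.

Lemma quot_piD : {morph quot_pi : u v / u + v}.
Proof. by move=> u v; rewrite /quot_pi (Quotient.pi_add (in_submod sN)). Qed.

Lemma quot_pi_repr (x : quot_module) : quot_pi (repr (x : Quotient.quot (in_submod sN))) = x.
Proof. exact: reprK. Qed.

Definition quot_scale (a : R) (x : quot_module) : quot_module :=
  quot_pi (a *: repr (x : Quotient.quot (in_submod sN))).

Lemma quot_scaleE a u : quot_scale a (quot_pi u) = quot_pi (a *: u).
Proof.
apply/quot_piP; rewrite -scalerBr; apply: (submodZ a sN).
by apply/quot_piP; rewrite quot_pi_repr.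
Qed.

Lemma quot_scaleA a b x : quot_scale a (quot_scale b x) = quot_scale (a * b) x.
Proof. by rewrite -[x]quot_pi_repr !quot_scaleE scalerA. Qed.
Lemma quot_scale1 : left_id 1 quot_scale.
Proof. by move=> x; rewrite -[x]quot_pi_repr !quot_scaleE scale1r. Qed.
Lemma quot_scaleDr : right_distributive quot_scale +%R.
Proof.
move=> a x y; rewrite -[x]quot_pi_repr -[y]quot_pi_repr.
by rewrite -quot_piD !quot_scaleE scalerDr quot_piD.
Qed.
Lemma quot_scaleDl x : {morph quot_scale^~ x : a b / a + b}.
Proof.
by move=> a b; rewrite -[x]quot_pi_repr !quot_scaleE scalerDl quot_piD.
Qed.

HB.instance Definition _ := GRing.Zmodule_isLmodule.Build R quot_module
  quot_scaleA quot_scale1 quot_scaleDr quot_scaleDl.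

Lemma quot_pi_linear : linear quot_pi.
Proof. by move=> a u v; rewrite quot_piD -quot_scaleE. Qed.

HB.instance Definition _ :=
  GRing.isLinear.Build R V quot_module _ quot_pi quot_pi_linear.

End QuotientModule.

Section Baer.
Variables (R : comNzRingType) (E : lmodType R).

Hypothesis hE : forall (I : set R^o) (h : R^o -> E), is_submodule I ->
  linear_on I h -> exists e, forall x : R^o, I x -> h x = (x : R) *: e.

(** Partial extensions are ordered through their graphs. *)
Lemma baer : injective_module E.
Proof.
move=> U W f g fI; pose G0 : set (W * E)%type := [set (f u, g u) | u in [set: U]].
have sG0 : is_submodule G0.
  split; first by exists 0; rewrite ?linear0.
  move=> a _ _ [u _ <-] [v _ <-]; exists (a *: u + v) => //.
  by rewrite !linearP.
have [||C CF [X CX] Ct|G [sG G0G fG] maxG] := zorn_nonempty (F := [set G |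
    [/\ @is_submodule R _ G, G0 `<=` G & forall e, G (0, e) -> e = 0]]) (X0 := G0).
- split=> // _ [u _ [fu <-]]; have -> : u = 0 by apply: fI; rewrite fu linear0.
  by rewrite linear0.
- by move=> X [sX _ _]; exists 0; exact: submod0.
- have [sX G0X _] := CF X CX; split.
  + split; first by exists X => //; exact: submod0.
    move=> a u v [Y CY Yu] [Z CZ Zv]; have [YZ|ZY] := Ct Y Z CY CZ.
      by exists Z => //; have [sZ _ _] := CF Z CZ; apply: sZ.2 => //; apply: YZ.
    by exists Y => //; have [sY _ _] := CF Y CY; apply: sY.2 => //; apply: ZY.
  + by move=> u /G0X Xu; exists X.
  + by move=> e [Y CY Ye]; have [_ _] := CF Y CY; apply.
have uG w e e' : G (w, e) -> G (w, e') -> e = e'.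
  move=> Ge Ge'; apply/eqP; rewrite -subr_eq0; apply/eqP/fG.
  by have := submodB sG Ge Ge'; rewrite /= -[(w, e) - _]/(w - w, e - e') subrr.
have tot : forall w, exists e, G (w, e).
  move=> w; apply: contrapT => nw.
  pose I : set R^o := [set a | exists e, G ((a : R) *: w, e)].
  have sI : is_submodule I.
    split; first by exists 0; rewrite scale0r; exact: (submod0 sG).
    move=> a u v [e He] [e' He']; exists (a *: e + e').
    rewrite scalerDl -scalerA -[(_, _)]/(a *: (u *: w, e) + (v *: w, e')).
    exact: sG.2.
  have /choice[h hh] : forall a : R^o, exists e, I a -> G ((a : R) *: w, e).
    move=> a; have [[e He]|nI] := pselect (I a); first by exists e.
    by exists 0.
  have [|e0 he0] := hE (h := h) sI.
    move=> a u v Iu Iv; have Iuv := sI.2 a u v Iu Iv.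
    apply: (uG ((a *: u + v : R^o) *: w)); first exact: hh.
    rewrite scalerDl -scalerA -[(_, _)]/(a *: ((u : R) *: w, h u) + ((v : R) *: w, h v)).
    by apply: sG.2; apply: hh.
  apply: nw; exists e0; rewrite -(maxG (adjoin G (w, e0))).
  - exact: adjoin_in.
  - split; first exact: adjoin_submod.
      by move=> u /G0G; apply: adjoin_ext.
    move=> e [a]; rewrite -[(0, e) - _]/(0 - a *: w, e - a *: e0) sub0r => Ge.
    have Ga : G (a *: w, a *: e0 - e).
      by have := submodN sG Ge; rewrite -[- _]/(- - (a *: w), - (e - a *: e0)) opprK opprB.
    have Ia : I a by exists (a *: e0 - e).
    have := uG _ _ _ Ga (hh a Ia); rewrite (he0 a Ia) => /eqP.
    by rewrite subr_eq addrC -subr_eq subrr eq_sym => /eqP.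
  - exact: adjoin_ext.
have /choice[h hh] := tot.
have hlin : linear h.
  move=> a u v; apply: (uG (a *: u + v)) => //.
  by rewrite -[(_, _)]/(a *: (u, h u) + (v, h v)); apply: sG.2.
exists (HB.pack h (GRing.isLinear.Build _ _ _ _ h hlin) : {linear W -> E}) => u /=.
by apply: (uG (f u)) => //; apply: G0G; exists u.
Qed.
End Baer.

(** Induction on the number of coordinates, applying Nakayama's lemma to the image
    of one of them and passing to its kernel. It is used for modules of
    homomorphisms, which need not be known to be finitely generated. *)
Lemma nakayama_coordinates (R : comNzRingType) (m : ideal R) (V W : lmodType R)
    (L : set W) (phi : nat -> V -> W) (x : R) t (P P0 : set V) :
  local_units m -> m x -> acc L -> (forall i, lin (phi i)) ->
  is_submodule P -> is_submodule P0 -> P0 `<=` P ->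
  (forall i u, P u -> L (phi i u)) ->
  (forall u, P u -> exists u0 v, [/\ P0 u0, P v & u = u0 + x *: v]) ->
  (forall u, P u -> (forall i, (i < t)%N -> phi i u = 0) -> P0 u) ->
  P `<=` P0.
Proof.
move=> locm mx aL pl; elim: t P P0 => [|t IH] P P0 sP sP0 P0P PL PP0 Pz.
  by move=> u Pu; apply: Pz.
have eP : phi t @` P = phi t @` P0.
  apply: (nakayama locm (acc_sub _ aL)).
  - by move=> _ [u Pu <-]; apply: PL.
  - exact: (image_submod (pl t)).
  - exact: (image_submod (pl t)).
  - by move=> _ [u /P0P Pu <-]; exists u.
  move=> _ [u Pu <-]; have [u0 [v [P0u Pv ->]]] := PP0 u Pu.
  rewrite (linD (pl t)) (linZ (pl t)).
  exists (x *: phi t v); last by rewrite addrK; exists u0.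
  by apply: span_ext; exists x, (phi t v); split=> //; exists v.
pose K := [set u | phi t u = 0].
have sK : is_submodule K.
  by split=> [|a u v Ku Kv]; rewrite /K /= ?(lin0 (pl t)) // (pl t) Ku Kv scaler0 addr0.
have H : P `&` K `<=` P0 `&` K.
  apply: IH.
  - exact: setI_submod.
  - exact: setI_submod.
  - by move=> u [/P0P].
  - by move=> i u [/PL].
  - move=> u [Pu Ku]; have [u0 [v [P0u Pv eu]]] := PP0 u Pu.
    have [v0 P0v ev] : (phi t @` P0) (phi t v) by rewrite -eP; exists v.
    exists (u0 + x *: v0), (v - v0); split.
    + split; first by apply: (submodD sP0) => //; apply: submodZ.
      move: Ku; rewrite /K /= eu !(linD (pl t)) !(linZ (pl t)) ev; exact.
    + split; first by apply: (submodB sP) => //; apply: P0P.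
      by rewrite /K /= (linB (pl t)) ev subrr.
    + by rewrite eu scalerBr addrA addrAC addrK.
  - move=> u [Pu Ku] z; split=> //; apply: Pz => // i.
    by rewrite ltnS leq_eqVlt => /orP[/eqP->|/z].
move=> u Pu; have [u0 P0u e] : (phi t @` P0) (phi t u) by rewrite -eP; exists u.
rewrite -(subrK u0 u); apply: (submodD sP0) => //; apply: (H _ _).1; split.
  by apply: (submodB sP) => //; apply: P0P.
by rewrite /K /= (linB (pl t)) e subrr.
Qed.

(** * Fractional ideals of type one have injective dimension one *)

Section InjectiveResolution.
Variables (R : comNzRingType) (m : ideal R) (Q : comAlgType R).
Hypotheses (cm : cm1 m) (tf : total_fractions Q).
Let locm : local_units m := cm1_loc cm.
Local Notation alg := (@emb R Q).
Local Notation base := (@ring_image R Q).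
Local Notation mQ := ([set alg a | a in (m : set R)]).

Lemma type_one_scl (D : set Q) p : invertible p -> type_one m D -> type_one m (scl p D).
Proof.
move=> up [fD cD]; split; first exact: scl_frac.
have -> : colq (scl p D) mQ = scl p (colq D mQ).
  have [q ep] := up; apply/seteqP; split=> [u hu|_ [u hu <-] v mv].
    exists (q * u); last by rewrite mulrA ep mul1r.
    move=> v /hu[d Dd e]; suff -> : q * u * v = d by [].
    by rewrite -mulrA -e mulrA [q * p]mulrC ep mul1r.
  by rewrite -mulrA; exists (u * v) => //; apply: hu.
by apply: cser_scl => //; exact: frac_submod.
Qed.

Section QuotientByTypeOne.
Variable D : set Q.
Hypothesis tD : type_one m D.
Let fD : fractional D := tD.1.
Let sD : is_submodule D := frac_submod fD.
Variables (B : lmodType R) (pi : {linear Q -> B}).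
Hypotheses (piS : range pi = setT) (pi0 : forall q, pi q = 0 <-> D q).

Let piE (q : B) : exists p, q = pi p.
Proof. by have [p _ <-] : range pi q by [rewrite piS]; exists p. Qed.

(** Duality separates [J] from its simple extension by [v], so some element of
    [D : J] does not multiply [v] into [D]; it multiplies [v] into [D : m], which
    modulo [D] has only one dimension to fill. *)
Lemma dual_hits (J : set Q) v p : fractional J -> ~ J v ->
  (forall a, m a -> J (a *: v)) -> colq D mQ p -> exists2 q, colq D J q & D (p - q * v).
Proof.
move=> fJ Jv mv hp; have sJ := frac_submod fJ.
have fJv := adjoin_frac tf v fJ.
have [q hq nq] : exists2 q, colq D J q & ~ D (q * v).
  apply: contrapT => nq; apply: Jv.
  have sub : colq D J `<=` colq D (adjoin J v).
    move=> q hq u [a Ju]; rewrite -(subrK (a *: v) u) mulrDr.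
    apply: submodD => //; first exact: hq.
    rewrite -scalerAr; apply: submodZ => //; apply: contrapT => nD.
    by apply: nq; exists q.
  rewrite -(dualK cm tf tD fJ) => q /sub; rewrite mulrC; apply.
  exact: adjoin_in.
have hqv : colq D mQ (q * v).
  by move=> _ [a ma <-]; rewrite -mulrA [v * _]mulrC -algZ; apply: hq; apply: mv.
have := hp; rewrite (cser1_gen cm sD tD.2 hqv nq) => -[a Dpq].
exists (a *: q); last by rewrite -scalerAl.
exact: (submodZ a (colq_submod J sD) hq).
Qed.

(** Adjust the multiplier along a maximal subideal on which [h] is already a
    multiplication; it starts at [z R], where one can divide by [z]. *)
Lemma quotient_extends_regular (J : set R^o) (h : R^o -> B) z :
  is_submodule J -> nonzerodivisor z -> J z -> linear_on J h ->
  exists q, forall x : R^o, J x -> h x = (x : R) *: pi q.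
Proof.
move=> sJ hz Jz hl; pose zR := [set z * x | x in [set: R]] : set R^o.
have sz : is_submodule zR := principal_submod z.
have zJ : zR `<=` J by move=> _ [x _ <-]; rewrite mulrC; apply: submodMl.
have [||J' [sJ' zJ' J'J [q hq]] maxJ] := cm1_acc cm (F := [set J' : set R^o |
    [/\ is_submodule J', zR `<=` J', J' `<=` J &
    exists q, forall x : R^o, J' x -> h x = (x : R) *: pi q]]).
- exists zR; split=> //.
  have [p ep] := piE (h z); have [z' ez'] := (nzd_invertible tf z).1 hz.
  exists (z' * p) => _ [x _ <-]; rewrite mulrC.
  have -> : h (x * z) = x *: h z by rewrite -(linear_onZ _ sJ hl).
  rewrite -!linearZ ep -linearZ; congr (pi _); rewrite !algZ algM.
  by rewrite -mulrA [alg z * _]mulrA ez' mul1r.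
- by move=> N [].
have [e|ne] := pselect (J' = J); first by exists q => x; rewrite -e; apply: hq.
have [_ fJ'] := fl_split locm sz sJ' zJ' (@subsetT _ _) (cm1_fl cm hz).
have [fJ _] := fl_split locm sJ' sJ J'J (@subsetT _ _) fJ'.
have [w [Jw J'w mw]] := fl_socle sJ' fJ ne.
have [p ep] := piE (h w - (w : R) *: pi q).
have fJQ : fractional [set alg a | a in J'].
  by apply: (@ideal_frac _ _ (Ideal sJ') z) => //; apply: zJ'; exists 1; rewrite ?mulr1.
have [|||q' hq' Dpq] := @dual_hits [set alg a | a in J'] (alg w) p fJQ.
- by move=> [a Ja /(alg_inj tf) e]; apply: J'w; rewrite -e.
- by move=> a /mw J'a; exists (a * w); rewrite ?algZ ?algM.
- move=> _ [a ma <-]; rewrite mulrC -algZ; apply/pi0.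
  rewrite linearZ /= -ep scalerBr scalerA -(hq (a *: w)); last exact: mw.
  by rewrite (linear_onZ _ sJ hl) // subrr.
have nq' a : J' a -> (a : R) *: pi q' = 0.
  by move=> Ja; rewrite -linearZ; apply/pi0; rewrite algZ mulrC; apply: hq'; exists a.
have wq' : (w : R) *: pi q' = pi p.
  apply/eqP; rewrite eq_sym -subr_eq0 -linearZ -linearB; apply/eqP/pi0.
  by rewrite algZ mulrC.
case: J'w; rewrite -(maxJ (adjoin J' w)).
- exact: adjoin_in.
- split; first exact: adjoin_submod.
  + by move=> u /zJ'; apply: adjoin_ext.
  + exact: adjoin_min.
  exists (q + q') => x [a Jxa].
  have Jxa' : J (x - a *: w) by apply: J'J.
  have ex : x = a *: w + (x - a *: w) by rewrite addrC subrK.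
  have -> : h x = a *: h w + (x - a *: w : R) *: pi q.
    by rewrite {1}ex hl // (hq _ Jxa).
  have xq' : (x : R) *: pi q' = a *: pi p.
    by rewrite {1}ex scalerDl (nq' _ Jxa) addr0 regZ -scalerA wq'.
  rewrite linearD scalerDr xq' -ep scalerBr scalerA regZ scalerBl.
  by rewrite addrCA.
- exact: adjoin_ext.
Qed.

End QuotientByTypeOne.
End InjectiveResolution.

Section InjectiveResolution.
Variables (R : comNzRingType) (m : ideal R) (Q : comAlgType R).
Hypotheses (cm : cm1 m) (tf : total_fractions Q).
Let locm : local_units m := cm1_loc cm.
Local Notation alg := (@emb R Q).
Local Notation base := (@ring_image R Q).
Local Notation mQ := ([set alg a | a in (m : set R)]).

(** Values in finitely many generators suffice. *)
Lemma common_denominator (B : lmodType R) (N : set B) (I : set R^o) (h : R^o -> B) :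
  is_submodule N -> is_submodule I -> linear_on I h ->
  (forall b, exists2 t, nonzerodivisor t & N (t *: b)) ->
  exists2 t, nonzerodivisor t & forall x, I x -> N (t *: h x).
Proof.
move=> sN sI hl ht.
have [||I' [sI' I'I [t tn tI']] maxI] := cm1_acc cm (F := [set I' : set R^o |
    [/\ is_submodule I', I' `<=` I &
    exists2 t, nonzerodivisor t & forall x, I' x -> N (t *: h x)]]).
- exists [set 0]; split.
  + by split=> // a u v -> ->; rewrite scaler0 addr0.
  + by move=> _ ->; exact: submod0.
  + exists 1; first exact: nzd1.
    by move=> _ ->; rewrite (linear_on0 sI hl) scaler0; exact: submod0.
- by move=> X [].
suff e : I = I' by exists t => // x; rewrite e; apply: tI'.
apply/seteqP; split=> // w Iw; have [s sn sh] := ht (h w).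
suff <- : adjoin I' w = I' by apply: adjoin_in.
apply: maxI; last exact: adjoin_ext.
split; [exact: adjoin_submod|exact: adjoin_min|].
exists (t * s); first exact: nzdM.
move=> x [a Ix]; rewrite -(subrK (a *: w) x) addrC hl //; last exact: I'I.
rewrite scalerDr; apply: (submodD sN).
  by rewrite scalerA mulrAC -scalerA; apply: (submodZ _ sN).
by rewrite mulrC -scalerA; apply: (submodZ _ sN); apply: tI'.
Qed.

(** The colons [I : t ^ n] form an increasing chain, hence become stationary. *)
Lemma artin_rees_principal (I : set R^o) t : is_submodule I ->
  exists n, forall a, I (a * t ^+ n) -> exists2 y : R, I y & a * t ^+ n = t * y.
Proof.
move=> sI.
have [||_ [n _ <-] maxn] := cm1_acc cm
    (F := [set ideal_colon I (t ^+ n) | n in [set: nat]]).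
- by exists (ideal_colon I (t ^+ 0)); exists 0%N.
- by move=> _ [n _ <-]; split=> //; apply: ideal_colon_submod.
exists n.+1 => a Ia; exists (a * t ^+ n); last by rewrite exprS mulrCA.
suff /seteqP[H _] : ideal_colon I (t ^+ n.+1) = ideal_colon I (t ^+ n) by apply: H.
apply: maxn; first by exists n.+1.
by move=> b Ib; rewrite /ideal_colon /= exprS mulrCA; apply: submodMl.
Qed.

Section TypeOneResolution.
Variable D : set Q.
Hypothesis tD : type_one m D.
Let fD : fractional D := tD.1.
Let sD : is_submodule D := frac_submod fD.

Lemma frac_absorbs_element (q : Q) : exists2 t, nonzerodivisor t & D (t *: q).
Proof.
have [_ _ [d hd Dd]] := fD; have [a [s [hs e]]] := fracP tf q.
exists (d * s); first exact: nzdM.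
by rewrite algZ algM -mulrA e mulrC -algZ; apply: submodZ.
Qed.

(** Baer's criterion for an ideal [I] that may consist of zero divisors: a regular
    [t] kills all values of [h], so by the Artin-Rees lemma [h] extends by zero to
    [I + t ^ n R], which is a regular ideal. *)
Lemma quotient_injective (B : lmodType R) (pi : {linear Q -> B}) :
  range pi = setT -> (forall q, pi q = 0 <-> D q) -> injective_module B.
Proof.
move=> piS pi0; apply: baer => I h sI hl.
have s0 : is_submodule [set (0 : B)].
  by split=> // a u v -> ->; rewrite scaler0 addr0.
have [b|t tn th] := common_denominator s0 sI hl.
  have [q _ <-] : range pi b by rewrite piS.
  have [t tn Dt] := frac_absorbs_element q.
  by exists t => //=; rewrite -linearZ; apply/pi0.
have [n ar] := artin_rees_principal t sI.
have [|h' [hl' e' _]] := linear_on_adjoin (w := t ^+ n : R^o) (b := 0) sI hl.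
  move=> a; rewrite regZ => /ar[y Iy ->]; rewrite scaler0.
  by rewrite (linear_onZ t sI hl Iy); apply: th.
have sIt := adjoin_submod (t ^+ n : R^o) sI.
have [q hq] := quotient_extends_regular cm tf tD piS pi0 sIt (nzdX (n := n) tn)
  (adjoin_in (t ^+ n : R^o) sI) hl'.
by exists (pi q) => x Ix; rewrite -hq ?e' //; apply: adjoin_ext.
Qed.
End TypeOneResolution.

(** After clearing denominators a homomorphism from an ideal has values in [D].
    Modulo [x D] it is a multiplication, by injectivity of [Q / x D]; the error is
    [x] times another homomorphism into [D], so Nakayama's lemma for the module of
    homomorphisms concludes. *)
Lemma fractions_injective (D : ideal R) :
  type_one m [set alg a | a in (D : set R)] -> injective_module Q.
Proof.
set DQ := [set alg a | a in (D : set R)] => tD.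
have fD := tD.1; have sD := frac_submod fD.
apply: baer => I h0 sI hl0.
have [t tn th] := common_denominator sD sI hl0 (frac_absorbs_element tD).
have [t' et] := (nzd_invertible tf t).1 tn.
pose h x : Q := t *: h0 x.
have hl : linear_on I h.
  by move=> a u v Iu Iv; rewrite /h hl0 // scalerDr !scalerA mulrC.
suff [q hq] : exists q, forall x : R^o, I x -> h x = (x : R) *: q.
  exists (t' * q) => x Ix; apply: (invertible_inj (q := alg t)); first by exists t'.
  by rewrite -algZ -/(h x) hq // scalerAr mulrA et mul1r.
pose P : set (R^o -> Q) := [set u | linear_on I u /\ forall x, I x -> DQ (u x)].
pose P0 : set (R^o -> Q) :=
  [set u | P u /\ exists q, forall x : R^o, I x -> u x = (x : R) *: q].
suff H : P `<=` P0 by have [_] : P0 h by apply: H.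
have sP : is_submodule P.
  split.
    split=> [a x y _ _|x _]; first by rewrite /= scaler0 addr0.
    exact: (submod0 sD).
  move=> a u v [ul uD] [vl vD]; split=> [b x y Ix Iy|x Ix]; rewrite !fctE.
    by rewrite ul // vl // !scalerDr !scalerA [a * b]mulrC addrACA.
  by apply: sD.2; [apply: uD | apply: vD].
have sP0 : is_submodule P0.
  split; first by split; [exact: submod0 | exists 0 => x _; rewrite scaler0].
  move=> a u v [Pu [q uq]] [Pv [p vp]]; split; first exact: sP.2.
  exists (a *: q + p) => x Ix; rewrite !fctE uq // vp //.
  by rewrite scalerDr !scalerA mulrC.
have [x mx hx] := cm1_reg cm.
have ux := (nzd_invertible tf x).1 hx; have [p ep] := ux.
have txD := type_one_scl tf ux tD.
have sxD := frac_submod txD.1.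
have [g [gen eI]] : exists k (g : 'I_k -> R^o), I = span (range g).
  have [k [g e]] := acc_fin_gen (acc_sub (@subsetT _ _) (cm1_acc cm)) sI.
  by exists k, g.
have Igen i : I (gen i) by rewrite eI; apply: span_ext; exists i.
pose phi i (u : R^o -> Q) : Q :=
  if insub i is Some j then u (gen j) else 0.
apply: (nakayama_coordinates (phi := phi) (t := g) locm mx (base_acc cm (Q := Q))) => //.
- move=> i a u v; rewrite /phi; case: insub => [j|]; first by rewrite !fctE.
  by rewrite scaler0 addr0.
- by move=> u [].
- move=> i u [_ uD]; rewrite /phi; case: insubP => [j _ _|_].
    by have [d _ <-] := uD _ (Igen j); exists d.
  exact: (submod0 (base_submod Q)).
- move=> u [ul uD].
  have pi0 q : quot_pi sxD q = 0 <-> scl (alg x) DQ q.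
    by have := quot_piP sxD q 0; rewrite linear0 subr0.
  have piS : range (quot_pi sxD) = setT.
    apply/seteqP; split=> // y _; rewrite -[y]quot_pi_repr.
    by eexists.
  have iB := quotient_injective txD (pi := quot_pi sxD) piS pi0.
  have [|b hb] := injective_extends (I := Ideal sI) (h := fun y => quot_pi sxD (u y)) iB.
    by move=> a y z Iy Iz; rewrite /= ul // linearP.
  have [q _ eq] : range (quot_pi sxD) b by rewrite piS.
  have hq y : I y -> scl (alg x) DQ (u y - (y : R) *: q).
    move=> Iy; apply/pi0; rewrite linearB linearZ /= eq.
    by rewrite -hb ?subrr.
  pose v (y : R^o) : Q := p * (u y - (y : R) *: q).
  have Pv : P v.
    split=> [a y z Iy Iz|y Iy]; last first.
      by have [d Dd e] := hq y Iy; rewrite /v -e mulrA [p * _]mulrC ep mul1r.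
    rewrite /v ul // scalerAr -mulrDr; congr (p * _).
    by rewrite scalerDl scalerBr regZ -scalerA opprD addrACA.
  exists (u - x *: v), v; split=> //; last by rewrite subrK.
  split; first by apply: (submodB sP) => //; apply: submodZ.
  exists q => y Iy; rewrite !fctE /v [x *: _]algZ mulrA ep mul1r.
  by rewrite opprB addrC subrK.
- move=> u Pu uz; split=> //; exists 0 => y; rewrite eI => Iy.
  have [ul uD] := Pu; rewrite scaler0.
  suff : span (range gen) `<=` [set y : R^o | I y /\ u y = 0] by move=> /(_ y Iy)[].
  apply: span_min.
    split; first by split; [exact: submod0|exact: (linear_on0 sI ul)].
    move=> a w z [Iw uw] [Iz uz']; split; first exact: sI.2.
    by rewrite ul // uw uz' scaler0 addr0.
  move=> _ [i _ <-]; split=> //.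
  by have := uz i (ltn_ord i); rewrite /phi insubT // => lt; congr (u (gen _) = 0); apply: val_inj.
Qed.
End InjectiveResolution.

(** * Fractional ideals of type one are canonical *)

Section CanonicalConverse.
Variables (R : comNzRingType) (m : ideal R) (Q : comAlgType R).
Hypotheses (cm : cm1 m) (tf : total_fractions Q).
Let locm : local_units m := cm1_loc cm.
Local Notation alg := (@emb R Q).
Local Notation base := (@ring_image R Q).
Local Notation mQ := ([set alg a | a in (m : set R)]).
Variable D : ideal R.
Local Notation DQ := ([set alg a | a in (D : set R)]).
Hypothesis tD : type_one m DQ.
Let fD : fractional DQ := tD.1.
Let sD : is_submodule DQ := frac_submod fD.
Local Notation C := (ideal_module D).
Local Notation f := (ideal_incl D).

Let fI : injective f := @ideal_incl_inj R D.

Let fZ (a : R) (w : C) : f (a *: w) = a * (f w : R).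
Proof. exact: linearZ. Qed.

Let Dr a : D a -> exists w, f w = a.
Proof. by rewrite -[D a]/((D : set R) a) -ideal_incl_range => -[w _ <-]; exists w. Qed.

Lemma max_scl_proper x : m x -> nonzerodivisor x -> scl (alg x) DQ <> DQ.
Proof.
move=> mx hx e; have [p ep] := (nzd_invertible tf x).1 hx.
have : colq DQ DQ p.
  by move=> u; rewrite -{1}e => -[v Dv <-]; rewrite mulrA [p * _]mulrC ep mul1r.
rewrite (dual_self cm tf tD) => -[a _ ea]; apply: locm.1.
suff <- : a * x = 1 by apply: submodMl => //; exact: ideal_submodule.
by apply: (alg_inj tf); rewrite algM ea alg1 mulrC.
Qed.

(** A socle element of [D / x D] is killed by any second member of a regular
    sequence. *)
Lemma ideal_module_depth : depth m C 1.
Proof.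
have step x (v : C) : (exists n w : C, [set 0] n /\ v = n + x *: w) <->
    scl (alg x) DQ (alg (f v)).
  split=> [[_ [w [-> ->]]]|[_ [a Da <-] e]].
    rewrite add0r fZ algM; exists (alg (f w)) => //.
    by exists (f w) => //; rewrite -ideal_incl_range; exists w.
  have [w ew] := Dr Da; exists 0, w; split=> //.
  rewrite add0r; apply: fI; apply: (alg_inj tf).
  by rewrite fZ algM ew.
have [t ht Dt] := frac_reg fD; move: Dt => [t' Dt /(alg_inj tf) et]; subst t'.
have [u0 eu0] := Dr Dt.
split.
  have [x mx hx] := cm1_reg cm; exists [:: x]; split=> //; split.
    by move=> y; rewrite inE => /eqP->.
  split=> [v xv|e]; first exact: (torsion_free fI hx).
  apply: (max_scl_proper mx hx); apply/seteqP; split; first exact: scl_sub.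
  move=> _ [a Da <-]; have [w <-] := Dr Da.
  by apply: (step x w).1; have : [set: C] w by []; rewrite -e.
move=> [|x [|y s]] //= [sm [xr [yr _]]].
have mx : m x by apply: sm; rewrite mem_head.
have my : m y by apply: sm; rewrite !inE eqxx orbT.
have hx : nonzerodivisor x.
  move=> a xa; apply: ht; have : (a *: u0 : C) = 0.
    apply: xr => /=; apply: fI; rewrite !fZ linear0 eu0 mulrA xa mul0r.
    by [].
  by move=> /(congr1 f); rewrite fZ linear0 eu0 mulrC.
have ux := (nzd_invertible tf x).1 hx.
have fxD := scl_frac tf ux fD.
have [_ [[a Da <-] nw mw]] := fl_socle (frac_submod fxD)
  (frac_fl cm tf fxD fD (scl_sub sD)) (max_scl_proper mx hx).
have [w ew] := Dr Da; subst a.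
case: nw; apply: (step x w).1; apply: yr; apply: (step x _).2.
by rewrite fZ algM -algZ; apply: mw.
Qed.

Lemma type_one_canonical : canonical_ideal m D.
Proof.
exists C, f; split; [|exact: fI|exact: ideal_incl_range].
split.
- apply: acc_fin_gen; last by [].
  apply: (acc_inj (f := f) _ fI (@subsetT _ _) (cm1_acc cm)).
  by move=> a u v; rewrite linearP.
- exact: ideal_module_depth.
- apply: (cm_typeE cm); apply/(cser_type cm fI tf).
  by rewrite ideal_incl_range; exact: tD.2.
- exists 1%N.
  pose inc (u : C) : Q := alg (f u).
  have incl : linear inc by move=> a u v; rewrite /inc linearP; exact: alg_lin.
  exists Q, (quot_module sD : lmodType R),
    (HB.pack inc (GRing.isLinear.Build _ _ _ _ inc incl) : {linear C -> Q}),
    (quot_pi sD).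
  have pi0 q : quot_pi sD q = 0 <-> DQ q.
    by have := quot_piP sD q 0; rewrite linear0 subr0.
  have piS : range (quot_pi sD) = setT.
    apply/seteqP; split=> // y _; rewrite -[y]quot_pi_repr.
    by eexists.
  split=> //=.
  + exact: (fractions_injective cm tf tD).
  + by move=> u v /= /(alg_inj tf)/fI.
  + move=> q; rewrite pi0; split=> [[a Da <-]|[u _ <-]].
      by have [u <-] := Dr Da; exists u.
    by exists (f u) => //; rewrite -ideal_incl_range; exists u.
  + exact: (quotient_injective cm tf tD piS pi0).
Qed.

End CanonicalConverse.

(** * Orthogonal families in the fibre ring *)

Section Powers.
Variables (R : comNzRingType) (m : ideal R) (Q : comAlgType R).
Hypotheses (cm : cm1 m) (tf : total_fractions Q).
Let locm : local_units m := cm1_loc cm.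
Local Notation alg := (@emb R Q).
Local Notation base := (@ring_image R Q).
Local Notation mQ := ([set alg a | a in (m : set R)]).

Fixpoint powq (L : set Q) (n : nat) : set Q :=
  if n is n'.+1 then prodq L (powq L n') else base.

Variable L : set Q.
Hypothesis fL : fractional L.
Local Notation P := (powq L).
Local Notation M n := (prodq mQ (P n)).

Lemma powq_submod n : is_submodule (P n).
Proof. by case: n => [|n] /=; [exact: base_submod | exact: prodq_submod]. Qed.

Lemma powq_frac n : fractional (P n).
Proof. by elim: n => [|n IH] /=; [exact: base_frac | exact: prodq_frac]. Qed.

Lemma powq1 : P 1 = L.
Proof.
have sL := frac_submod fL; apply/seteqP; split.
  apply: prodq_min => // u _ Lu [a _ <-]; rewrite mulrC -algZ; exact: submodZ.
move=> u Lu; rewrite -[u]mulr1; apply: prodq_in => //.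
by exists 1; rewrite ?alg1.
Qed.

Lemma powqM a b u v : P a u -> P b v -> P (a + b) (u * v).
Proof.
move=> Pu Pv; elim: a u Pu => [|a IH] u.
  by case=> c _ <-; rewrite add0n -algZ; apply: submodZ => //; exact: powq_submod.
have sP := powq_submod (a.+1 + b).
suff : prodq L (P a) `<=` (fun w => v * w) @^-1` P (a.+1 + b).
  by move=> H /H; rewrite /preimage /= mulrC.
apply: prodq_min; first exact: (preimage_submod (mul_lin v) sP).
move=> w1 w2 Lw Pw; rewrite /preimage /= mulrCA [v * _]mulrC.
by apply: prodq_in => //; apply: IH.
Qed.

Lemma powqD_sub a b N : is_submodule N ->
  (forall u v, P a u -> P b v -> N (u * v)) -> P (a + b) `<=` N.
Proof.
elim: a N => [|a IH] N sN H.
  move=> u Pu; rewrite -[u]mul1r; apply: H => //.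
  by exists 1; rewrite ?alg1.
rewrite addSn /=; apply: prodq_min => // u v Lu.
move: v; apply: (IH ((fun w => u * w) @^-1` N)).
  exact: (preimage_submod (mul_lin u) sN).
move=> v w Pv Pw; rewrite /preimage /= mulrA; apply: H => //.
exact: prodq_in.
Qed.

Lemma powqX a u n : P a u -> P (a * n) (u ^+ n).
Proof.
move=> Pu; elim: n => [|n IH]; first by rewrite muln0 expr0; exists 1; rewrite ?alg1.
by rewrite exprS mulnS; apply: powqM.
Qed.

Lemma powq_one : P 0 1. Proof. by exists 1; rewrite ?alg1. Qed.

Lemma maxpow_submod n : is_submodule (M n). Proof. exact: prodq_submod. Qed.

Lemma maxpow_sub n : M n `<=` P n.
Proof.
apply: prodq_min; first exact: powq_submod.
by move=> _ u [a _ <-] Pu; rewrite -algZ; apply: submodZ => //; exact: powq_submod.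
Qed.

Lemma maxpowM a b u v : M a u -> P b v -> M (a + b) (u * v).
Proof.
move=> + Pv; move: u; have sM := maxpow_submod (a + b).
suff : M a `<=` (fun w => v * w) @^-1` M (a + b).
  by move=> H u /H; rewrite /preimage /= mulrC.
apply: prodq_min; first exact: (preimage_submod (mul_lin v) sM).
move=> w1 w2 mw Pw; rewrite /preimage /= mulrCA [v * _]mulrC.
by apply: prodq_in => //; apply: powqM.
Qed.

Lemma maxpow_frac n : fractional (M n).
Proof. by apply: prodq_frac; [exact: max_frac | exact: powq_frac]. Qed.

Let bound : exists b, forall n, (lgt m (M n) (P n) <= b)%N.
Proof.
have [x mx hx] := cm1_reg cm; exists (lgt m (scl (alg x) base) base) => n.
apply: (lgt_le_scl_self cm tf hx (maxpow_frac n) (powq_frac n)).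
  by move=> _ [u Pu <-]; apply: prodq_in => //; exists x.
exact: maxpow_sub.
Qed.

(** Nilpotency of the class of [z] in the fibre ring, the direct sum of the
    [L ^ n / m L ^ n]. *)
Definition gr_nilpotent a z : Prop := exists p, M (a * p) (z ^+ p).

Lemma nilpX a z k : gr_nilpotent (a * k) (z ^+ k) -> gr_nilpotent a z.
Proof. by case=> p Mp; exists (k * p)%N; rewrite exprM mulnA. Qed.

Lemma nilp_ge a z p k : P a z -> M (a * p) (z ^+ p) -> (p <= k)%N ->
  M (a * k) (z ^+ k).
Proof.
move=> Pz Mp /subnKC<-; rewrite exprD mulnDr; apply: maxpowM => //.
exact: powqX.
Qed.

Definition orthogonal_family s a (z : 'I_s -> Q) : Prop :=
  [/\ forall i, P a (z i), forall i, ~ gr_nilpotent a (z i) &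
      forall i j, i != j -> M (a + a) (z i * z j)].

(** Orthogonal non-nilpotent elements are linearly independent in
    [L ^ a / m L ^ a], as multiplication by one of them isolates its coefficient;
    and [L ^ a / m L ^ a] is no longer than [R / x R] for a regular [x] in [m]. *)
Lemma orthogonal_bound : exists b, forall s a (z : 'I_s -> Q),
  orthogonal_family a z -> (s <= b)%N.
Proof.
have [b hb] := bound; exists b => s a z [Pz nz oz]; apply: leq_trans (hb a).
have sM := maxpow_submod a.
have c := flP (frac_fl cm tf (maxpow_frac a) (powq_frac a) (@maxpow_sub a)).
apply: (indep_mod_le locm sM c Pz) => d Md j.
apply: contrapT => /locm.2[e ed]; apply: (nz j); exists 2%N.
have Mdz : M (a + a) (d j *: (z j * z j)).
  have := maxpowM Md (Pz j); rewrite (bigD1 j) //= mulrDl -scalerAl.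
  apply: (submod_addK (maxpow_submod (a + a))).
  rewrite mulr_suml; elim/big_rec: _ => [|i u ij Mu].
    exact: (submod0 (maxpow_submod (a + a))).
  apply: (submodD (maxpow_submod (a + a))) => //.
  by rewrite -scalerAl; apply: (submodZ _ (maxpow_submod (a + a))); exact: oz.
rewrite muln2 -addnn expr2 -[_ * _]scale1r -ed -scalerA.
exact: (submodZ _ (maxpow_submod (a + a)) Mdz).
Qed.

Lemma orthogonal_pow s a k (z : 'I_s -> Q) : (0 < k)%N ->
  orthogonal_family a z -> orthogonal_family (a * k) (fun i => z i ^+ k).
Proof.
move=> k0 [Pz nz oz]; split=> [i|i /nilpX|i j ij]; [exact: powqX|exact: nz|].
rewrite -exprMn -mulnDl; apply: (nilp_ge (p := 1)) => //.
  exact: powqM.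
by rewrite muln1 expr1; apply: oz.
Qed.

(** Modulo [H] extended by [j], induction applies to the remaining generators and
    gives [L ^ n] inside [H + j L ^ n]; iterating, nilpotency of [j] absorbs the
    second term. *)
Lemma nilp_generators (H : nat -> set Q) (js : seq Q) :
  (forall n, is_submodule (H n)) ->
  (forall a b u v, H a u -> P b v -> H (a + b)%N (u * v)) ->
  (forall j, j \in js -> L j /\ exists p, H p (j ^+ p)) ->
  L `<=` addS (H 1) (span [set j | j \in js]) ->
  exists n, P n `<=` H n.
Proof.
elim: js H => [|j js IH] H sH stH hj hL.
  exists 1%N; rewrite powq1 => u /hL[v sv Hv]; rewrite -(subrK v u).
  apply: submodD => //; move: v sv {Hv}; exact: span_min.
have [Lj [p Hp]] := hj j (mem_head _ _).
have jH n u : H n u -> H n.+1 (j * u).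
  by move=> Hu; rewrite mulrC -addn1; apply: stH => //; rewrite powq1.
pose Y n : set Q := if n is n'.+1 then scl j (P n') else [set 0].
have sY n : is_submodule (Y n).
  case: n => [|n] /=; last by apply: scl_submod; exact: powq_submod.
  by split=> // a u v -> ->; rewrite scaler0 addr0.
have [||i ijs||n hn] := IH (fun n => addS (H n) (Y n)).
- by move=> n; apply: addS_submod.
- move=> a b u v [w Yw Hw] Pv; exists (w * v); last by rewrite -mulrBl; apply: stH.
  case: a Yw {Hw} => [->|a [w' Pw' <-]] /=.
    by rewrite mul0r; exact: submod0.
  by rewrite -mulrA; exists (w' * v) => //; apply: powqM.
- have [|Li [q Hq]] := hj i; first by rewrite inE ijs orbT.
  by split=> //; exists q; apply: addSl.
- move=> u /hL[v sv Hv]; rewrite -(subrK v u).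
  have s1 : is_submodule (addS (addS (H 1%N) (Y 1%N)) (span [set j | j \in js])).
    by apply: addS_submod; [exact: addS_submod | exact: span_submod].
  apply: (submodD s1).
    by apply: addSl; [exact: span_submod | exact: addSl].
  move: v sv {Hv}; apply: span_min => // v /=; rewrite inE => /orP[/eqP->|vjs].
    apply: addSl; first exact: span_submod.
    apply: addSr => //; exists 1; last by rewrite mulr1.
    exact: powq_one.
  apply: (addSr (addS_submod (sH 1%N) (sY 1%N))); exact: span_ext.
have hS k : P (n + k) `<=` addS (H (n + k)%N) (Y (n + k)%N).
  apply: powqD_sub; first exact: addS_submod.
  move=> u v /hn[w Yw Hw] Pv; exists (w * v); last by rewrite -mulrBl; apply: stH.
  case: (n) Yw => [->|a [w' Pw' <-]] /=; first by rewrite mul0r; exact: submod0.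
  by rewrite -mulrA; exists (w' * v) => //; apply: powqM.
have iter k : P (n + k) `<=` addS (H (n + k)%N) (scl (j ^+ k) (P n)).
  elim: k => [|k IHk].
    by rewrite addn0 expr0 scl1; apply: addSr.
  move=> u /hS[w + Hw].  rewrite addnS /= => -[w' /IHk[_ [v Pv <-] Hv] ew].
  exists (j ^+ k.+1 * v); first by exists v.
  have -> : u - j ^+ k.+1 * v = (u - w) + j * (w' - j ^+ k * v).
    by rewrite -ew mulrBr exprS mulrA addrA subrK.
  by apply: submodD => //; [rewrite addnS in Hw | apply: jH].
exists (n + p)%N; apply: subset_trans (@iter p) _; apply: addS_min => //.
by move=> _ [v Pv <-]; rewrite addnC; apply: stH.
Qed.

(** The elements killed in the fibre ring by a power of [y]. *)
Definition torsion a y n : set Q :=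
  [set u | P n u /\ exists k, M (n + a * k) (y ^+ k * u)].

Lemma torsion_ge a y n u k l : P a y -> M (n + a * k) (y ^+ k * u) ->
  (k <= l)%N -> M (n + a * l) (y ^+ l * u).
Proof.
move=> Py Mu /subnKC<-; rewrite exprD mulnDr addnA mulrAC.
by apply: maxpowM => //; apply: powqX.
Qed.

Lemma torsion_submod a y n : P a y -> is_submodule (torsion a y n).
Proof.
move=> Py; split.
  split; first exact: submod0 (powq_submod n).
  by exists 0%N; rewrite mulr0; exact: submod0 (maxpow_submod _).
move=> c u v [Pu [k Mu]] [Pv [l Mv]]; split; first exact: (powq_submod n).2.
exists (k + l)%N; rewrite mulrDr -scalerAr; apply: (maxpow_submod _).2.
  by apply: torsion_ge Mu _; rewrite ?leq_addr.
by apply: torsion_ge Mv _; rewrite ?leq_addl.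
Qed.

Lemma torsionM a y n b u v : torsion a y n u -> P b v ->
  torsion a y (n + b) (u * v).
Proof.
move=> [Pu [k Mu]] Pv; split; first exact: powqM.
by exists k; rewrite mulrA addnAC; apply: maxpowM.
Qed.

Lemma maxpow_torsion a y n : M n `<=` torsion a y n.
Proof.
move=> u Mu; split; first exact: maxpow_sub.
by exists 0%N; rewrite mul1r muln0 addn0.
Qed.

Let generators : exists2 js : seq Q, (forall j, j \in js -> L j) &
  L `<=` span [set j | j \in js].
Proof.
have [n [g eL]] := acc_fin_gen (frac_acc cm tf fL) (frac_submod fL).
exists [seq g i | i <- enum 'I_n].
  by move=> j /mapP[i _ ->]; rewrite eL; apply: span_ext; exists i.
rewrite {1}eL; apply: span_min; first exact: span_submod.
by move=> _ [i _ <-]; apply: span_ext => /=; apply/map_f; rewrite mem_enum.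
Qed.

Lemma nilp_all (H : nat -> set Q) :
  (forall n, is_submodule (H n)) ->
  (forall a b u v, H a u -> P b v -> H (a + b)%N (u * v)) ->
  (forall j, L j -> exists p, H p (j ^+ p)) -> exists n, P n `<=` H n.
Proof.
have [js jL Lj] := generators => sH stH hj; apply: (nilp_generators (js := js)) => //.
  by move=> j jjs; split; [exact: jL | exact/hj/jL].
by move=> u /Lj; apply: addSr.
Qed.

(** If all [z w] were nilpotent, the generators of [L] would be nilpotent modulo
    the elements killed by a power of [z], and then so would be [z] itself. *)
Lemma nilp_succ a z : (0 < a)%N -> P a z -> ~ gr_nilpotent a z ->
  exists2 w, L w & ~ gr_nilpotent (a + 1) (z * w).
Proof.
move=> a0 Pz nz; apply: contrapT => nw; apply: nz.
have [||j Lj|n hn] := @nilp_all (torsion a z).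
- by move=> n; apply: torsion_submod.
- by move=> k b u v; apply: torsionM.
- have [p Mp] : gr_nilpotent (a + 1) (z * j) by apply: contrapT => nj; apply: nw; exists j.
  exists p; split; first by rewrite -[X in P X]mul1n; apply: powqX; rewrite powq1.
  by exists p; rewrite -exprMn (_ : (p + a * p = (a + 1) * p)%N) //; lia.
have : P (a * n) `<=` torsion a z (a * n).
  have le : (n <= a * n)%N by rewrite leq_pmull.
  rewrite -(subnKC le); apply: powqD_sub; first exact: torsion_submod.
  by move=> u v /hn hu; apply: torsionM.
move=> /(_ _ (powqX n Pz))[_ [k Mk]]; exists (k + n)%N.
by rewrite exprD mulnDr addnC.
Qed.

Lemma orthogonal_succ s a (z : 'I_s -> Q) : (0 < a)%N ->
  orthogonal_family a z -> exists z' : 'I_s -> Q, orthogonal_family (a + 1) z'.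
Proof.
move=> a0 [Pz nz oz].
have /choice[w hw] : forall i, exists w, L w /\ ~ gr_nilpotent (a + 1) (z i * w).
  by move=> i; have [w Lw nw] := nilp_succ a0 (Pz i) (nz i); exists w.
have Pw i : P 1 (w i) by rewrite powq1; case: (hw i).
exists (fun i => z i * w i); split=> [i|i|i j ij].
- exact: powqM.
- by case: (hw i).
- by rewrite mulrACA addnACA; apply: maxpowM; [exact: oz | exact: powqM].
Qed.

End Powers.

(** * Reductions and multiplicity *)

Section Reduction.
Variables (R : comNzRingType) (m : ideal R) (Q : comAlgType R).
Hypotheses (cm : cm1 m) (tf : total_fractions Q).
Let locm : local_units m := cm1_loc cm.
Local Notation alg := (@emb R Q).
Local Notation base := (@ring_image R Q).
Local Notation mQ := ([set alg a | a in (m : set R)]).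

Variable L : set Q.
Hypothesis fL : fractional L.
Local Notation P := (powq L).
Local Notation M n := (prodq mQ (P n)).

(** A reduction in degree [a]: with a finite residue field [L] itself may contain
    none. *)
Definition reduction_from N a (y : Q) : Prop :=
  P a y /\ forall n, (N <= n)%N -> P (n + a) = scl y (P n).

(** Multiplication by [y] embeds [P n / torsion] in [P (n + a) / torsion]. The
    lengths along [0, a, 2 a, ...] are bounded, so some embedding is onto. *)
Lemma torsion_onto a y : P a y ->
  exists n, P (n + a) `<=` addS (torsion m L a y (n + a)) (scl y (P n)).
Proof.
move=> Py; pose T n := torsion m L a y n.
have sT n : is_submodule (T n) by apply: torsion_submod.
have TP n : T n `<=` P n by move=> u [].
have fT n : fractional (T n).
  exact: (frac_between (maxpow_frac cm fL n) (powq_frac fL n) (sT n)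
    (@maxpow_torsion _ _ _ _ _ _ _) (@TP n)).
have flT n : finite_length m (T n) (P n).
  exact: (frac_fl cm tf (fT n) (powq_frac fL n) (@TP n)).
have [b hb] : exists b, forall n, (lgt m (T n) (P n) <= b)%N.
  have [x mx hx] := cm1_reg cm; exists (lgt m (scl (alg x) base) base) => n.
  apply: (lgt_le_scl_self cm tf hx (fT n) (powq_frac fL n) _ (@TP n)).
  move=> _ [u Pu <-]; apply: maxpow_torsion; apply: prodq_in => //.
  by exists x.
pose Z n := addS (T (n + a)%N) (scl y (P n)).
have yP n : scl y (P n) `<=` P (n + a).
  by move=> _ [u Pu <-]; rewrite addnC; apply: powqM.
have push n : cser m (T (n + a)%N) (Z n) (lgt m (T n) (P n)).
  apply: (cser_push (mul_lin y) (sT n) (sT _) _ _ (flP (flT n))).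
    move=> _ [u Tu <-]; rewrite mulrC; exact: (torsionM Tu Py).
  move=> u Pu [_ [k Mk]]; split=> //; exists k.+1.
  by move: Mk; rewrite mulrA -exprSr mulnS addnA.
have sZ n : is_submodule (Z n).
  by apply: addS_submod => //; apply: scl_submod; exact: powq_submod.
have TZ n : T (n + a)%N `<=` Z n.
  by apply: addSl; apply: scl_submod; exact: powq_submod.
have ZP n : Z n `<=` P (n + a).
  by apply: addS_min => //; exact: powq_submod.
have fZ n : fractional (Z n).
  exact: (frac_between (fT _) (powq_frac fL _) (sZ n) (@TZ n) (@ZP n)).
have le n : lgt m (T (n + a)%N) (P (n + a)) =
    (lgt m (T n) (P n) + lgt m (Z n) (P (n + a)))%N.
  rewrite (frac_lgt_add cm tf (fT _) (fZ n) (powq_frac fL _) (@TZ n) (@ZP n)).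
  by rewrite (lgtE locm (sT _) (push n)).
apply: contrapT => nex.
have lt n : (lgt m (T n) (P n) < lgt m (T (n + a)%N) (P (n + a)))%N.
  rewrite le -addn1 leq_add2l lt0n; apply/eqP => e0; apply: nex; exists n.
  by rewrite -(frac_lgt_eq0 cm tf (fZ n) (powq_frac fL _) (@ZP n) e0).
have grow k : (k <= lgt m (T (a * k)%N) (P (a * k)))%N.
  elim: k => // k IH; apply: leq_ltn_trans IH _.
  by rewrite mulnS addnC.
by have := leq_trans (grow b.+1) (hb _); rewrite ltnn.
Qed.

(** An element killed by a power of [y] is nilpotent, for otherwise its powers
    would enlarge the family. As everything of some degree is [y]-divisible up to
    such elements, everything is nilpotent modulo [y]. *)
Lemma orthogonal_reduction s a (z : 'I_s -> Q) : (0 < a)%N ->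
  orthogonal_family m L a z ->
  (forall s' a' (z' : 'I_s' -> Q), (0 < a')%N ->
     orthogonal_family m L a' z' -> (s' <= s)%N) ->
  exists N, reduction_from N a (\sum_i z i).
Proof.
move=> a0 oz smax; have [Pz nz zz] := oz.
set y := \sum_i z i; have sM n : is_submodule (M n) by exact: prodq_submod.
have Py : P a y by apply: submod_sum => //; exact: powq_submod.
have [n1 hn1] := torsion_onto Py; set n' := (n1 + a)%N in hn1.
have zy j : M (a + a) (z j * y - z j * z j).
  rewrite /y (bigD1 j) //= mulrDr addrAC subrr add0r mulr_sumr.
  elim/big_rec: _ => [|i u ij Mu]; first exact: (submod0 (sM _)).
  by apply: (submodD (sM _)) => //; apply: zz; rewrite eq_sym.
have zyk j k : M (a * k.+1) (z j * y ^+ k - z j ^+ k.+1).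
  elim: k => [|k IH].
    by rewrite expr0 mulr1 expr1 subrr; exact: (submod0 (sM _)).
  have -> : z j * y ^+ k.+1 - z j ^+ k.+2 =
      (z j * y - z j * z j) * y ^+ k + z j * (z j * y ^+ k - z j ^+ k.+1).
    by rewrite !exprS; ring.
  apply: (submodD (sM _)) => //; last first.
    by rewrite mulrC mulnSr; apply: (maxpowM IH).
  have -> : (a * k.+2 = (a + a) + a * k)%N by lia.
  by apply: maxpowM => //; apply: powqX.
have Tnil t : torsion m L a y n' t -> gr_nilpotent m L n' t.
  move=> [Pt [k Mk]]; apply: contrapT => nt.
  have ztk j : M (a * k.+1 + n') (z j ^+ k.+1 * t).
    have -> : z j ^+ k.+1 * t = z j * (y ^+ k * t) - (z j * y ^+ k - z j ^+ k.+1) * t.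
      by ring.
    apply: (submodB (sM _)) => //; last exact: maxpowM.
    have -> : (a * k.+1 + n' = (n' + a * k) + a)%N by lia.
    by rewrite mulrC; apply: maxpowM.
  (* The exponents [d] and [c] bring the [z j] and [t] to the common degree
     [a * d], and are large enough for [z j ^+ d * t ^+ c] to contain the factor
     [z j ^+ k.+1 * t]. *)
  pose d := (n' * k.+1)%N; pose c := (a * k.+1)%N.
  pose z' (i : 'I_s.+1) := if unlift ord_max i is Some j then z j ^+ d else t ^+ c.
  have ed : (n' * c = a * d)%N by rewrite /d /c; lia.
  have n'0 : (0 < n')%N by rewrite /n'; lia.
  have d0 : (0 < d)%N by rewrite /d muln_gt0 n'0.
  have c0 : (0 < c)%N by rewrite /c muln_gt0 a0.
  have [Pz' nz' zz'] := orthogonal_pow d0 oz.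
  have ztd j : M (a * d + a * d) (z j ^+ d * t ^+ c).
    have -> : z j ^+ d * t ^+ c = (z j ^+ k.+1 * t) * (z j ^+ (d - k.+1) * t ^+ c.-1).
      rewrite mulrACA -exprD -exprS prednK // subnKC //.
      by rewrite /d leq_pmull.
    have -> : (a * d + a * d = (a * k.+1 + n') + (a * (d - k.+1) + n' * c.-1))%N.
      have l1 : (k.+1 <= d)%N by rewrite /d leq_pmull.
      have e1 : (a * d = a * k.+1 + a * (d - k.+1))%N by rewrite -mulnDr subnKC.
      have e2 : (a * d = n' + n' * c.-1)%N by rewrite -ed -mulnS prednK.
      by lia.
    apply: maxpowM => //.
    by apply: powqM; apply: powqX.
  suff /smax : orthogonal_family m L (a * d) z' by rewrite muln_gt0 a0 d0 ltnn => /(_ isT).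
  split.
  - move=> i; rewrite /z'; case: unliftP => [j _|_]; first exact: Pz'.
    by rewrite -ed; apply: powqX.
  - move=> i; rewrite /z'; case: unliftP => [j _|_]; first exact: nz'.
    by rewrite -ed => /nilpX.
  - move=> i j; rewrite /z'; case: unliftP => [i' ->|->]; case: unliftP => [j' ->|->].
    + by move=> ij; apply: zz'; apply: contraNneq ij => ->.
    + by move=> _; apply: ztd.
    + by move=> _; rewrite mulrC; apply: ztd.
    + by rewrite eqxx.
(* The ideal generated by [y] in degree [n] is zero below degree [a]. *)
pose Y n : set Q := if (a <= n)%N then scl y (P (n - a)) else [set 0].
have sY n : is_submodule (Y n).
  rewrite /Y; case: ifP => _; first by apply: scl_submod; exact: powq_submod.
  by split=> // c u v -> ->; rewrite scaler0 addr0.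
pose H n := addS (M n) (Y n).
have sH n : is_submodule (H n) by apply: addS_submod.
have stH c b u v : H c u -> P b v -> H (c + b)%N (u * v).
  move=> [w Yw Mw] Pv; exists (w * v); last by rewrite -mulrBl; apply: maxpowM.
  move: Yw; rewrite /Y; case: leqP => [ac [w' Pw' <-]|_ ->]; last first.
    by rewrite mul0r; exact: (submod0 (sY _)).
  rewrite (leq_trans ac (leq_addr _ _)) -addnBAC // -mulrA.
  by exists (w' * v) => //; apply: powqM.
have [||j Lj|n hn] := nilp_all cm tf fL (H := H) => //.
  have Pj : P n' (j ^+ n').
    by rewrite -[X in P X]mul1n; apply: powqX => //; rewrite powq1.
  have [w [w1 Pw1 ew] Tt] := hn1 _ Pj; have [Pt _] := Tt.
  have [p Mp] := Tnil _ Tt; set t := j ^+ n' - w in Mp Tt Pt.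
  exists (n' * p.+1)%N; rewrite exprM; set u := j ^+ n' in Pj t Mp Tt Pt *.
  exists (u ^+ p.+1 - t ^+ p.+1); last first.
    rewrite opprB addrC subrK.
    by apply: (nilp_ge Pt Mp).
  have an' : (a <= n' * p.+1)%N by rewrite mulnS /n' -addnA addnCA leq_addr.
  rewrite /Y an' subrXX (_ : u - t = y * w1); last by rewrite /t subKr ew.
  rewrite -mulrA; exists (w1 * \sum_(i < p.+1) u ^+ (p.+1.-1 - i) * t ^+ i) => //.
  have -> : (n' * p.+1 - a = n1 + n' * p)%N by rewrite mulnS /n' addnAC addnK.
  apply: powqM => //; apply: submod_sum => [|i]; first exact: powq_submod.
  have -> : (n' * p = n' * (p - i) + n' * i)%N.
    by rewrite -mulnDr subnK // -ltnS.
  by apply: powqM => //; apply: powqX.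
exists (n + a)%N; split=> // k nk.
have kn : (n <= k + a)%N by lia.
have PH : P (k + a) `<=` H (k + a)%N.
  rewrite -(subnKC kn); apply: powqD_sub; first exact: sH.
  by move=> u v /hn; apply: stH.
have yP : scl y (P k) `<=` P (k + a).
  by move=> _ [u Pu <-]; rewrite addnC; apply: powqM.
apply: (frac_nakayama cm tf (powq_frac fL _) _ yP).
  by apply: scl_submod; exact: powq_submod.
move=> u /PH[w + Mw]; rewrite /Y leq_addl addnK => Yw.
exists (u - w) => //; by rewrite subKr.
Qed.

Lemma reduction_invertible N a y : reduction_from N a y -> invertible y.
Proof.
move=> [_ h]; have [_ _ [t ht]] := powq_frac fL (N + a).
rewrite h // => -[u _ e]; have [p ep] := (nzd_invertible tf t).1 ht.
by exists (u * p); rewrite mulrA e.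
Qed.

(** A family of maximal size can be moved one degree up. *)
Lemma exists_reductions : exists N a y y', [/\ (0 < a)%N, reduction_from N a y &
  reduction_from N a.+1 y'].
Proof.
have [b hb] := orthogonal_bound cm tf fL.
pose ok s := `[< exists a (z : 'I_s -> Q), (0 < a)%N /\ orthogonal_family m L a z >].
have ex : exists s, ok s.
  exists 0%N; apply/asboolP; exists 1%N, (fun=> 0); split=> //.
  by split=> [[]|[]|[]].
have bd s : ok s -> (s <= b)%N by move=> /asboolP[a [z [_ /hb]]].
have [s /asboolP[a [z [a0 oz]]] smax] := ex_maxnP ex bd.
have {}smax s' a' (z' : 'I_s' -> Q) : (0 < a')%N ->
    orthogonal_family m L a' z' -> (s' <= s)%N.
  by move=> a'0 oz'; apply: smax; apply/asboolP; exists a', z'.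
have [N hN] := orthogonal_reduction a0 oz smax.
have [z' oz'] := orthogonal_succ cm tf fL a0 oz.
have [N' hN'] := orthogonal_reduction (ltn_addl a (ltnSn 0)) oz' smax.
have [y1 hy1] := hN; have [y2 hy2] := hN'.
exists (N + N')%N, a, (\sum_i z i), (\sum_i z' i).
rewrite addn1 in y2 hy2; split=> //.
  by split=> // n le; apply: hy1; lia.
by split=> // n le; apply: hy2; lia.
Qed.

Hypothesis Lbase : L `<=` base.

Lemma powq_dec n : P n.+1 `<=` P n.
Proof.
apply: prodq_min; first exact: powq_submod.
move=> u v /Lbase[a _ <-] Pv; rewrite -algZ; apply: submodZ => //.
exact: powq_submod.
Qed.

Lemma powq_base n : P n `<=` base.
Proof. by elim: n => // n IH; apply: subset_trans IH; exact: powq_dec. Qed.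

(** The leading coefficient of the Hilbert-Samuel polynomial of [L]. *)
Definition hilbert_slope (e : nat) : Prop := exists N c, forall n, (N <= n)%N ->
  (lgt m (P n) base + c = e * n + lgt m (P N) base)%N.

(** The successive differences of the colengths have the coprime periods [a] and
    [a.+1], hence are constant. *)
Lemma exists_hilbert_slope : exists e, hilbert_slope e.
Proof.
have [N [a [y [y' [a0 hy hy']]]]] := exists_reductions.
pose h n := lgt m (P n.+1) (P n).
have per b x : reduction_from N b x -> forall n, (N <= n)%N -> h (n + b)%N = h n.
  move=> hx n le; rewrite /h -addSn !(hx.2) ?(leqW le) //.
  rewrite lgt_scl //; first exact: (reduction_invertible hx).
    exact: powq_submod.
  by apply: (frac_fl cm tf); [exact: powq_frac | exact: powq_frac | exact: powq_dec].
have hS n : (N <= n)%N -> h n.+1 = h n.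
  move=> le; rewrite -(per _ _ hy _ (leqW le)) addSnnS.
  exact: (per _ _ hy').
have hc n : (N <= n)%N -> h n = h N.
  by move=> /subnKC<-; elim: (n - N)%N => [|k IH]; rewrite ?addn0 // addnS hS ?leq_addr.
exists (h N), N, (h N * N)%N => n /subnKC<-; elim: (n - N)%N => [|k IH].
  by rewrite addn0 addnC.
rewrite addnS (frac_lgt_add cm tf (powq_frac fL _) (powq_frac fL (N + k)) (base_frac Q)).
- by rewrite -/(h (N + k)%N) hc ?leq_addr //; lia.
- exact: powq_dec.
- exact: powq_base.
Qed.

(** [L ^ n / L ^ (n + a)] is [L ^ n / t L ^ n], as long as [R / t R]. *)
Lemma reduction_slope N a t e : reduction_from N a (alg t) -> hilbert_slope e ->
  (a * e)%N = lgt m (scl (alg t) base) base.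
Proof.
move=> hy [N' [c hl]]; set n := (N + N')%N.
have ht : nonzerodivisor t by apply/(nzd_invertible tf)/(reduction_invertible hy).
have fP := powq_frac fL.
have sub : P (n + a) `<=` P n.
  elim: (a) => [|k IH]; first by rewrite addn0.
  by rewrite addnS; apply: subset_trans IH; exact: powq_dec.
have H3 := frac_lgt_add cm tf (fP (n + a)%N) (fP n) (base_frac Q) sub (@powq_base n).
have H2 := hl n (leq_addl _ _).
have H1 := hl (n + a)%N (leq_trans (leq_addl N N') (leq_addr a _)).
have H4 := lgt_scl_self cm tf ht (fP n).
rewrite -(hy.2 n (leq_addr _ _)) in H4.
by rewrite -H4; move: H1 H2 H3; rewrite mulnDr [(a * e)%N]mulnC; lia.
Qed.

Lemma exists_reduction : exists N a t, (0 < a)%N /\ reduction_from N a (alg t).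
Proof.
have [N [a [y [_ [a0 hy _]]]]] := exists_reductions.
have [t _ et] := powq_base hy.1.
by exists N, a, t; rewrite et.
Qed.

Lemma reduction_pow N a y k : reduction_from N a y ->
  reduction_from N (a * k) (y ^+ k).
Proof.
move=> [Py hy]; split; first exact: powqX.
elim: k => [|k IH] n le; first by rewrite muln0 addn0 expr0 scl1.
rewrite mulnS addnA IH ?(leq_trans le (leq_addr _ _)) // hy // sclM.
by rewrite exprSr.
Qed.

End Reduction.

(** * Multiplicities of products *)

Section Multiplicity.
Variables (R : comNzRingType) (m : ideal R) (Q : comAlgType R).
Hypotheses (cm : cm1 m) (tf : total_fractions Q).
Let locm : local_units m := cm1_loc cm.
Local Notation alg := (@emb R Q).
Local Notation base := (@ring_image R Q).
Local Notation len t := (lgt m (scl (alg t) base) base).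
Implicit Types (L K : set Q) (t : R).

Lemma lenM s t : nonzerodivisor s -> nonzerodivisor t ->
  len (s * t) = (len s + len t)%N.
Proof.
move=> hs ht; have us := (nzd_invertible tf s).1 hs.
have ut := (nzd_invertible tf t).1 ht.
have fs := scl_frac tf us (base_frac Q); have ft := scl_frac tf ut (base_frac Q).
rewrite algM -sclM (frac_lgt_add cm tf (scl_frac tf us ft) ft (base_frac Q)).
- by rewrite (lgt_scl_self cm tf hs ft).
- by apply: scl_sub; apply: scl_submod; exact: base_submod.
- by apply: scl_sub; exact: base_submod.
Qed.

Lemma lenX s k : nonzerodivisor s -> len (s ^+ k) = (k * len s)%N.
Proof.
move=> hs; elim: k => [|k IH].
  by rewrite expr0 alg1 scl1 lgt_refl //; exact: base_submod.
by rewrite exprS lenM ?IH //; exact: nzdX.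
Qed.

Lemma algX t n : alg (t ^+ n) = alg t ^+ n.
Proof. by elim: n => [|n IH]; rewrite ?alg1 // !exprS algM IH. Qed.

Lemma reduction_nzd L N a t : fractional L -> reduction_from L N a (alg t) ->
  nonzerodivisor t.
Proof. by move=> fL /(reduction_invertible tf fL)/(nzd_invertible tf). Qed.

Lemma hilbert_slope_uniq L e e' : fractional L -> L `<=` base ->
  hilbert_slope m L e -> hilbert_slope m L e' -> e = e'.
Proof.
move=> fL Lb h h'; have [N [a [t [a0 ht]]]] := exists_reduction cm tf fL Lb.
have := reduction_slope cm tf fL Lb ht h'.
rewrite -(reduction_slope cm tf fL Lb ht h) => /eqP.
by rewrite eqn_pmul2l // => /eqP.
Qed.

Lemma prodqACA L1 L2 L3 L4 :
  prodq (prodq L1 L2) (prodq L3 L4) = prodq (prodq L1 L3) (prodq L2 L4).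
Proof.
suff H (A B C D : set Q) : prodq (prodq A B) (prodq C D) `<=` prodq (prodq A C) (prodq B D).
  by apply/seteqP; split.
apply: prodq_min; first exact: prodq_submod.
move=> u v + CDv; move: u.
pose E := prodq (prodq A C) (prodq B D); have sE : is_submodule E by exact: prodq_submod.
suff : prodq A B `<=` (fun u => v * u) @^-1` E.
  by move=> H u /H; rewrite /preimage /= mulrC.
apply: prodq_min; first exact: (preimage_submod (mul_lin v) sE).
move=> a b Aa Bb; rewrite /preimage /= mulrC.
move: v CDv; suff : prodq C D `<=` (fun v => (a * b) * v) @^-1` E by [].
apply: prodq_min; first exact: (preimage_submod (mul_lin _) sE).
by move=> c d Cc Dd; rewrite /preimage /= mulrACA; do 2!apply: prodq_in => //.
Qed.

Lemma powq_prodq L K n : powq (prodq L K) n = prodq (powq L n) (powq K n).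
Proof.
elim: n => [|n IH] /=; last by rewrite IH prodqACA.
apply/seteqP; split=> [u bu|].
  by rewrite -[u]mulr1; apply: prodq_in => //; exists 1; rewrite ?alg1.
by apply: prodq_min; [exact: base_submod | exact: baseM].
Qed.

Lemma prodq_scl p q L K : prodq (scl p L) (scl q K) = scl (p * q) (prodq L K).
Proof.
apply/seteqP; split.
  apply: prodq_min; first by apply: scl_submod; exact: prodq_submod.
  move=> _ _ [u Lu <-] [v Kv <-]; exists (u * v); first exact: prodq_in.
  by rewrite mulrACA.
move=> _ [w Pw <-].
suff : prodq L K `<=` (fun w => p * q * w) @^-1` prodq (scl p L) (scl q K) by apply.
apply: prodq_min; first exact: (preimage_submod (mul_lin _) (prodq_submod _ _)).
move=> u v Lu Kv; rewrite /preimage /= mulrACA.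
by apply: prodq_in; [exists u | exists v].
Qed.

Lemma prodq_base L K : L `<=` base -> K `<=` base -> prodq L K `<=` base.
Proof.
move=> Lb Kb; apply: prodq_min; first exact: base_submod.
by move=> u v /Lb bu /Kb bv; apply: baseM.
Qed.

(** Reductions of equal degree multiply. *)
Lemma hilbert_slope_prodq L K e e' : fractional L -> L `<=` base ->
  fractional K -> K `<=` base -> hilbert_slope m L e -> hilbert_slope m K e' ->
  hilbert_slope m (prodq L K) (e + e').
Proof.
move=> fL Lb fK Kb he he'; have fP := prodq_frac fL fK.
have Pb := prodq_base Lb Kb.
have [e2 he2] := exists_hilbert_slope cm tf fP Pb.
have [N [a [t [a0 ht]]]] := exists_reduction cm tf fL Lb.
have [N' [b [s [b0 hs]]]] := exists_reduction cm tf fK Kb.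
have {}ht := reduction_pow b ht; have {}hs := reduction_pow a hs.
rewrite mulnC -algX in hs; rewrite -algX in ht.
have h2 : reduction_from (prodq L K) (N + N') (a * b) (alg (t ^+ b * s ^+ a)).
  split=> [|n le]; rewrite algM.
    by rewrite powq_prodq; apply: prodq_in; [exact: ht.1 | exact: hs.1].
  rewrite !powq_prodq ht.2 ?hs.2 ?prodq_scl //; lia.
have E := reduction_slope cm tf fP Pb h2 he2.
rewrite lenM in E; [|exact: (reduction_nzd fL ht)|exact: (reduction_nzd fK hs)].
rewrite -(reduction_slope cm tf fL Lb ht he) in E.
rewrite -(reduction_slope cm tf fK Kb hs he') -mulnDr in E.
have ab0 : (0 < a * b)%N by rewrite muln_gt0 a0.
by move/eqP: E; rewrite eqn_pmul2l // => /eqP <-.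
Qed.

Lemma powq_scl q L n : powq (scl q L) n = scl (q ^+ n) (powq L n).
Proof.
by elim: n => [|n IH] /=; rewrite ?expr0 ?scl1 // IH prodq_scl exprS.
Qed.

Lemma hilbert_slope_scl L e t : nonzerodivisor t -> fractional L -> L `<=` base ->
  hilbert_slope m L e -> hilbert_slope m (scl (alg t) L) (len t + e).
Proof.
move=> ht fL Lb he; have fS := scl_frac tf ((nzd_invertible tf t).1 ht) fL.
have Sb : scl (alg t) L `<=` base.
  by apply: subset_trans Lb; apply: scl_sub; exact: frac_submod.
have [e2 he2] := exists_hilbert_slope cm tf fS Sb.
have [N [a [s [a0 hs]]]] := exists_reduction cm tf fL Lb.
have h2 : reduction_from (scl (alg t) L) N a (alg (t ^+ a * s)).
  rewrite algM algX; split=> [|n le]; rewrite !powq_scl.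
    by exists (alg s) => //; exact: hs.1.
  rewrite hs.2 // !sclM; congr (scl _ _); rewrite exprD; ring.
have E := reduction_slope cm tf fS Sb h2 he2.
rewrite lenM ?lenX in E => //; [|exact: nzdX|exact: (reduction_nzd fL hs)].
rewrite -(reduction_slope cm tf fL Lb hs he) -mulnDr in E.
by move/eqP: E; rewrite eqn_pmul2l // => /eqP <-.
Qed.

Local Notation img I := ([set alg a | a in (I : set R)]).

Lemma image_ideal_pow (I : ideal R) n : img (ideal_pow I n) = powq (img I) n.
Proof.
elim: n => [|n IH] //=; rewrite (image_span (@alg_lin R Q)) -IH /prodq; congr span.
apply/seteqP; split=> [_ [_ [x [y [Ix Py ->]] <-]]|_ [_ [_ [[x Ix <-] [y Py <-] ->]]]].
  by exists (alg x), (alg y); split; [exists x|exists y|rewrite algM].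
by exists (x * y); [exists x, y | rewrite algM].
Qed.

Lemma img_base (I : set R) : img I `<=` base.
Proof. by move=> _ [a _ <-]; exists a. Qed.

Lemma colength_lgt (I : set R^o) : is_submodule I -> fractional (img I) ->
  colength I = lgt m (img I) base.
Proof.
move=> sI fI; have c := flP (frac_fl cm tf fI (base_frac Q) (@img_base I)).
apply: (cser_colength locm sI).
have := cser_preimage (@alg_lin R Q) (frac_submod fI) (@subset_refl _ base) c.
have -> : (alg : R^o -> Q) @^-1` img I = I.
  apply/seteqP; split=> [a [b Ib /(alg_inj tf) <-] //|a Ia].
  by exists a.
have -> // : (alg : R^o -> Q) @^-1` base = setT.
by apply/seteqP; split=> // a _; exists a.
Qed.

Lemma ideal_pow_submod (I : ideal R) n : @is_submodule R R^o (ideal_pow I n).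
Proof. by case: n => [|n] //=; exact: span_submod. Qed.

Lemma hilbert_slope_multiplicity (I : ideal R) e : fractional (img I) ->
  hilbert_slope m (img I) e -> multiplicity I = e.
Proof.
move=> fI [N [c h]].
have col n : colength (ideal_pow I n : set R^o) = lgt m (powq (img I) n) base.
  rewrite -image_ideal_pow; apply: colength_lgt; first exact: ideal_pow_submod.
  by rewrite image_ideal_pow; exact: powq_frac.
have hm : is_multiplicity I e.
  exists (c%:Z - (lgt m (powq (img I) N) base)%:Z), N => n /h; rewrite col; lia.
apply: xget_unique => // e' [c' [N' h']].
pose k := (N + N')%N.
have h1 := h' k (leq_addl _ _); have h2 := h' k.+1 (leqW (leq_addl _ _)).
have h3 := h k (leq_addr _ _); have h4 := h k.+1 (leqW (leq_addr _ _)).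
rewrite !col in h1 h2; nia.
Qed.

End Multiplicity.

(** * The ring m : m *)

(** [Q] as an algebra over the intermediate ring [A = m : m], under another name
    because [Q] already carries the structure of an algebra over [R]. *)
Section OverColon.
Variables (R : comNzRingType) (Q : comAlgType R) (m : ideal R).

Definition over_colon : Type := let _ := m in Q.
HB.instance Definition _ := GRing.ComNzRing.copy over_colon Q.

Definition over_colon_scale (a : colon_ring Q m) (q : over_colon) : over_colon :=
  (colon_val a : over_colon) * q.

Lemma over_colon_scaleA a b q :
  over_colon_scale a (over_colon_scale b q) = over_colon_scale (a * b) q.
Proof. by rewrite /over_colon_scale mulrA. Qed.
Lemma over_colon_scale1 : left_id 1 over_colon_scale.
Proof. by move=> q; rewrite /over_colon_scale mul1r. Qed.
Lemma over_colon_scaleDr : right_distributive over_colon_scale +%R.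
Proof. by move=> a p q; rewrite /over_colon_scale mulrDr. Qed.
Lemma over_colon_scaleDl q : {morph over_colon_scale^~ q : a b / a + b}.
Proof. by move=> a b; rewrite /over_colon_scale mulrDl. Qed.

HB.instance Definition _ := GRing.Zmodule_isLmodule.Build (colon_ring Q m)
  over_colon over_colon_scaleA over_colon_scale1 over_colon_scaleDr
  over_colon_scaleDl.

Lemma over_colon_scaleAl (a : colon_ring Q m) (p q : over_colon) :
  a *: (p * q) = a *: p * q.
Proof. exact: mulrA. Qed.

HB.instance Definition _ := GRing.Lmodule_isLalgebra.Build (colon_ring Q m)
  over_colon over_colon_scaleAl.
HB.instance Definition _ := GRing.Lalgebra_isComAlgebra.Build (colon_ring Q m)
  over_colon.

Definition over_colon_comAlg : comAlgType (colon_ring Q m) := over_colon.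

Lemma over_colonZ (a : colon_ring Q m) (q : over_colon) :
  a *: q = ((colon_val a : Q) * (q : Q) : Q).
Proof. by []. Qed.
End OverColon.

Section Overring.
Variables (R : comNzRingType) (m : ideal R) (Q : comAlgType R).
Hypotheses (cm : cm1 m) (tf : total_fractions Q).
Let locm : local_units m := cm1_loc cm.
Local Notation A := (colon_ring Q m).
Local Notation QA := (over_colon_comAlg Q m).
Local Notation alg := (@emb R Q).
Local Notation base := (@ring_image R Q).
Local Notation mQ := ([set alg a | a in (m : set R)]).
Local Notation algA := (@emb A QA).
Local Notation AQ := (colq mQ mQ).

Lemma algAE (a : A) : algA a = colon_val a. Proof. exact: mulr1. Qed.

Lemma colon_val_inj : injective (@colon_val R Q m).
Proof. by move=> a b e; apply: val_inj. Qed.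

Lemma colonP q : reflect (AQ q) (q \in @colon R Q m).
Proof.
apply: (iffP (asboolP _)) => [h _ [x mx <-]|h x mx].
  by have [y my e] := h x mx; exists y.
by have [|y my e] := h (alg x); [exists x | exists y].
Qed.

Lemma baseA : @ring_image A QA = (AQ : set Q).
Proof.
apply/seteqP; split=> [_ [a _ <-]|q Aq]; first by rewrite algAE; apply/colonP/colon_valP.
have qA : q \in @colon R Q m by apply/colonP.
by exists (ColonRing qA) => //; rewrite algAE.
Qed.

Lemma colon_frac : fractional AQ.
Proof. by apply: colq_frac; exact: max_frac. Qed.

Lemma base_colon : base `<=` AQ.
Proof.
move=> _ [a _ <-] _ [x mx <-]; exists (a * x); last by rewrite algM.
by apply: submodMl => //; exact: ideal_submodule.
Qed.

Lemma colonM q p : AQ q -> AQ p -> AQ (q * p).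
Proof. by move=> hq hp u mu; rewrite -mulrA; apply: hq; apply: hp. Qed.

(** A regular element of [A] is a fraction over [R] whose numerator is then
    regular, so it is a unit of [Q]. *)
Lemma total_fractions_colon : total_fractions QA.
Proof.
have inA a : base a -> exists b : A, algA b = a.
  by move=> /base_colon; rewrite -baseA => -[b _ <-]; exists b.
split.
- move=> a; rewrite -[_%:A]/(algA a) algAE => e; apply: val_inj; exact: e.
- move=> s hs; have [a [t [ht e]]] := fracP tf (colon_val s).
  have na : nonzerodivisor a.
    move=> x ax; have [|x' ex] := inA (alg x); first by exists x.
    suff x0 : x' = 0.
      by apply: (alg_inj tf); rewrite -ex x0 /emb scale0r scale0r.
    apply: hs; apply: val_inj; rewrite /= -(algAE x') ex.
    have ut := (nzd_invertible tf t).1 ht; apply: (invertible_inj ut).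
    by rewrite /= mulrA e -algM ax /emb !scale0r mulr0.
  have : invertible (colon_val s : Q).
    have [p ep] := (nzd_invertible tf a).1 na.
    by exists (alg t * p); rewrite mulrA [_ * alg t]mulrC e.
  by case=> p ep; exists p; rewrite -[s%:A]/(algA s) algAE.
- move=> q; have [a [s [hs e]]] := fracP tf (q : Q).
  have [|a' ea] := inA (alg a); first by exists a.
  have [|s' es] := inA (alg s); first by exists s.
  exists a', s'; split; last by rewrite -[s'%:A]/(algA s') -[a'%:A]/(algA a') es ea.
  move=> x sx; apply: val_inj; have us := (nzd_invertible tf s).1 hs.
  apply: (invertible_inj us); rewrite /= mulr0 -es algAE.
  exact: (congr1 val sx).
Qed.

Lemma submod_over (N : set QA) : is_submodule N -> @is_submodule R Q N.
Proof.
move=> sN; split; first exact: (submod0 sN).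
move=> a u v Nu Nv; have : base (alg a) by exists a.
move=> /base_colon; rewrite -baseA => -[b _ eb].
by rewrite algZ -eb algAE; exact: (sN.2 b u v Nu Nv).
Qed.

Lemma over_submod (N : set Q) : @is_submodule R Q N ->
  (forall q u, AQ q -> N u -> N (q * u)) -> @is_submodule A QA N.
Proof.
move=> sN h; split; first exact: (submod0 sN).
move=> a u v Nu Nv; apply: (submodD sN) => //; apply: h => //.
exact/colonP/colon_valP.
Qed.

Variables (M : ideal A) (hM : local_ring M).
Local Notation MQ := ([set algA a | a in (M : set A)] : set Q).

Lemma colon_acc : acc [set: A^o].
Proof.
have aQ := frac_acc cm tf colon_frac.
have aAQ : @acc A QA AQ.
  move=> G G0 GL; apply: (aQ G G0) => N GN; have [sN NA] := GL N GN.
  by split=> //; exact: submod_over.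
apply: (acc_inj (f := algA : A^o -> QA) _ _ _ aAQ) => //.
- exact: alg_lin.
- by apply: alg_inj; exact: total_fractions_colon.
- by move=> _ [a _ <-]; rewrite -baseA; exists a.
Qed.

Let locM : local_units M := acc_local_units colon_acc hM.

(** The inverse of an element of [m] does not map [m] into itself. *)
Lemma max_sub_over : mQ `<=` MQ.
Proof.
move=> _ [x mx <-]; have : base (alg x) by exists x.
move=> /base_colon; rewrite -baseA => -[a _ ea]; exists a => //.
apply: contrapT => /locM.2[b eb]; apply: locm.1.
have /colonP : colon_val b \in @colon R Q m by exact: colon_valP.
move=> /(_ (alg x)) [|y my ey]; first by exists x.
suff <- : y = 1 by [].
apply: (alg_inj tf); rewrite ey -ea algAE alg1.
exact: (congr1 val eb).
Qed.

Lemma over_max_frac : @fractional R Q MQ.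
Proof.
have sM : is_submodule MQ.
  exact: (submod_over (image_submod (@alg_lin A QA) (ideal_submodule M))).
apply: (frac_between (max_frac Q cm) colon_frac sM max_sub_over).
by move=> _ [a _ <-]; rewrite -baseA; exists a.
Qed.

Lemma over_max_sub : MQ `<=` AQ.
Proof. by move=> _ [a _ <-]; rewrite -baseA; exists a. Qed.

(** The residue degree of [A] over [R], as a length. *)
Definition res_deg : nat := lgt m MQ AQ.

Lemma res_degE : residue_degree m M = res_deg.
Proof.
have c := flP (frac_fl cm tf over_max_frac colon_frac over_max_sub).
have sMQ := frac_submod over_max_frac.
have mA a u : m a -> AQ u -> MQ (a *: u).
  move=> ma; rewrite -baseA => -[b _ <-].
  have [|c' Mc ec] := @max_sub_over (alg a); first by exists a.
  exists (c' * b); first by rewrite mulrC; exact: submodMl (ideal_submodule M) Mc.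
  by rewrite algZ -ec !algAE.
have h := (residue_dim_cser locm _ sMQ (frac_submod colon_frac) over_max_sub mA).2 c.
have inA a u : m a -> M (a *: u : A).
  move=> ma; have [|c' Mc ec] := @max_sub_over (alg a); first by exists a.
  suff -> : a *: u = u * c' by apply: submodMl => //; exact: ideal_submodule.
  by apply: val_inj; rewrite /= -(algAE c') ec algZ mulrC.
have sM : @is_submodule R A M.
  split; first exact: (submod0 (ideal_submodule M)).
  move=> a u v Mu Mv; apply: (submodD (ideal_submodule M)) => //.
  by rewrite -[u]mul1r scalerAl; apply: submodMl => //; exact: ideal_submodule.
apply: (residue_dimE locm sM (@setT_submod R A)) => //.
  by move=> a u ma _; apply: inA.
apply: (residue_dim_transfer (T := fun (q : Q) (a : A) => q = colon_val a)) h.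
- by [].
- by move=> a u v u' v' -> ->.
- move=> u; rewrite -baseA => -[a _ <-]; exists a => //.
  by rewrite algAE.
- by move=> a _; exists (colon_val a) => //; apply/colonP/colon_valP.
- move=> _ a ->; split=> [[b Mb]|Ma]; last by exists a; rewrite ?algAE.
  by rewrite algAE => /colon_val_inj <-.
Qed.

Lemma res_deg_gt0 : (0 < res_deg)%N.
Proof.
rewrite lt0n; apply/eqP => e0; apply: locM.1.
have := frac_lgt_eq0 cm tf over_max_frac colon_frac over_max_sub e0.
have /base_colon : base (1 : Q) by exists 1; rewrite ?alg1.
move=> + e; rewrite -e => -[a Ma]; rewrite algAE => e1.
by have <- : a = 1 by apply: val_inj.
Qed.

(** Every simple [A]-module is a copy of [A / M]. *)
Lemma lgt_restrict (X Y : set QA) n : @is_submodule A QA X ->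
  @is_submodule A QA Y -> X `<=` Y -> @cser R m Q X Y n ->
  exists2 k, cser M X Y k & n = (res_deg * k)%N.
Proof.
have cA := flP (frac_fl cm tf over_max_frac colon_frac over_max_sub).
have sMQ := frac_submod over_max_frac.
have ed0 := res_deg_gt0.
elim/ltn_ind: n X => n IH X sX sY XY c.
have sXR := submod_over sX; have sYR := submod_over sY.
have [e|/existsNP[v0 /not_implyP[Yv0 Xv0]]] := pselect (Y `<=` X).
  have eXY : X = Y by apply/seteqP.
  exists 0%N; first by rewrite eXY; exact: cser0.
  rewrite muln0; apply: (cser_uniq locm sXR c); rewrite -eXY; exact: cser0.
have sub v : Y v -> adjoin X v `<=` Y by move=> Yv; apply: adjoin_min.
have sadj v : @is_submodule R Q (adjoin X v) := submod_over (adjoin_submod v sX).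
have Xadj v : X `<=` adjoin X v by exact: adjoin_ext.
have fX v : Y v -> finite_length m (X : set Q) (adjoin X v).
  move=> Yv; have [|f _] := fl_split locm sXR (sadj v) (@Xadj v) (sub v Yv) => //.
  by exists n.
have [v [Yv Xv Mv]] : exists v, [/\ Y v, ~ X v & forall a, M a -> X (a *: v)].
  (* Choose [v] so that [X + A v] has least length over [R]; then [X + A a v]
     cannot be smaller for [a] in [M], unless it is [X]. *)
  pose len v := lgt m (X : set Q) (adjoin X v).
  have exl : exists l, `[< exists v, [/\ Y v, ~ X v & len v = l] >].
    by exists (len v0); apply/asboolP; exists v0.
  have [l /asboolP[v [Yv Xv ev]] lmin] := ex_minnP exl.
  exists v; split=> // a Ma; apply: contrapT => Xav.
  have Yav : Y (a *: v) by exact: submodZ.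
  have ss : adjoin X (a *: v) `<=` adjoin X v.
    apply: adjoin_min; [exact: adjoin_submod|exact: adjoin_ext|].
    by apply: (submodZ _ (adjoin_submod v sX)); exact: adjoin_in.
  have [f1 f2] := fl_split locm sXR (sadj _) (@Xadj (a *: v)) ss (fX v Yv).
  have := lgt_add locm sXR f1 f2.
  have : (l <= len (a *: v))%N by apply: lmin; apply/asboolP; exists (a *: v).
  rewrite -/(len v) -/(len _) ev => le1 le2.
  have e : adjoin X (a *: v) = adjoin X v.
    by apply: (lgt_eq0 (m := m) (sadj _) f2); lia.
  have : adjoin X (a *: v) v by rewrite e; exact: adjoin_in.
  case=> b Xb; apply: Xv.
  apply: (nakayama1 locM (N := X) (a := b * a) sX); last by rewrite -scalerA.
  exact: submodMl (ideal_submodule M) Ma.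
have cX : @cser R m Q X (adjoin X v) res_deg.
  have -> : adjoin X v = addS (X : set Q) [set (v : Q) * u | u in AQ].
    apply/seteqP; split=> [u [a Xu]|].
      exists (colon_val a * v) => //; exists (colon_val a); last by rewrite mulrC.
      exact/colonP/colon_valP.
    apply: (addS_min (sadj v) (@Xadj v)) => _ [q + <-]; rewrite -baseA => -[a _ <-].
    exists a; rewrite over_colonZ algAE mulrC subrr.
    exact: (submod0 sX).
  apply: (cser_push (mul_lin (v : Q)) sMQ sXR _ _ cA).
    move=> _ [_ [a Ma <-] <-]; rewrite algAE mulrC; exact: Mv.
  move=> u; rewrite -baseA => -[a _ <-]; rewrite algAE mulrC => Xav.
  exists a; rewrite ?algAE //; apply: contrapT => /locM.2[b eb]; apply: Xv.
  by rewrite -[v]scale1r -eb -scalerA; apply: submodZ.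
have [a [b [eab ca cb]]] := cser_split locm sXR (sadj v) (@Xadj v) (sub v Yv) c.
have ea := cser_uniq locm sXR ca cX.
have [|k ck ek] := IH b _ (adjoin X v) (adjoin_submod v sX) sY (sub v Yv) cb.
  by rewrite -eab ea -[X in (X < _)%N]add0n ltn_add2r.
exists (1 + k)%N; last by rewrite -eab ea ek mulnDr muln1.
apply: cser_trans ck; apply: cserS => //; exact: cser0.
Qed.

(** [A] is a fractional ideal of [R], so its ideals are Noetherian modules over [R]
    and its lengths are bounded by those over [R]. *)
Lemma cm1_colon : cm1 M.
Proof.
have tfA := total_fractions_colon.
split; [exact: locM|exact: colon_acc| |].
  have [x mx hx] := cm1_reg cm.
  have [|a Ma ea] := @max_sub_over (alg x); first by exists x.
  exists a => //; apply/(nzd_invertible tfA); rewrite ea.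
  exact/(nzd_invertible tf).
move=> z hz; have uz : invertible (colon_val z : Q).
  by have := (nzd_invertible tfA z).1 hz; rewrite algAE.
have fz := scl_frac tf uz colon_frac.
have zA : scl (colon_val z : Q) AQ `<=` AQ.
  by move=> _ [u Au <-]; apply: colonM => //; exact/colonP/colon_valP.
have [n c] := frac_fl cm tf fz colon_frac zA.
have sA : @is_submodule A QA AQ by rewrite -baseA; exact: base_submod.
have sz : @is_submodule A QA (scl (colon_val z : Q) AQ).
  exact: (scl_submod (Q := QA) _ sA).
have [k ck _] := lgt_restrict sz sA zA c.
exists k; have := cser_preimage (@alg_lin A QA) sz _ ck.
rewrite -baseA => /(_ (@subset_refl _ _)).
have -> : (algA : A^o -> QA) @^-1` @ring_image A QA = setT.
  by apply/seteqP; split=> // a _; exists a.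
have -> // : (algA : A^o -> QA) @^-1` scl (colon_val z : Q) (@ring_image A QA) =
    [set z * x | x in setT].
apply/seteqP; split=> [a [_ [b _ <-]]|_ [b _ <-]].
  by rewrite !algAE => e; exists b => //; apply: val_inj.
by exists (algA b); [exists b | rewrite !algAE].
Qed.

End Overring.

(** * The canonical degree *)

Section CanonicalDegree.
Variables (R : comNzRingType) (m : ideal R) (Q : comAlgType R).
Hypotheses (cm : cm1 m) (tf : total_fractions Q).
Let locm : local_units m := cm1_loc cm.
Local Notation alg := (@emb R Q).
Local Notation base := (@ring_image R Q).
Local Notation mQ := ([set alg a | a in (m : set R)]).
Local Notation img I := ([set alg a | a in (I : set R)]).

Lemma exists_multiplicity (I : ideal R) : fractional (img I) ->
  hilbert_slope m (img I) (multiplicity I).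
Proof.
move=> fI; have [e he] := exists_hilbert_slope cm tf fI (@img_base R Q I).
by rewrite (hilbert_slope_multiplicity cm tf fI he).
Qed.

(** Two canonical ideals differ by a fraction, and multiplication by a regular
    element changes the multiplicity and the colength by the same amount. *)
Lemma canonical_degree_unique (D D' : ideal R) :
  canonical_ideal m D -> canonical_ideal m D' ->
  (multiplicity D)%:Z - (@colength R R^o D)%:Z =
  (multiplicity D')%:Z - (@colength R R^o D')%:Z.
Proof.
move=> /(canonical_type_one cm tf) tD /(canonical_type_one cm tf) tD'.
have [p up e] := type_one_unique cm tf tD tD'.
have [a [b [hb ha ep]]] := invertible_fracP tf up.
have ua := (nzd_invertible tf a).1 ha; have ub := (nzd_invertible tf b).1 hb.
have fD := tD.1; have fD' := tD'.1.
have eab : scl (alg b) (img D) = scl (alg a) (img D') by rewrite e sclM ep.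
have s1 := hilbert_slope_scl cm tf hb fD (@img_base R Q D) (exists_multiplicity fD).
have s2 := hilbert_slope_scl cm tf ha fD' (@img_base R Q D') (exists_multiplicity fD').
have fbD := scl_frac tf ub fD.
have bb : scl (alg b) (img D) `<=` base.
  by apply: subset_trans (@img_base R Q D); apply: scl_sub; exact: frac_submod.
rewrite -eab in s2; have E1 := hilbert_slope_uniq cm tf fbD bb s1 s2.
have len z (I : ideal R) : nonzerodivisor z -> fractional (img I) ->
    lgt m (scl (alg z) (img I)) base =
    (lgt m (scl (alg z) base) base + colength (I : set R^o))%N.
  move=> hz fI; have uz := (nzd_invertible tf z).1 hz; have fb := base_frac Q.
  have ib := @img_base R Q I.
  rewrite (frac_lgt_add cm tf (scl_frac tf uz fI) (scl_frac tf uz fb) fb).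
  - rewrite (lgt_scl cm uz) //; last exact: (frac_fl cm tf).
      by rewrite addnC (colength_lgt cm tf (ideal_submodule I) fI).
    exact: frac_submod.
  - exact: sclS.
  - by apply: scl_sub; exact: base_submod.
have E2 := len b D hb fD; have E3 := len a D' ha fD'.
rewrite eab E3 in E2; move: E1 E2 {E3}.
move: (lgt m (scl (alg b) base) base) (lgt m (scl (alg a) base) base).
move: (multiplicity D) (multiplicity D') (colength _) (colength _).
by move=> x1 x2 x3 x4 x5 x6; lia.
Qed.

Lemma cdegE (D : ideal R) : canonical_ideal m D ->
  cdeg m = (multiplicity D)%:Z - (@colength R R^o D)%:Z.
Proof.
move=> cD; apply: xget_unique; first by exists D.
by move=> c [D' [cD' ->]]; apply: canonical_degree_unique.
Qed.

(** Noetherianity keeps a nonzero element from being divisible by all powers of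
    [y], so it is a unit times a power of [y]. *)
Lemma principal_max_dvr y : nonzerodivisor y -> m y ->
  (forall x, m x -> exists z, x = z * y) -> is_dvr m.
Proof.
move=> hy my gy; have [m1 mu] := locm.
have fact x : x <> 0 -> exists u v n, x = u * y ^+ n /\ v * u = 1.
  move=> x0.
  have [||_ [w [n [ex <-]]] maxw] := cm1_acc cm (F := [set J | exists w n,
      x = w * y ^+ n /\ [set a * w | a in [set: R]] = J]).
  - by exists [set a * x | a in [set: R]]; exists x, 0%N; rewrite expr0 mulr1.
  - move=> _ [w [n [_ <-]]]; split=> //; split; first by exists 0; rewrite ?mul0r.
    move=> a _ _ [b _ <-] [c _ <-]; exists (a * b + c) => //.
    by rewrite mulrDl -mulrA.
  have [mw|/mu[v ev]] := pselect (m w); last by exists w, v, n.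
  have [z ez] := gy w mw; case: x0.
  have ww : [set a * z | a in [set: R]] = [set a * w | a in [set: R]].
    apply: maxw; first by exists z, n.+1; rewrite exprS mulrA -ez.
    by move=> _ [a _ <-]; exists (a * y) => //; rewrite -mulrA [y * z]mulrC -ez.
  have [a _ ea] : [set a * w | a in [set: R]] z by rewrite -ww; exists 1; rewrite ?mul1r.
  have z0 : z = 0.
    apply: (nakayama1 locm (N := [set 0] : set R^o) (a := a * y)).
    - by split=> // b u v -> ->; rewrite scaler0 addr0.
    - by apply: submodMl => //; exact: ideal_submodule.
    - by rewrite /= regZ -mulrA [y * z]mulrC -ez ea subrr.
  by rewrite ex ez z0 !mul0r.
split.
- move=> a b ab; have [->|a0] := pselect (a = 0); [by left|right].
  have [u [v [n [ea vu]]]] := fact a a0; apply: (nzdX (n := n) hy).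
  by rewrite -[_ * b]mul1r -vu -mulrA [u * _]mulrA -ea ab mulr0.
- move=> I; have sI := ideal_submodule I.
  have [I0|nI0] := pselect ((I : set R) `<=` [set 0]).
    exists 0; apply/seteqP; split=> [x /I0->|_ [x _ <-]].
      by exists 0; rewrite ?mulr0.
    by rewrite mulr0; exact: submod0 sI.
  have powI x : I x -> x <> 0 -> exists n, I (y ^+ n) /\ exists u, x = u * y ^+ n.
    move=> Ix /fact[u [v [n [ex vu]]]]; exists n; split; last by exists u.
    by rewrite -[y ^+ n]mul1r -vu -mulrA -ex; apply: submodMl.
  have exn : exists n, `[< I (y ^+ n) >].
    have /existsNP[x /not_implyP[Ix x0]] := nI0.
    by have [n [In _]] := powI x Ix x0; exists n; apply/asboolP.
  have [n /asboolP In nmin] := ex_minnP exn.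
  exists (y ^+ n); apply/seteqP; split=> [x Ix|_ [x _ <-]]; last exact: submodMl.
  have [->|x0] := pselect (x = 0); first by exists 0; rewrite ?mul0r.
  have [k [Ik [u ->]]] := powI x Ix x0.
  have le : (n <= k)%N by apply: nmin; apply/asboolP.
  by exists (u * y ^+ (k - n)) => //; rewrite -mulrA -exprD subnK.
- move=> m0; have y0 : y = 0 by move: my; rewrite m0.
  by apply: m1; rewrite (hy 1) ?y0 ?mul0r //; exact: submod0 (ideal_submodule m).
Qed.

(** An element of [R : m] outside [m : m] maps [m] onto [R], so its inverse
    generates [m]. *)
Lemma colon_max_base : ~ is_dvr m -> colq base mQ = colq mQ mQ.
Proof.
move=> ndvr; apply/seteqP; split; last first.
  by move=> q hq u /hq[a _ <-]; exists a.
move=> q hq _ [x mx <-]; have [|a _ ea] := hq (alg x); first by exists x.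
have [ma|/locm.2[b ba]] := pselect (m a); first by exists a.
case: ndvr; have q1 : q * alg (b * x) = 1.
  by rewrite algM mulrCA -ea -algM ba alg1.
have ubx : invertible (alg (b * x)) by exact: invertible_inv q1.
apply: (principal_max_dvr (y := b * x)); first exact/(nzd_invertible tf).
  by apply: submodMl => //; exact: ideal_submodule.
move=> z mz; have [|c _ ec] := hq (alg z); first by exists z.
exists c; apply: (alg_inj tf); rewrite algM ec mulrAC q1 mul1r.
by [].
Qed.

Lemma cm_type_ring n : cser m base (colq base mQ) n -> cm_type m R^o = n.
Proof.
move=> c; apply: (cm_typeE cm); apply/(cser_type cm (f := idfun) _ tf) => //.
have -> // : [set alg a | a in range (idfun : R^o -> R^o)] = base.
by apply/seteqP; split=> [_ [a _ <-]|_ [a _ <-]]; [exists a | exists a => //; exists a].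
Qed.

End CanonicalDegree.

Section MainComputation.
Variables (R : comNzRingType) (m : ideal R) (Q : comAlgType R).
Hypotheses (cm : cm1 m) (tf : total_fractions Q) (ndvr : ~ is_dvr m).
Let locm : local_units m := cm1_loc cm.
Local Notation A := (colon_ring Q m).
Local Notation QA := (over_colon_comAlg Q m).
Local Notation alg := (@emb R Q).
Local Notation base := (@ring_image R Q).
Local Notation mQ := ([set alg a | a in (m : set R)]).
Local Notation algA := (@emb A QA).
Local Notation AQ := (colq mQ mQ).
Variables (M : ideal A) (hM : local_ring M).
Local Notation MQ := ([set algA a | a in (M : set A)] : set Q).
Let cmA : cm1 M := cm1_colon cm tf hM.
Let tfA : total_fractions QA := total_fractions_colon m tf.
Variables (D : ideal R) (cD : canonical_ideal m D).
Local Notation DQ := ([set alg a | a in (D : set R)]).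
Let tD : type_one m DQ := canonical_type_one cm tf cD.
Let fD : fractional DQ := tD.1.
Let sD : is_submodule DQ := frac_submod fD.
Local Notation KQ := (prodq DQ mQ).
Local Notation e := (res_deg M).
Local Notation r := (lgt m base AQ).

(** [A = R : m = (D : D) : m = D : m D], and [m D] is its own double dual. *)
Lemma product_dual : colq DQ AQ = KQ.
Proof.
have fK : fractional KQ by apply: prodq_frac => //; exact: max_frac.
rewrite -(colon_max_base cm tf ndvr) -(dual_self cm tf tD) -colq_prodq //.
by apply: (dualK cm tf tD); rewrite prodqC; apply: prodq_frac => //; exact: max_frac.
Qed.

Lemma product_over : @is_submodule A QA KQ.
Proof.
apply: over_submod; first exact: prodq_submod.
move=> q u Aq; rewrite -product_dual => hu v Av.
by rewrite mulrAC mulrC; apply: hu; rewrite mulrC; apply: colonM.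
Qed.

Let K : ideal A := Ideal (preimage_submod (@alg_lin A QA) product_over).
Local Notation KA := ([set algA a | a in (K : set A)]).

Lemma product_base : KQ `<=` base.
Proof. by apply: prodq_base; exact: img_base. Qed.

Lemma product_image : KA = KQ.
Proof.
apply/seteqP; split=> [_ [a Ka <-] //|u Ku].
have := @base_colon R m Q _ (product_base Ku); rewrite -baseA => -[a _ ea].
by exists a => //; rewrite /K /= /preimage /= ea.
Qed.

(** Over [R] the ideal [m D] is [D : A], so [m D : M] is [D : M], and duality turns
    the quotient of the two into [A / M], of length [e] over [R]. *)
Lemma product_type_one : type_one M KA.
Proof.
rewrite product_image.
have fK : @fractional R Q KQ by apply: prodq_frac => //; exact: max_frac.
have fMQ := over_max_frac cm tf hM.
have sKM : @is_submodule A QA (colq KQ MQ) := @colq_submod A QA _ _ product_over.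
have eKM : colq KQ MQ = colq DQ MQ.
  rewrite -product_dual -colq_prodq //; congr (colq _ _).
  apply/seteqP; split.
    apply: prodq_min; first exact: frac_submod.
    move=> u v; rewrite -baseA => -[a _ <-] [b Mb <-].
    exists (a * b); last by rewrite algM.
    by apply: submodMl => //; exact: ideal_submodule.
  move=> u Mu; rewrite -[u]mul1r; apply: prodq_in => //.
  by apply: base_colon; exists 1; rewrite ?alg1.
have KM : KQ `<=` colq KQ MQ.
  move=> u Ku _ [a _ <-]; rewrite algAE mulrC; exact: (submodZ a product_over Ku).
have c : @cser R m Q KQ (colq KQ MQ) e.
  rewrite /res_deg -(dual_lgt cm tf tD fMQ (colon_frac Q cm) (@over_max_sub _ _ _ M)).
  rewrite product_dual eKM; apply: flP; apply: (frac_fl cm tf) => //.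
    exact: colq_frac.
  by rewrite -eKM.
split.
  split; first exact: product_over.
    exists 1; first exact: nzd1.
    rewrite alg1 scl1 baseA => u /product_base; exact: base_colon.
  have [_ _ [t ht Kt]] := fK; have : KA (alg t) by rewrite product_image.
  case=> a _ ea; exists a; last by rewrite ea.
  by apply/(nzd_invertible tfA); rewrite ea; exact/(nzd_invertible tf).
have [k ck ek] := lgt_restrict cm tf hM product_over sKM KM c.
have e0 := res_deg_gt0 cm tf hM.
suff -> : 1%N = k by [].
by apply/eqP; rewrite -(eqn_pmul2l e0) -ek muln1.
Qed.

Lemma product_powq n : @powq A QA KQ n.+1 = powq KQ n.+1.
Proof.
have fK : @fractional R Q KQ by apply: prodq_frac => //; exact: max_frac.
have sK := product_over.
elim: n => [|n IH].
  rewrite (powq1 (Q := Q) fK) /= baseA; apply/seteqP; split.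
    apply: (prodq_min (Q := QA) sK) => u v Ku; rewrite -baseA => -[a _ <-].
    by rewrite algAE mulrC; exact: (submodZ a sK Ku).
  move=> u Ku; rewrite -[u]mulr1; apply: (prodq_in (Q := QA)) => //.
  by apply: base_colon; exists 1; rewrite ?alg1.
rewrite /= -/(@powq A QA KQ n.+1) IH; set X := powq KQ n.+1.
apply/seteqP; split; last first.
  apply: (prodq_min (Q := Q) (submod_over (prodq_submod (Q := QA) KQ X))).
  by move=> u v Ku Xv; apply: (prodq_in (Q := QA)).
apply: (prodq_min (Q := QA)); last by move=> u v Ku Xv; apply: prodq_in.
apply: over_submod; first exact: prodq_submod.
move=> q w Aq; suff : prodq KQ X `<=` (fun w => q * w) @^-1` prodq KQ X by apply.
apply: prodq_min; first exact: (preimage_submod (mul_lin q) (prodq_submod _ _)).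
move=> u v Ku Xv; rewrite /preimage /= mulrA; apply: prodq_in => //.
move: Aq; rewrite -baseA => -[a _ <-]; rewrite algAE; exact: (submodZ a sK Ku).
Qed.

Lemma lgt_over (X Y : set QA) : @is_submodule A QA X -> @is_submodule A QA Y ->
  X `<=` Y -> @finite_length R m Q X Y -> @lgt R m Q X Y = (e * lgt M X Y)%N.
Proof.
move=> sX sY XY f; have [k ck ->] := lgt_restrict cm tf hM sX sY XY (flP f).
by rewrite (lgtE (cm1_loc cmA) sX ck).
Qed.

Lemma type_colon : cm_type m R^o = r.
Proof.
apply: (cm_type_ring cm tf); rewrite (colon_max_base cm tf ndvr); apply: flP.
by apply: (frac_fl cm tf); [exact: base_frac|exact: colon_frac|exact: base_colon].
Qed.

(** Add up [A / R], [R / D] and [D / m D]; the outer two have length [r]. *)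
Lemma colength_over : (e * @colength A A^o K = r + r + @colength R R^o D)%N.
Proof.
have fK : @fractional R Q KQ by apply: prodq_frac => //; exact: max_frac.
have fKA : fractional KA by exact: product_type_one.1.
have sA : @is_submodule A QA AQ by rewrite -baseA; exact: base_submod.
have fA := colon_frac Q cm; have fb := base_frac Q.
have bA := @base_colon R m Q.
have Kb := product_base; have KA' : KQ `<=` AQ := subset_trans Kb bA.
rewrite (colength_lgt cmA tfA (ideal_submodule K) fKA) product_image baseA.
rewrite -lgt_over //; [|exact: product_over|exact: (frac_fl cm tf)].
have KD : KQ `<=` DQ.
  apply: prodq_min => // u _ Du [a _ <-]; rewrite mulrC -algZ.
  exact: (submodZ a sD Du).
have Db := @img_base R Q D.
rewrite (frac_lgt_add cm tf fK fb fA Kb bA) (frac_lgt_add cm tf fK fD fb KD Db).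
rewrite (colength_lgt cm tf (ideal_submodule D) fD).
rewrite -(type_generators cm tf tD) (colon_max_base cm tf ndvr); lia.
Qed.

(** The powers of [m D] are the same over both rings, and [A / R] contributes only
    a constant. *)
Lemma multiplicity_over :
  (e * @multiplicity A K = multiplicity D + multiplicity m)%N.
Proof.
have fK : @fractional R Q KQ by apply: prodq_frac => //; exact: max_frac.
have fKA : fractional KA by exact: product_type_one.1.
have fA := colon_frac Q cm; have fb := base_frac Q; have fm := max_frac Q cm.
have sA : @is_submodule A QA AQ by rewrite -baseA; exact: base_submod.
have bA := @base_colon R m Q.
have [N [c h]] := exists_multiplicity cmA tfA fKA.
have sl := hilbert_slope_prodq cm tf fD (@img_base R Q D) fm (@img_base R Q m)
  (exists_multiplicity cm tf fD) (exists_multiplicity cm tf fm).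
apply: (hilbert_slope_uniq cm tf fK product_base) sl.
have Pb n := powq_base product_base n.
have len n : (lgt m (powq KQ n.+1) base + r =
    e * lgt M (@powq A QA KA n.+1) (@ring_image A QA))%N.
  have PA : powq KQ n.+1 `<=` AQ := subset_trans (Pb n.+1) bA.
  rewrite product_image baseA -lgt_over //.
  - by rewrite product_powq (frac_lgt_add cm tf (powq_frac fK n.+1) fb fA (Pb n.+1) bA).
  - exact: (powq_submod (Q := QA) KQ n.+1).
  - by rewrite product_powq.
  - by rewrite product_powq; apply: (frac_fl cm tf) => //; exact: powq_frac.
exists N.+1, (e * multiplicity K * N.+1)%N => -[|n] // le.
have h1 := h n.+1 (leq_trans (leqnSn N) le); have h2 := h N.+1 (leqnSn N).
have l1 := len n; have l2 := len N.
have {h1 h2} H : (lgt M (powq KA n.+1) (ring_image (Q := QA)) + multiplicity K * N.+1 =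
    multiplicity K * n.+1 + lgt M (powq KA N.+1) (ring_image (Q := QA)))%N.
  move: h1 h2; move: (lgt M _ _) (lgt M _ _) (lgt M _ _) => x y z.
  by move: (multiplicity K * _)%N (multiplicity K * _)%N => u v; lia.
have := congr1 (fun k => e * k)%N H; rewrite !mulnDr !mulnA -l1 -l2.
move: (e * _ * _)%N (e * _ * _)%N (lgt m _ _) (lgt m _ _) (lgt m _ _) => u v x y z.
lia.
Qed.

Lemma cdeg_over :
  (e%:Z * cdeg M = cdeg m + (multiplicity m)%:Z - 2 * (cm_type m R^o)%:Z)%R.
Proof.
rewrite (cdegE cm tf cD) (cdegE cmA tfA (type_one_canonical cmA tfA product_type_one)).
rewrite type_colon mulrBr -!PoszM colength_over multiplicity_over !PoszD.
move: (multiplicity D) (multiplicity m) (colength _) (lgt m _ _) => x y z u.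
lia.
Qed.

End MainComputation.

Theorem theorem12p3 (R : comNzRingType) (m : ideal R)
    (hR : cm_local_dim1 m)
    (hcan : exists D : ideal R, canonical_ideal m D)
    (hdvr : ~ is_dvr m)
    (Q : comAlgType R) (hQ : total_fractions Q)
    (M : ideal (colon_ring Q m)) (hM : local_ring M) :
  (cdeg M)%:~R =
    (residue_degree m M)%:R^-1 *
      ((cdeg m)%:~R + (multiplicity m)%:R - 2%:R * (cm_type m R^o)%:R) :> rat.
Proof.
have cm := cm_local_dim1_cm1 hR; have [D cD] := hcan.
have e0 := res_deg_gt0 cm hQ hM.
have H := cdeg_over cm hQ hdvr hM cD.
rewrite (res_degE cm hQ hM).
have e1 : (res_deg M)%:R != 0 :> rat by rewrite Num.Theory.pnatr_eq0 -lt0n.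
apply: (mulfI e1); rewrite mulVKf //.
have := congr1 (fun z : int => z%:~R : rat) H.
by rewrite !(rmorphM, rmorphD, rmorphN) /= => ->.
Qed.
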